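(* Let $n\geq 2$ be an integer and let $P(X)=a_nX^n+a_{n-1}X^{n-1}+\cdots+a_1X+a_0$ be a polynomial with real coefficients and $a_n\neq 0$. For integers $k,m$ set $$ Q(k,m)=\sum_{\ell=1}^n a_\ell\sum_{j=0}^{\ell-1}k^{\ell-1-j}m^j, \qquad E=\{Q(k,m) : k,m\in\mathbb{Z},\ k\neq m\}. $$ Let $(t_0,x_0)\in\mathbb{R}\times\mathbb{T}$ and $a\in\mathbb{R}$. For $u_0=\sum_{k\in\mathbb{Z}}c_ke^{2i\pi kx}\in A(\mathbb{T})$, let $u$ be the solution of $$ \begin{cases} i\,\partial_t u(t,x)=2\pi P\left(\dfrac{\partial_x}{2i\pi}\right)u(t,x),\\ u(0,x)=u_0(x)=\displaystyle\sum_{k\in\mathbb{Z}}c_ke^{2i\pi kx}. \end{cases} $$ Then: (1) If $a\notin E$, then for all $T>0$ there exists a constant $C=C(a,T)>0$ (independent of $u_0$) such that for every $u_0\in A(\mathbb{T})$, $$ \frac{1}{T}\int_0^T |u(t_0+t,x_0+at)|\,\mathrm{d}t \geq C\max_{k\in\mathbb{Z}}|c_k|. \qquad (\mathrm{I}) $$ If moreover $n$ is even, then for all $T>0$ there also exists a constant $C=C(a,T)>0$ (independent of $u_0$) such that for every $u_0\in A(\mathbb{T})$, $$ \frac{1}{T}\int_0^T |u(t_0+t,x_0+at)|\,\mathrm{d}t \geq C\sum_{k\in\mathbb{Z}}\frac{|c_k|}{1+|k|}. \qquad (\mathrm{II}) $$ (2) If $a\in E$, then both (I) and (II) fail; that is,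 for every $T>0$ there is no constant $C>0$ for which (I) holds for all $u_0\in A(\mathbb{T})$, and none for which (II) holds for all $u_0\in A(\mathbb{T})$.
   Context: $\mathbb{T}=\mathbb{R}/\mathbb{Z}$. The Wiener algebra $A(\mathbb{T})$ is the set of $f\in L^1(\mathbb{T})$ whose Fourier coefficients $c_k(f)=\int_0^1 f(x)e^{-2i\pi kx}\,\mathrm{d}x$ satisfy $\sum_{k\in\mathbb{Z}}|c_k(f)|<+\infty$. The operator $P\left(\frac{\partial_x}{2i\pi}\right)$ multiplies $e^{2i\pi kx}$ by $P(k)$, and for $u_0=\sum_{k}c_ke^{2i\pi kx}\in A(\mathbb{T})$ the solution of the equation is the continuous function given by the uniformly convergent series $$u(t,x)=\sum_{k\in\mathbb{Z}}c_ke^{-2i\pi P(k)t}e^{2i\pi kx},\qquad t\in\mathbb{R},\ x\in\mathbb{T}.$$ The point $x_0+at$ is understood modulo $1$. The constants may depend on the fixed polynomial $P$. *)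

(* Defs.v *)
From HB Require Import structures.
From mathcomp Require Import all_boot all_order all_algebra.
From mathcomp Require Import complex.
From mathcomp Require Import all_classical all_reals all_analysis.

Set Implicit Arguments.
Unset Strict Implicit.
Unset Printing Implicit Defensive.

Import Order.TTheory GRing.Theory Num.Theory.
Import numFieldNormedType.Exports.

Local Open Scope classical_set_scope.
Local Open Scope ring_scope.
Local Open Scope complex_scope.

Section Wiener_algebra.
Context {R : realType}.

(* The norm of the numeric field R[i] is R[i]-valued; this modulus is real. *)
Definition cmod (z : R[i]) : R := ComplexField.Normc.normc z.

(* e^{2 i pi y} *)
Definition cexp2pi (y : R) : R[i] :=
  cos (2 * pi * y) +i* sin (2 * pi * y).

(* MathComp-Analysis only integrates (extended) real functions. *)
Definition cintegral (D : set R) (f : R -> R[i]) : R[i] :=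
  (\int[lebesgue_measure]_(x in D) complex.Re (f x)) +i*
  (\int[lebesgue_measure]_(x in D) complex.Im (f x)).

(* Functions on R/Z are 1-periodic functions on R. *)
Definition L1_torus (f : R -> R[i]) : Prop :=
  [/\ forall x, f (x + 1) = f x,
      lebesgue_measure.-integrable `[0, 1] (fun x => (complex.Re (f x))%:E) &
      lebesgue_measure.-integrable `[0, 1] (fun x => (complex.Im (f x))%:E)].

Definition fourier_coef (f : R -> R[i]) (k : int) : R[i] :=
  cintegral `[0, 1] (fun x => f x * cexp2pi (- (k%:~R * x))).

Definition wiener_algebra (f : R -> R[i]) : Prop :=
  L1_torus f /\
  (\esum_(k in [set: int]) (cmod (fourier_coef f k))%:E < +oo)%E.

(* R[i] carries no canonical topology, so the limit of the symmetric partial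
   sums over -N <= k <= N is taken componentwise; it is meant for absolutely
   summable families. *)
Definition csum_int (F : int -> R[i]) : R[i] :=
  let S (N : nat) := \sum_(j < (2 * N).+1%N) F (j%:Z - N%:Z) in
  limn (fun N => complex.Re (S N)) +i* limn (fun N => complex.Im (S N)).

Definition solution (P : {poly R}) (u0 : R -> R[i]) (t x : R) : R[i] :=
  csum_int (fun k =>
    fourier_coef u0 k * cexp2pi (- (P.[k%:~R] * t)) * cexp2pi (k%:~R * x)).

Definition Qpoly (n : nat) (P : {poly R}) (k m : int) : R :=
  \sum_(1 <= l < n.+1)
    P`_l * \sum_(0 <= j < l) k%:~R ^+ (l - 1 - j) * m%:~R ^+ j.

Definition Eset (n : nat) (P : {poly R}) : set R :=
  [set q | exists k m : int, k != m /\ q = Qpoly n P k m].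

Definition line_mean (P : {poly R}) (a T t0 x0 : R) (u0 : R -> R[i]) : \bar R :=
  ((T^-1)%:E * \int[lebesgue_measure]_(t in `[0%R, T])
      (cmod (solution P u0 (t0 + t) (x0 + a * t)))%:E)%E.

(* The supremum is a maximum on the Wiener algebra, since the Fourier
   coefficients tend to 0. *)
Definition max_bound (P : {poly R}) (a T t0 x0 C : R) (u0 : R -> R[i]) : Prop :=
  (C%:E * ereal_sup (range (fun k : int => (cmod (fourier_coef u0 k))%:E))
     <= line_mean P a T t0 x0 u0)%E.

Definition weighted_sum_bound (P : {poly R}) (a T t0 x0 C : R)
    (u0 : R -> R[i]) : Prop :=
  (C%:E * (\esum_(k in [set: int])
             (cmod (fourier_coef u0 k) / (1 + `|k%:~R|))%:E)
     <= line_mean P a T t0 x0 u0)%E.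

End Wiener_algebra.

(* Main.v *)
(* On the line (t0 + t, x0 + a t) the solution is an almost periodic function
   f(t) = sum_k d_k e(lam_k t) with |d_k| = |c_k| and lam_k = a k - P(k), and
   lam_k - lam_m = (k - m) (a - Q(k, m)), so that a is outside E exactly when the
   lam_k are distinct. If a is in E, two plane waves cancel on the line.

   If the lam_k are distinct, then |lam_k - lam_m| >= c max(|k|, |m|) except for
   finitely many pairs: away from the diagonals k = m + s and k = s - m the leading
   term dominates, and on such a diagonal the gap is a nonconstant polynomial in k.
   For (I), given k0, the finitely many small frequencies other than lam_k0 are
   removed by differences f(t) - e(-lam_j c) f(t + c), each shortening the time
   interval a little; the remaining gaps are so large that the coefficient of
   largest modulus dominates after a triple averaging over short time windows.

   For (II) no Littlewood-type construction is needed, since the frequencies are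
   sparse. Let q^20 <= N. Averages over times of order 1 / (q^8 N^(n-1)) isolate the
   frequencies with ||k| - N| <= q^9, the others being controlled by (I). For k, k',
   m, m' in a block around N (or -N), lam_k + lam_k' - lam_m - lam_m' has size at
   least c N if k + k' <> m + m' and c |k - m| |k - m'| otherwise. Hence the L^4 norm
   of the isolated part F is nearly as small as its L^2 norm, and
   |F|^2 <= H |F| + |F|^4 / H^2 converts this into sum |d_k|^2 <= C q^6 |f|_1^2 over
   the block, so that sum |d_k| <= C q^7 |f|_1 over q^8 consecutive indices: better
   than (I) by a factor q. With q = 2^l for 2^(20 l) <= |k| < 2^(20 (l + 1)), the
   contributions to sum |c_k| / (1 + |k|) decay like 2^-l. *)
Require Import Defs.
From HB Require Import structures.
From mathcomp Require Import all_boot all_order all_algebra.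
From mathcomp Require Import complex polyrcf.
From mathcomp Require polyorder.
From mathcomp Require Import all_classical all_reals all_analysis.
From mathcomp Require Import ring lra zify.

Set Implicit Arguments.
Unset Strict Implicit.
Unset Printing Implicit Defensive.

Import Order.TTheory GRing.Theory Num.Theory.
Import numFieldNormedType.Exports.

Local Open Scope classical_set_scope.
Local Open Scope ring_scope.

(** * Integrals over [0, T] of continuous real functions: primitives, shifts, moving averages *)

Section Integral0.
Context {R : realType}.
Implicit Types (g h : R -> R) (T : R).

Definition int0 T g : R := \int[lebesgue_measure]_(x in `[0, T]) g x.

Lemma continuous_integrable T g : continuous g ->
  lebesgue_measure.-integrable `[0, T] (EFin \o g).
Proof.
move=> cg; apply: continuous_compact_integrable; first exact: segment_compact.
exact: continuous_subspaceT.
Qed.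

Lemma eq_int0 T g h : g =1 h -> int0 T g = int0 T h.
Proof. by move=> gh; congr (int0 T _); apply/funext. Qed.

Lemma int0D T g h : continuous g -> continuous h ->
  int0 T (fun x => g x + h x) = int0 T g + int0 T h.
Proof.
by move=> cg ch; rewrite /int0 RintegralD//; exact: continuous_integrable.
Qed.

Lemma int0Z T r g : continuous g -> int0 T (fun x => r * g x) = r * int0 T g.
Proof.
by move=> cg; rewrite /int0 RintegralZl//; exact: continuous_integrable.
Qed.

Lemma continuous_sum (I : Type) (s : seq I) (F : I -> R -> R) :
  (forall i, continuous (F i)) -> continuous (fun x => \sum_(i <- s) F i x).
Proof.
move=> cF; elim: s => [|i s ih] x.
  by under eq_fun do rewrite big_nil; exact: cvg_cst.
by under eq_fun do rewrite big_cons; apply: cvgD; [exact: cF|exact: ih].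
Qed.

Lemma int0_sum T (I : Type) (s : seq I) (F : I -> R -> R) :
  (forall i, continuous (F i)) ->
  int0 T (fun x => \sum_(i <- s) F i x) = \sum_(i <- s) int0 T (F i).
Proof.
move=> cF; elim: s => [|i s ih].
  rewrite big_nil; under eq_int0 do rewrite big_nil.
  by rewrite /int0 Rintegral_cst// mul0r.
under eq_int0 do rewrite big_cons.
by rewrite int0D ?ih ?big_cons//; exact: continuous_sum.
Qed.

Lemma le_int0 T g h : continuous g -> continuous h ->
  (forall x, 0 <= x <= T -> g x <= h x) -> int0 T g <= int0 T h.
Proof.
move=> cg ch gh; apply: le_Rintegral => //; exact: continuous_integrable.
Qed.

Lemma int0_ge0 T g : (forall x, 0 <= g x) -> 0 <= int0 T g.
Proof. by move=> g0; apply: Rintegral_ge0. Qed.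

Lemma int0_cst T r : 0 <= T -> int0 T (fun=> r) = r * T.
Proof.
move=> T0; rewrite /int0 Rintegral_cst//= lebesgue_measure_itv/= lte_fin.
by case: ltP => //= T0'; rewrite ?subr0// (le_anti (introT andP (conj T0 T0'))) ?mulr0.
Qed.

(** The derivative of [G] is required on [- 2^-1 < x] rather than on [0, T], so that 0 is an
    interior point and two-sided derivatives make sense there. *)
Lemma int0_FTC2 T g (G : R -> R) : 0 <= T -> continuous g ->
  (forall x : R, - 2^-1 < x -> is_derive x 1 G (g x)) -> int0 T g = G T - G 0.
Proof.
move=> T0 cg dG; have [->|Tn0] := eqVneq T 0.
  by rewrite subrr /int0 set_itv1 Rintegral_set1.
have {Tn0}T0 : 0 < T by rewrite lt_neqAle eq_sym Tn0.
have dx (x : R) : 0 <= x -> is_derive x 1 G (g x) by move=> x0; apply: dG; lra.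
have cG (x : R) : 0 <= x -> {for x, continuous G}.
  move=> x0; apply: differentiable_continuous; apply/derivable1_diffP.
  by have := dx x x0 => -[].
rewrite /int0 /Rintegral (@continuous_FTC2 _ g G)//.
- exact: continuous_subspaceT.
- split.
  + by move=> x; rewrite in_itv/= => /andP[x0 _]; have [] := dx x (ltW x0).
  + by apply: cvg_at_right_filter; exact: cG.
  + by apply: cvg_at_left_filter; apply: cG; exact: ltW.
- move=> x; rewrite in_itv/= => /andP[x0 _].
  by have dxx := dx x (ltW x0); rewrite derive1E; exact: derive_val.
Qed.

(** The primitive is the integral from [b], which is differentiable to the right of [b]. Primitives
    of primitives are taken by moving the left end from -1 to -3/4 and then to -1/2. *)
Lemma primitive_exists (a b : R) g : a < b ->
  (forall x : R, a < x -> {for x, continuous g}) ->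
  exists G : R -> R, forall x : R, b < x -> is_derive x 1 G (g x).
Proof.
move=> ab cg; exists (fun x => \int[lebesgue_measure]_(t in `[b, x]) g t) => x bx.
have xx : x < x + 1 by lra.
have gi : lebesgue_measure.-integrable `[b, x + 1] (EFin \o g).
  apply: continuous_compact_integrable; first exact: segment_compact.
  apply: continuous_in_subspaceT => y; rewrite inE /= in_itv/= => /andP[by_ _].
  by apply: cg; exact: lt_le_trans by_.
have [dF F'] := continuous_FTC1_closed xx gi bx (cg x (lt_trans ab bx)).
by split; [exact: dF|rewrite -derive1E].
Qed.

Lemma derive_mono (a : R) (G : R -> R) g : (forall x : R, a < x -> is_derive x 1 G (g x)) ->
  (forall x, a < x -> 0 <= g x) -> forall x y, a < x -> x <= y -> G x <= G y.
Proof.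
move=> dG g0 x y ax xy.
have [||c + GE] := @MVT_segment _ G g x y xy.
- move=> z; rewrite in_itv/= => /andP[xz _]; apply: dG; exact: lt_trans xz.
- apply: continuous_in_subspaceT => z; rewrite inE /= in_itv/= => /andP[xz _].
  apply: differentiable_continuous; apply/derivable1_diffP.
  by have [] := dG z (lt_le_trans ax xz).
- rewrite in_itv/= => /andP[xc _]; rewrite -subr_ge0 GE mulr_ge0 ?subr_ge0//.
  exact/g0/(lt_le_trans ax).
Qed.

Lemma is_derive_shift (G : R -> R) (c x dG : R) : is_derive (x + c) 1 G dG ->
  is_derive x 1 (fun y => G (y + c)) dG.
Proof.
move=> dGx.
have h : is_derive x 1 (fun y : R => y + c) (1 + 0).
  by apply: is_deriveD.
have := is_derive1_comp (f := G) (g := fun y : R => y + c) (x := x).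
move=> /(_ _ _ dGx h); rewrite addr0 mulr1 => H; exact: H.
Qed.

Lemma continuous_shift g c : continuous g -> continuous (fun x => g (x + c)).
Proof.
move=> cg x; apply: (@continuous_comp _ _ _ (fun x : R => x + c) g); last exact: cg.
by apply: cvgD; [exact: cvg_id|exact: cvg_cst].
Qed.

(** For a primitive [G] of [g] the two sides are G(T + c) - G(c) and G(T + c) - G(0), and [G] is
    nondecreasing. *)
Lemma int0_shift_le T c g : 0 <= T -> 0 <= c -> continuous g ->
  (forall x, 0 <= g x) -> int0 T (fun x => g (x + c)) <= int0 (T + c) g.
Proof.
move=> T0 c0 cg g0.
have [G dG] : exists G : R -> R, forall x : R, - 2^-1 < x -> is_derive x 1 G (g x).
  by apply: (@primitive_exists (- 1)); [lra|move=> x _; exact: cg].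
have -> : int0 T (fun x => g (x + c)) = G (T + c) - G (0 + c).
  apply: (int0_FTC2 (G := fun x => G (x + c))) => //; first exact: continuous_shift.
  by move=> x x0; apply: is_derive_shift; apply: dG; lra.
rewrite (int0_FTC2 (addr_ge0 T0 c0) cg dG) add0r lerD2l lerN2.
by apply: (derive_mono dG) => //; lra.
Qed.

Lemma int0_mono T T' g : 0 <= T -> T <= T' -> continuous g ->
  (forall x, 0 <= g x) -> int0 T g <= int0 T' g.
Proof.
move=> T0 TT' cg g0.
have [G dG] : exists G : R -> R, forall x : R, - 2^-1 < x -> is_derive x 1 G (g x).
  by apply: (@primitive_exists (- 1)); [lra|move=> x _; exact: cg].
rewrite (int0_FTC2 T0 cg dG) (int0_FTC2 (le_trans T0 TT') cg dG) lerD2r.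
by apply: (derive_mono dG) => //; lra.
Qed.

(* With [G' = g] and [K' = G], the integral over [0 <= s <= T] of the bound on
   [h s] is [(K (T + c) - K T) - (K c - K 0)], and [G 0 <= G <= G (T + c)]. *)
Lemma int0_average T c g : 0 <= T -> 0 <= c -> continuous g ->
  (forall x, 0 <= g x) -> forall h, continuous h ->
  (forall s, 0 <= s <= T -> h s <= int0 c (fun t => g (t + s))) ->
  int0 T h <= c * int0 (T + c) g.
Proof.
move=> T0 c0 cg g0 h ch hg.
have [G dG1] : exists G : R -> R, forall x : R, - (3/4) < x -> is_derive x 1 G (g x).
  by apply: (@primitive_exists (- 1)); [lra|move=> x _; exact: cg].
have dG (x : R) : - 2^-1 < x -> is_derive x 1 G (g x) by move=> ?; apply: dG1; lra.
have cG (x : R) : - (3/4) < x -> {for x, continuous G}.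
  move=> x0; apply: differentiable_continuous; apply/derivable1_diffP.
  by have [] := dG1 x x0.
have [K dK] : exists K : R -> R, forall x : R, - 2^-1 < x -> is_derive x 1 K (G x).
  by apply: (@primitive_exists (- (3/4))); [lra|exact: cG].
have [H dH] : exists H : R -> R, forall x : R, - 2^-1 < x -> is_derive x 1 H (h x).
  by apply: (@primitive_exists (- 1)); [lra|move=> x _; exact: ch].
have Gmono x y : 0 <= x -> x <= y -> G x <= G y.
  by move=> x0; apply: (derive_mono dG); [move=> *; exact: g0|lra].
rewrite (int0_FTC2 T0 ch dH) (int0_FTC2 (addr_ge0 T0 c0) cg dG).
pose D x := K (x + c) - K x - H x.
have dD (x : R) : - 2^-1 < x -> is_derive x 1 D (G (x + c) - G x - h x).
  move=> x0; apply: is_deriveB; last exact: dH.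
  apply: is_deriveB; last exact: dK.
  by apply: is_derive_shift; apply: dK; lra.
have D0T : D 0 <= D T.
  have [||z + DE] := @MVT_segment _ D (fun x => G (x + c) - G x - h x) 0 T T0.
  - move=> z; rewrite in_itv/= => /andP[z0 _]; apply: dD; lra.
  - apply: continuous_in_subspaceT => z; rewrite inE /= in_itv/= => /andP[z0 _].
    apply: differentiable_continuous; apply/derivable1_diffP.
    by have [|] := dD z; first lra.
  - rewrite in_itv/= => /andP[z0 zT]; rewrite -subr_ge0 DE mulr_ge0 ?subr_ge0//.
    have := hg z; rewrite z0 zT => /(_ isT).
    have -> : int0 c (fun t => g (t + z)) = G (c + z) - G (0 + z).
      apply: (int0_FTC2 (G := fun x => G (x + z))) => //; first exact: continuous_shift.
      by move=> x x0; apply: is_derive_shift; apply: dG; lra.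
    by rewrite add0r (addrC c).
have Kup a b : 0 <= a -> a <= b -> (b - a) * G a <= K b - K a <= (b - a) * G b.
  move=> a0 ab; have [||z + KE] := @MVT_segment _ K G a b ab.
  - move=> z; rewrite in_itv/= => /andP[z0 _]; apply: dK; lra.
  - apply: continuous_in_subspaceT => z; rewrite inE /= in_itv/= => /andP[z0 _].
    apply: differentiable_continuous; apply/derivable1_diffP.
    by have [|] := dK z; first lra.
  - rewrite in_itv/= => /andP[za zb]; rewrite KE (mulrC (G z)).
    by rewrite !ler_wpM2l ?subr_ge0 ?Gmono//; lra.
have /andP[K1 _] := Kup 0 c (lexx _) c0.
have Tc : T <= T + c by lra.
have /andP[_ K2] := Kup T (T + c) T0 Tc.
have Tc' : T + c - T = c by ring.
by move: D0T; rewrite /D add0r; move: K1 K2; rewrite subr0 Tc'; lra.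
Qed.

End Integral0.

#[local] Arguments cmod : simpl never.
#[local] Arguments cexp2pi : simpl never.

(** * The modulus of complex numbers and the exponentials e(y) = [cexp2pi y] *)

Section ComplexModulus.
Context {R : realType}.
Local Open Scope complex_scope.
Implicit Types (z w : R[i]).

Lemma cmodE z : cmod z = Num.sqrt (complex.Re z ^+ 2 + complex.Im z ^+ 2).
Proof. by case: z. Qed.

Lemma cmod_ge0 z : 0 <= cmod z.
Proof. by rewrite cmodE sqrtr_ge0. Qed.

Lemma cmod0 : cmod (0 : R[i]) = 0.
Proof. exact: ComplexField.Normc.normc0. Qed.

Lemma cmod1 : cmod (1 : R[i]) = 1.
Proof. exact: ComplexField.Normc.normc1. Qed.

Lemma cmod_eq0 z : cmod z = 0 -> z = 0.
Proof. exact: ComplexField.Normc.eq0_normc. Qed.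

Lemma cmodM z w : cmod (z * w) = cmod z * cmod w.
Proof. exact: ComplexField.Normc.normcM. Qed.

Lemma cmodX z n : cmod (z ^+ n) = cmod z ^+ n.
Proof. by elim: n => [|n ih]; rewrite ?expr0 ?cmod1// !exprS cmodM ih. Qed.

Lemma ler_cmodD z w : cmod (z + w) <= cmod z + cmod w.
Proof. exact: le_normcD. Qed.

Lemma cmodN z : cmod (- z) = cmod z.
Proof. exact: normcN. Qed.

Lemma ler_cmodB z w : cmod (z - w) <= cmod z + cmod w.
Proof. by rewrite -(cmodN w) ler_cmodD. Qed.

Lemma lerB_cmod z w : cmod z - cmod w <= cmod (z + w).
Proof. by have := ler_cmodB (z + w) w; rewrite addrK; lra. Qed.

Lemma cmod_real (r : R) : cmod r%:C = `|r|.
Proof. by rewrite cmodE /= expr0n addr0 sqrtr_sqr. Qed.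

Lemma cmod_conj z : cmod (conjc z) = cmod z.
Proof. by case: z => a b; rewrite !cmodE /= sqrrN. Qed.

Lemma ler_cmod_sum (I : Type) (s : seq I) (P : pred I) (F : I -> R[i]) :
  cmod (\sum_(i <- s | P i) F i) <= \sum_(i <- s | P i) cmod (F i).
Proof.
elim/big_ind2 : _ => [|a b c d ab cd|//]; first by rewrite cmod0.
by rewrite (le_trans (ler_cmodD _ _))// lerD.
Qed.

Lemma ler_Re_cmod z : `|complex.Re z| <= cmod z.
Proof.
by rewrite cmodE -(sqrtr_sqr (complex.Re z)) ler_wsqrtr// lerDl sqr_ge0.
Qed.

Lemma ler_Im_cmod z : `|complex.Im z| <= cmod z.
Proof.
by rewrite cmodE -(sqrtr_sqr (complex.Im z)) ler_wsqrtr// lerDr sqr_ge0.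
Qed.

Lemma Re_le_cmod z : complex.Re z <= cmod z.
Proof. exact: le_trans (ler_norm _) (ler_Re_cmod z). Qed.

Lemma cmod_le_ReIm z : cmod z <= `|complex.Re z| + `|complex.Im z|.
Proof.
case: z => a b; have -> : a +i* b = a%:C + b%:C * 'i%C :> R[i].
  by rewrite [LHS]complexE /= (mulrC 'i%C).
rewrite (le_trans (ler_cmodD _ _))// cmodM !cmod_real (cmodE 'i%C) /=.
rewrite expr0n/= expr1n add0r sqrtr1 mulr1.
by rewrite !(mul0r, mulr0, mulr1, addr0, add0r, subr0).
Qed.

Lemma Re_addE z w : complex.Re (z + w) = complex.Re z + complex.Re w.
Proof. by case: z; case: w. Qed.

Lemma Im_addE z w : complex.Im (z + w) = complex.Im z + complex.Im w.
Proof. by case: z; case: w. Qed.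

Lemma Re_sum (I : Type) (s : seq I) (F : I -> R[i]) :
  complex.Re (\sum_(i <- s) F i) = \sum_(i <- s) complex.Re (F i).
Proof. by elim/big_ind2 : _ => // a b c d <- <-; rewrite Re_addE. Qed.

Lemma Im_sum (I : Type) (s : seq I) (F : I -> R[i]) :
  complex.Im (\sum_(i <- s) F i) = \sum_(i <- s) complex.Im (F i).
Proof. by elim/big_ind2 : _ => // a b c d <- <-; rewrite Im_addE. Qed.

Lemma Re_mulE z w : complex.Re (z * w) =
  complex.Re z * complex.Re w - complex.Im z * complex.Im w.
Proof. by case: z; case: w. Qed.

Lemma Im_mulE z w : complex.Im (z * w) =
  complex.Re z * complex.Im w + complex.Im z * complex.Re w.
Proof. by case: z; case: w. Qed.

Lemma conjM z w : conjc (z * w) = conjc z * conjc w.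
Proof. exact: (rmorphM (@conjc R)). Qed.

Lemma cmod_sqr z : cmod z ^+ 2 = complex.Re (z * conjc z).
Proof.
rewrite cmodE sqr_sqrtr ?addr_ge0 ?sqr_ge0//.
by case: z => a b; rewrite Re_mulE /= !expr2 mulrN opprK.
Qed.

(** Linearizes the modulus: [w] is the conjugate of z divided by |z|, or 0 if z = 0. Bounds on the
    modulus of an integral thereby reduce to real integrands. *)
Lemma cmod_phase z : exists2 w, cmod w <= 1 & complex.Re (w * z) = cmod z.
Proof.
have [->|z0] := eqVneq z 0.
  by exists 0; rewrite ?mul0r cmod0.
have cz0 : 0 < cmod z.
  by rewrite lt_def cmod_ge0 andbT; apply: contra_neq z0; exact: cmod_eq0.
exists ((cmod z)^-1%:C * conjc z).
  by rewrite cmodM cmod_real cmod_conj ger0_norm ?invr_ge0 ?cmod_ge0// mulVf ?gt_eqF.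
rewrite -mulrA Re_mulE/= mul0r subr0 (mulrC _ z) -cmod_sqr expr2 mulrA mulVf ?mul1r//.
by rewrite gt_eqF.
Qed.

Lemma cexp2piD (x y : R) : cexp2pi (x + y) = cexp2pi x * cexp2pi y.
Proof.
apply/eqP; rewrite eq_complex Re_mulE Im_mulE /= !mulrDr cosD sinD; apply/andP; split=> //.
by apply/eqP; ring.
Qed.

Lemma cexp2pi0 : cexp2pi (0 : R) = 1.
Proof. by rewrite /cexp2pi mulr0 cos0 sin0. Qed.

Lemma cmod_cexp2pi (x : R) : cmod (cexp2pi x) = 1.
Proof. by rewrite cmodE /cexp2pi /= cos2Dsin2 sqrtr1. Qed.

Lemma conj_cexp2pi (x : R) : conjc (cexp2pi x) = cexp2pi (- x).
Proof. by rewrite /cexp2pi mulrN cosN sinN. Qed.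

End ComplexModulus.

(** * Trigonometric sums and the integral of a single exponential *)

Section TrigSums.
Context {R : realType}.
Local Open Scope complex_scope.
Implicit Types (T x y : R).

Definition trig_sum (I : Type) (s : seq I) (d : I -> R[i]) (lam : I -> R) (t : R) : R[i] :=
  \sum_(k <- s) d k * cexp2pi (lam k * t).

(** The integral of e(x t) over 0 <= t <= T. It is the factor that the coefficient of frequency x
    acquires when a sum is integrated over a moving window of length T. *)
Definition exp_int T x : R[i] :=
  int0 T (fun t => cos (2 * pi * (x * t))) +i* int0 T (fun t => sin (2 * pi * (x * t))).

(** The L^1 norm on [0, T], without the factor 1/T. *)
Definition mean_norm (I : Type) T (s : seq I) (d : I -> R[i]) (lam : I -> R) : R :=
  int0 T (fun t => cmod (trig_sum s d lam t)).

Lemma continuous_mul (c : R) : continuous (fun t : R => c * t).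
Proof. by move=> t; apply: cvgM; [exact: cvg_cst|exact: cvg_id]. Qed.

Lemma continuous_cos_mul x : continuous (fun t => cos (2 * pi * (x * t))).
Proof.
under eq_fun do rewrite mulrA.
move=> t; apply: (@continuous_comp _ _ _ (fun t => 2 * pi * x * t) cos).
  exact: continuous_mul.
exact: continuous_cos.
Qed.

Lemma continuous_sin_mul x : continuous (fun t => sin (2 * pi * (x * t))).
Proof.
under eq_fun do rewrite mulrA.
move=> t; apply: (@continuous_comp _ _ _ (fun t => 2 * pi * x * t) sin).
  exact: continuous_mul.
exact: continuous_sin.
Qed.

Lemma continuous_Re_trig (I : Type) s (d : I -> R[i]) (lam : I -> R) :
  continuous (fun t => complex.Re (trig_sum s d lam t)).
Proof.
under eq_fun do rewrite /trig_sum Re_sum.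
apply: continuous_sum => k t; under eq_fun do rewrite Re_mulE.
apply: cvgB; apply: cvgM; try exact: cvg_cst.
  exact: continuous_cos_mul.
exact: continuous_sin_mul.
Qed.

Lemma continuous_Im_trig (I : Type) s (d : I -> R[i]) (lam : I -> R) :
  continuous (fun t => complex.Im (trig_sum s d lam t)).
Proof.
under eq_fun do rewrite /trig_sum Im_sum.
apply: continuous_sum => k t; under eq_fun do rewrite Im_mulE.
apply: cvgD; apply: cvgM; try exact: cvg_cst.
  exact: continuous_sin_mul.
exact: continuous_cos_mul.
Qed.

Lemma continuous_cmod_trig (I : Type) s (d : I -> R[i]) (lam : I -> R) :
  continuous (fun t => cmod (trig_sum s d lam t)).
Proof.
have csq (f : R -> R) : continuous f -> continuous (fun t => f t ^+ 2).
  by move=> cf t; under eq_fun do rewrite expr2; apply: cvgM; exact: cf.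
under eq_fun do rewrite cmodE.
move=> t; apply: (@continuous_comp _ _ _ (fun t =>
  complex.Re (trig_sum s d lam t) ^+ 2 + complex.Im (trig_sum s d lam t) ^+ 2) Num.sqrt).
  apply: cvgD; apply: csq; [exact: continuous_Re_trig|exact: continuous_Im_trig].
exact: sqrt_continuous.
Qed.

Lemma continuous_cmod_trigX (I : Type) s (d : I -> R[i]) (lam : I -> R) m :
  continuous (fun t => cmod (trig_sum s d lam t) ^+ m).
Proof.
elim: m => [|m ih] t; first by under eq_fun do rewrite expr0; exact: cvg_cst.
under eq_fun do rewrite exprS.
by apply: cvgM; [exact: continuous_cmod_trig|exact: ih].
Qed.

Lemma int0_Re_trig (I : Type) T s (d : I -> R[i]) (lam : I -> R) :
  int0 T (fun t => complex.Re (trig_sum s d lam t)) =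
  complex.Re (\sum_(k <- s) d k * exp_int T (lam k)).
Proof.
under eq_int0 do rewrite /trig_sum Re_sum.
rewrite int0_sum ?Re_sum; last first.
  move=> k; have := @continuous_Re_trig _ [:: k] d lam.
  by under eq_fun do rewrite /trig_sum big_seq1.
apply: eq_bigr => k _; under eq_int0 do rewrite Re_mulE -mulNr.
rewrite int0D.
- rewrite !int0Z ?Re_mulE ?mulNr//.
  + exact: continuous_sin_mul.
  + exact: continuous_cos_mul.
- by move=> t; apply: cvgM; [exact: cvg_cst|exact: continuous_cos_mul].
- by move=> t; apply: cvgM; [exact: cvg_cst|exact: continuous_sin_mul].
Qed.

Lemma mean_norm_ge0 (I : Type) T s (d : I -> R[i]) (lam : I -> R) :
  0 <= mean_norm T s d lam.
Proof. by apply: int0_ge0 => t; exact: cmod_ge0. Qed.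

Lemma trig_sumZ (I : Type) w s (d : I -> R[i]) (lam : I -> R) t :
  trig_sum s (fun k => w * d k) lam t = w * trig_sum s d lam t.
Proof. by rewrite /trig_sum mulr_sumr; apply: eq_bigr => k _; rewrite mulrA. Qed.

(** The sum on the left is the integral of the trigonometric sum over [0, T]. Rotating it by a phase
    makes it real, and the real part is bounded by the modulus pointwise. *)
Lemma ler_cmod_exp_int_sum (I : Type) T s (d : I -> R[i]) (lam : I -> R) :
  cmod (\sum_(k <- s) d k * exp_int T (lam k)) <= mean_norm T s d lam.
Proof.
have [w w1 <-] := cmod_phase (\sum_(k <- s) d k * exp_int T (lam k)).
have -> : w * (\sum_(k <- s) d k * exp_int T (lam k)) =
    \sum_(k <- s) (w * d k) * exp_int T (lam k).
  by rewrite mulr_sumr; apply: eq_bigr => k _; rewrite mulrA.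
rewrite -int0_Re_trig; apply: le_int0.
- exact: continuous_Re_trig.
- exact: continuous_cmod_trig.
- move=> t _; rewrite (le_trans (Re_le_cmod _))// trig_sumZ cmodM.
  by rewrite ler_piMl ?cmod_ge0.
Qed.

Lemma exp_int0 T : 0 <= T -> exp_int T 0 = T%:C.
Proof.
move=> T0; rewrite /exp_int; under eq_int0 do rewrite mul0r mulr0 cos0.
rewrite int0_cst// mul1r; congr (_ +i* _).
by under eq_int0 do rewrite mul0r mulr0 sin0; rewrite int0_cst// mul0r.
Qed.

Lemma ler_cmod_exp_int T x : 0 <= T -> cmod (exp_int T x) <= T.
Proof.
move=> T0; have := @ler_cmod_exp_int_sum unit T [:: tt] (fun=> 1) (fun=> x).
rewrite /mean_norm /trig_sum; under eq_int0 do rewrite big_seq1 mul1r cmod_cexp2pi.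
by rewrite big_seq1 mul1r int0_cst// mul1r.
Qed.

Lemma exp_intE T x : 0 <= T -> x != 0 ->
  exp_int T x = ((sin (2 * pi * (x * T))) / (2 * pi * x)) +i*
                ((1 - cos (2 * pi * (x * T))) / (2 * pi * x)).
Proof.
move=> T0 x0; have c0 : 2 * pi * x != 0.
  by rewrite !mulf_eq0 !negb_or x0 pnatr_eq0 (gt_eqF (pi_gt0 R)).
set c := 2 * pi * x in c0 *.
have dl (t : R) : is_derive t 1 (fun t : R => c * t) c.
  by rewrite -[X in is_derive _ _ _ X]mulr1; exact: (is_deriveZ c (is_derive_id t 1)).
have ds (t : R) : is_derive t 1 (fun t : R => sin (c * t) / c) (cos (c * t)).
  have H : is_derive t 1 (fun t : R => sin (c * t)) (cos (c * t) * c).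
    exact: (is_derive1_comp (f := @sin R) (is_derive_sin (c * t)) (dl t)).
  have -> : cos (c * t) = c^-1 * (cos (c * t) * c) by rewrite [RHS]mulrC mulfK.
  under eq_fun do rewrite mulrC.
  exact: (is_deriveZ c^-1 H).
have dc (t : R) : is_derive t 1 (fun t : R => (1 - cos (c * t)) / c) (sin (c * t)).
  have H : is_derive t 1 (fun t : R => cos (c * t)) (- sin (c * t) * c).
    exact: (is_derive1_comp (f := @cos R) (is_derive_cos (c * t)) (dl t)).
  have H1 : is_derive t 1 (fun t : R => 1 - cos (c * t)) (0 - - sin (c * t) * c).
    exact: (is_deriveB (is_derive_cst (1 : R) t (1 : R)) H).
  have -> : sin (c * t) = c^-1 * (0 - - sin (c * t) * c).
    by rewrite sub0r mulNr opprK [RHS]mulrC mulfK.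
  under eq_fun do rewrite mulrC.
  exact: (is_deriveZ c^-1 H1).
have h1 : int0 T (fun t => cos (2 * pi * (x * t))) = sin (c * T) / c - sin (c * 0) / c.
  apply: (int0_FTC2 (G := fun t : R => sin (c * t) / c)) => //.
    exact: continuous_cos_mul.
  by move=> t _; rewrite mulrA; exact: ds.
have h2 : int0 T (fun t => sin (2 * pi * (x * t))) =
    (1 - cos (c * T)) / c - (1 - cos (c * 0)) / c.
  apply: (int0_FTC2 (G := fun t : R => (1 - cos (c * t)) / c)) => //.
    exact: continuous_sin_mul.
  by move=> t _; rewrite mulrA; exact: dc.
rewrite /exp_int h1 h2.
by rewrite mulr0 sin0 cos0 subrr mul0r !subr0 /c !mulrA.
Qed.

(** The squared modulus is (2 - 2 cos y) / (2 pi x)^2, with numerator at most 4. *)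
Lemma ler_cmod_exp_int_inv T x : 0 <= T -> x != 0 ->
  cmod (exp_int T x) <= (`|x|)^-1.
Proof.
move=> T0 x0; rewrite exp_intE// cmodE /=.
set y := 2 * pi * (x * T); set c := 2 * pi * x.
have c0 : c != 0 by rewrite !mulf_eq0 !negb_or x0 pnatr_eq0 (gt_eqF (pi_gt0 R)).
have -> : (sin y / c) ^+ 2 + ((1 - cos y) / c) ^+ 2 = (2 - 2 * cos y) / c ^+ 2.
  rewrite !expr_div_n -mulrDl; congr (_ / _).
  by rewrite sin2cos2; ring.
rewrite -(ger0_norm (_ : 0 <= `|x|^-1)) ?invr_ge0// -sqrtr_sqr ler_wsqrtr//.
rewrite exprVn real_normK ?num_real// ler_pdivrMr ?exprn_even_gt0//.
have -> : x ^- 2 * c ^+ 2 = (2 * pi) ^+ 2.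
  by rewrite /c [(_ * x) ^+ 2]exprMn mulrC mulfK// expf_neq0.
have := cos_geN1 y; have := pi_ge2 R; nra.
Qed.

End TrigSums.

#[local] Arguments exp_int : simpl never.

(** * Averages and differences of trigonometric sums, and their second and fourth moments *)

Section TrigNorms.
Context {R : realType}.
Local Open Scope complex_scope.
Implicit Types (T x y : R).

Lemma mean_norm_mono (I : Type) T T' s (d : I -> R[i]) (lam : I -> R) :
  0 <= T -> T <= T' -> mean_norm T s d lam <= mean_norm T' s d lam.
Proof.
move=> T0 TT'; apply: int0_mono => //; first exact: continuous_cmod_trig.
by move=> t; exact: cmod_ge0.
Qed.

Lemma trig_sum_mod (I : Type) s (d : I -> R[i]) (lam : I -> R) l t :
  trig_sum s d (fun k => lam k - l) t = cexp2pi (- (l * t)) * trig_sum s d lam t.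
Proof.
rewrite /trig_sum mulr_sumr; apply: eq_bigr => k _.
by rewrite mulrBl cexp2piD; ring.
Qed.

Lemma mean_norm_mod (I : Type) T s (d : I -> R[i]) (lam : I -> R) l :
  mean_norm T s d (fun k => lam k - l) = mean_norm T s d lam.
Proof.
by apply: eq_int0 => t; rewrite trig_sum_mod cmodM cmod_cexp2pi mul1r.
Qed.

Lemma trig_sum_shift (I : Type) s (d : I -> R[i]) (lam : I -> R) c t :
  trig_sum s d lam (t + c) = trig_sum s (fun k => d k * cexp2pi (lam k * c)) lam t.
Proof. by apply: eq_bigr => k _; rewrite mulrDr cexp2piD; ring. Qed.

(** The new coefficients are those of the integral of the sum over the window [t, t + c].
    Integrating over t counts each point of [0, T + c] with weight at most c. *)
Lemma mean_norm_average1 (I : Type) T c s (d : I -> R[i]) (lam : I -> R) :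
  0 <= T -> 0 <= c ->
  mean_norm T s (fun k => d k * exp_int c (lam k)) lam <= c * mean_norm (T + c) s d lam.
Proof.
move=> T0 c0; apply: int0_average => //.
- exact: continuous_cmod_trig.
- by move=> t; exact: cmod_ge0.
- exact: continuous_cmod_trig.
move=> t _; under eq_int0 do rewrite trig_sum_shift.
rewrite (le_trans _ (ler_cmod_exp_int_sum _ _ _ _))//.
rewrite le_eqVlt; apply/orP; left; apply/eqP; congr cmod.
by apply: eq_bigr => k _; ring.
Qed.

(** Iterates the window integral r times, after a modulation that moves the frequency [l] to 0. The
    multiplier then has size c^r at [l] and decays like the power -r of the distance to [l]; each
    iteration lengthens the interval by c. *)
Lemma mean_norm_average (I : Type) r T c s (d : I -> R[i]) (lam : I -> R) l :
  0 <= T -> 0 <= c ->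
  mean_norm T s (fun k => d k * exp_int c (lam k - l) ^+ r) lam <=
  c ^+ r * mean_norm (T + r%:R * c) s d lam.
Proof.
move=> T0 c0; elim: r T T0 => [|r ih] T T0.
  rewrite mul0r addr0 expr0 mul1r; under [X in mean_norm _ _ X]eq_fun do rewrite expr0 mulr1.
  by [].
under [X in mean_norm _ _ X]eq_fun do rewrite exprSr mulrA.
rewrite -(mean_norm_mod _ _ _ _ l).
apply: (le_trans (mean_norm_average1 _ _ _ T0 c0)); rewrite mean_norm_mod.
rewrite exprS -mulrA ler_wpM2l//.
apply: (le_trans (ih _ _)); first exact: addr_ge0.
by rewrite -[r.+1]add1n natrD mulrDl mul1r addrA.
Qed.

(** After modulation by [l], the new coefficients are those of f(t) - f(t + c). The frequency [l] is
    annihilated. *)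
Lemma mean_norm_diff (I : Type) T c s (d : I -> R[i]) (lam : I -> R) l :
  0 <= T -> 0 <= c ->
  mean_norm T s (fun k => d k * (1 - cexp2pi ((lam k - l) * c))) lam <=
  2 * mean_norm (T + c) s d lam.
Proof.
move=> T0 c0; set mu := fun k => lam k - l.
rewrite -(mean_norm_mod _ _ _ lam l) -(mean_norm_mod _ _ d lam l) -/mu.
have E t : trig_sum s (fun k => d k * (1 - cexp2pi ((lam k - l) * c))) mu t =
    trig_sum s d mu t - trig_sum s d mu (t + c).
  rewrite trig_sum_shift /trig_sum -sumrB; apply: eq_bigr => k _.
  by rewrite /mu; ring.
have cf := @continuous_cmod_trig R I s d mu.
have f0 t : 0 <= cmod (trig_sum s d mu t) by exact: cmod_ge0.
apply: (@le_trans _ _ (int0 T (fun t => cmod (trig_sum s d mu t) +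
    cmod (trig_sum s d mu (t + c))))).
  apply: le_int0; first exact: continuous_cmod_trig.
    by move=> t; apply: cvgD; [exact: cf|apply: (continuous_shift (c := c) cf)].
  by move=> t _; rewrite E ler_cmodB.
rewrite int0D//; last exact: (continuous_shift (c := c) cf).
rewrite mulr_natl mulr2n lerD//.
- by apply: int0_mono => //; rewrite lerDl.
- exact: int0_shift_le.
Qed.

Lemma trig_sum_le (I : Type) s (d : I -> R[i]) (lam : I -> R) t :
  cmod (trig_sum s d lam t) <= \sum_(k <- s) cmod (d k).
Proof.
rewrite (le_trans (ler_cmod_sum _ _ _))//; apply: ler_sum => k _.
by rewrite cmodM cmod_cexp2pi mulr1.
Qed.

(** |f|^2 is itself a trigonometric sum, indexed by pairs, whose frequencies are the differences
    lam_k - lam_m. *)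
Lemma int0_cmod2 (I : Type) T s (d : I -> R[i]) (lam : I -> R) :
  int0 T (fun t => cmod (trig_sum s d lam t) ^+ 2) =
  complex.Re (\sum_(k <- s) \sum_(m <- s) d k * conjc (d m) * exp_int T (lam k - lam m)).
Proof.
pose p := [seq (k, m) | k <- s, m <- s].
have E t : cmod (trig_sum s d lam t) ^+ 2 =
    complex.Re (trig_sum p (fun q => d q.1 * conjc (d q.2)) (fun q => lam q.1 - lam q.2) t).
  rewrite cmod_sqr; congr complex.Re; rewrite {2}/trig_sum rmorph_sum /=.
  rewrite [RHS]/trig_sum /p big_allpairs_dep /= /trig_sum mulr_suml; apply: eq_bigr => k _.
  rewrite mulr_sumr; apply: eq_bigr => m _.
  by rewrite conjM conj_cexp2pi mulrBl cexp2piD; ring.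
under eq_int0 do rewrite E.
by rewrite int0_Re_trig /p big_allpairs_dep.
Qed.

Lemma int0_cmod2_le (I : Type) T s (d : I -> R[i]) (lam : I -> R) :
  int0 T (fun t => cmod (trig_sum s d lam t) ^+ 2) <=
  \sum_(k <- s) \sum_(m <- s) cmod (d k) * cmod (d m) * cmod (exp_int T (lam k - lam m)).
Proof.
rewrite int0_cmod2 (le_trans (Re_le_cmod _))// (le_trans (ler_cmod_sum _ _ _))//.
apply: ler_sum => k _; rewrite (le_trans (ler_cmod_sum _ _ _))//.
by apply: ler_sum => m _; rewrite !cmodM cmod_conj.
Qed.

(** The diagonal pairs have frequency 0 and contribute T |d_k|^2 exactly; the others are estimated
    in modulus. *)
Lemma int0_cmod2_ge (I : eqType) T s (d : I -> R[i]) (lam : I -> R) :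
  uniq s -> 0 <= T ->
  T * (\sum_(k <- s) cmod (d k) ^+ 2) -
  \sum_(k <- s) \sum_(m <- s | m != k)
     cmod (d k) * cmod (d m) * cmod (exp_int T (lam k - lam m)) <=
  int0 T (fun t => cmod (trig_sum s d lam t) ^+ 2).
Proof.
move=> us T0; rewrite int0_cmod2.
rewrite mulr_sumr -sumrB Re_sum big_seq [leRHS]big_seq; apply: ler_sum => k ks.
rewrite (bigD1_seq k)//= Re_addE subrr exp_int0//.
rewrite (Re_mulE (d k * conjc (d k))) /= mulr0 subr0 -cmod_sqr mulrC lerD2l.
rewrite lerNl; set z := \sum_(m <- s | m != k) d k * conjc (d m) * _.
rewrite (le_trans _ (_ : cmod z <= _))//.
  rewrite -cmodN; apply: le_trans (Re_le_cmod _).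
  by case: z.
rewrite (le_trans (ler_cmod_sum _ _ _))//.
by apply: ler_sum => m _; rewrite !cmodM cmod_conj.
Qed.

(** |f|^4 = |f^2|^2, and f^2 is a trigonometric sum over pairs with frequencies lam_k + lam_m, so
    the second moment bound applies to it. *)
Lemma int0_cmod4_le (I : Type) T s (d : I -> R[i]) (lam : I -> R) :
  int0 T (fun t => cmod (trig_sum s d lam t) ^+ 4) <=
  \sum_(k1 <- s) \sum_(k2 <- s) \sum_(m1 <- s) \sum_(m2 <- s)
    cmod (d k1) * cmod (d k2) * (cmod (d m1) * cmod (d m2)) *
    cmod (exp_int T (lam k1 + lam k2 - (lam m1 + lam m2))).
Proof.
pose p := [seq (k, m) | k <- s, m <- s].
have E t : cmod (trig_sum s d lam t) ^+ 4 =
    cmod (trig_sum p (fun q => d q.1 * d q.2) (fun q => lam q.1 + lam q.2) t) ^+ 2.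
  rewrite (exprM _ 2 2) -cmodX; congr (cmod _ ^+ 2).
  rewrite [RHS]/trig_sum /p big_allpairs_dep /= expr2 /trig_sum mulr_suml; apply: eq_bigr => k _.
  rewrite mulr_sumr; apply: eq_bigr => m _.
  by rewrite mulrDl cexp2piD; ring.
under eq_int0 do rewrite E.
rewrite (le_trans (int0_cmod2_le _ _ _ _))// /p big_allpairs_dep /=.
apply: ler_sum => k1 _; apply: ler_sum => k2 _; rewrite big_allpairs_dep/=.
by apply: ler_sum => m1 _; apply: ler_sum => m2 _; rewrite !cmodM.
Qed.

Lemma sin_le_norm x : `|sin x| <= `|x|.
Proof.
wlog x0 : x / 0 <= x.
  move=> H; have [/H//|/ltW x0] := leP 0 x.
  by rewrite -(normrN x) -(normrN (sin x)) -sinN H// oppr_ge0.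
have [|c _ +] := @MVT_segment R (@sin R) (@cos R) 0 x x0.
- exact/continuous_subspaceT/continuous_sin.
- rewrite sin0 !subr0 => ->; rewrite normrM ler_piMl//.
  exact: cos_max.
Qed.

(** cos x = 1 - 2 sin(x/2)^2 and |sin(x/2)| <= |x|/2 <= 1/2. *)
Lemma cos_ge_half x : `|x| <= 1 -> 2^-1 <= cos x.
Proof.
move=> x1; have -> : x = (x / 2) *+ 2 by rewrite -mulr_natr divfK.
rewrite cos_mulr2n cos2sin2.
have := sin_le_norm (x / 2); rewrite normrM [`|2^-1|]ger0_norm// => h.
have {}h : `|sin (x / 2)| <= 2^-1 by rewrite (le_trans h)// ler_piMl.
have : sin (x / 2) ^+ 2 <= 4^-1.
  by rewrite -real_normK ?num_real//; have := normr_ge0 (sin (x / 2)); nra.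
rewrite -mulr_natr; lra.
Qed.

(** The phase stays within one radian over the whole window, so the real part of the integrand is at
    least 1/2. *)
Lemma exp_int_ge_half T x : 0 <= T -> 2 * pi * (`|x| * T) <= 1 ->
  T / 2 <= cmod (exp_int T x).
Proof.
move=> T0 h; rewrite (le_trans _ (Re_le_cmod _))// /exp_int [T / 2]mulrC -(int0_cst 2^-1 T0) /=.
apply: le_int0; first by move=> ?; exact: cvg_cst.
  exact: continuous_cos_mul.
move=> t /andP[t0 tT]; apply: cos_ge_half; rewrite (le_trans _ h)//.
rewrite !normrM (ger0_norm t0) (ger0_norm (pi_ge0 R)) (ger0_norm (ler0n R 2)).
by rewrite ler_wpM2l ?mulr_ge0 ?pi_ge0 ?ler_wpM2l.
Qed.

(** The real part of 1 - e(y) is 1 - cos(2 pi |y|), which increases with |y| on [0, 1/2]. *)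
Lemma cexp2pi_diff_ge y y0 : 0 <= y0 -> y0 <= `|y| -> `|y| <= 2^-1 ->
  1 - cos (2 * pi * y0) <= cmod (1 - cexp2pi y).
Proof.
move=> y00 y0y y12; rewrite (le_trans _ (Re_le_cmod _))//.
have -> : complex.Re (1 - cexp2pi y) = 1 - cos (2 * pi * y) by [].
rewrite lerD2l lerN2.
have p0 := pi_gt0 R.
have -> : cos (2 * pi * y) = cos (2 * pi * `|y|).
  by rewrite -[LHS]cos_norm !normrM (ger0_norm (pi_ge0 R)) (ger0_norm (ler0n R 2)).
have mem (z : R) : 0 <= z -> z <= 2^-1 -> 2 * pi * z \in `[0, pi].
  by move=> z0 z1; rewrite in_itv/=; apply/andP; split; nra.
rewrite leNgt ltr_cos ?mem ?(le_trans y0y)// -leNgt; nra.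
Qed.

Lemma one_sub_cos_gt0 y : 0 < y -> y <= 2^-1 -> 0 < 1 - cos (2 * pi * y).
Proof.
move=> y0 y12; have p0 := pi_gt0 R.
have z0 : 0 <= 2 * pi * y by nra.
have z1 : 2 * pi * y <= pi by nra.
rewrite subr_gt0 -[ltRHS]cos0 ltr_cos ?in_itv/= ?lexx ?pi_ge0 ?z0//; nra.
Qed.

End TrigNorms.

(** * Finite sums over lists, in particular of inverse squares of integers *)

Section FiniteSums.
Context {R : realType}.

Lemma ler_sum_subset (I : eqType) (s s' : seq I) (F : I -> R) :
  (forall i, 0 <= F i) -> uniq s -> {subset s <= s'} ->
  \sum_(i <- s) F i <= \sum_(i <- s') F i.
Proof.
move=> F0; elim: s s' => [|x s ih] s' /=; first by rewrite big_nil sumr_ge0.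
move=> /andP[xs us] sub.
have xs' : x \in s' by apply: sub; rewrite mem_head.
rewrite (perm_big _ (perm_to_rem xs')) /= !big_cons lerD2l ih//.
move=> y ys; have := sub y; rewrite inE ys orbT => /(_ isT).
rewrite (perm_mem (perm_to_rem xs')) inE => /predU1P[yx|//].
by rewrite -yx ys in xs.
Qed.

Lemma seq_argmax (I : eqType) (s : seq I) (F : I -> R) k : k \in s ->
  exists2 m, m \in s & forall i, i \in s -> F i <= F m.
Proof.
elim: s k => [//|x s ih] k _; case: s ih => [_|y s ih].
  by exists x => [|i]; rewrite inE// => /eqP ->.
have [m ms mm] := ih y (mem_head _ _).
have [xm|mx] := leP (F x) (F m).
  exists m; first by rewrite inE ms orbT.
  by move=> i; rewrite inE => /predU1P[->//|/mm].
exists x; first exact: mem_head.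
by move=> i; rewrite inE => /predU1P[->//|/mm im]; exact: le_trans im (ltW mx).
Qed.

Lemma seq_pos_lower_bound (s : seq R) : (forall x, x \in s -> 0 < x) ->
  exists2 e, 0 < e & forall x, x \in s -> e <= x.
Proof.
elim: s => [|x s ih] s0; first by exists 1.
have [|e e0 es] := ih; first by move=> y ys; apply: s0; rewrite inE ys orbT.
exists (Num.min e x); first by rewrite lt_min e0 s0 ?mem_head.
by move=> y; rewrite inE ge_min => /predU1P[->|/es ->//]; rewrite lexx orbT.
Qed.

(** The value 1 at 0 makes this a summable majorant on all of Z, including indices where only a
    trivial bound is available. *)
Definition inv_sq (h : int) : R := if h == 0 then 1 else (h%:~R ^+ 2)^-1.

Lemma inv_sq_ge0 h : 0 <= inv_sq h.
Proof. by rewrite /inv_sq; case: ifP => // _; rewrite invr_ge0 sqr_ge0. Qed.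

Lemma sum_inv_sq_nat N : \sum_(0 <= j < N) (j.+1%:R ^+ 2 : R)^-1 <= 2.
Proof.
case: N => [|N]; first by rewrite big_geq.
(* The sharper bound 2 - 1/(N + 1) passes through the induction, since 1/(x + 1)^2 <= 1/x - 1/(x +
   1). *)
apply: (@le_trans _ _ (2 - N.+1%:R^-1)); last by rewrite lerBlDr lerDl invr_ge0.
elim: N => [|N ih]; first by rewrite big_nat1 expr1n invr1; lra.
rewrite big_nat_recr//= (le_trans (lerD ih (lexx _)))//.
have h1 : 0 < N.+1%:R :> R by rewrite ltr0n.
have h2 : N.+2%:R = N.+1%:R + 1 :> R by rewrite -natr1.
rewrite h2; set x : R := N.+1%:R in h1 *.
have x1 : 0 < x + 1 by lra.
rewrite -subr_ge0.
have -> : 2 - (x + 1)^-1 - (2 - x^-1 + ((x + 1) ^+ 2)^-1) =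
  (x * (x + 1) ^+ 2)^-1 by field; rewrite !gt_eqF.
by rewrite invr_ge0 mulr_ge0 ?sqr_ge0// ltW.
Qed.

(** The constant is 1 + 2 + 2, for the index 0, the positive and the negative indices. *)
Lemma sum_inv_sq (s : seq int) : uniq s -> \sum_(m <- s) inv_sq m <= 5.
Proof.
move=> us.
have [N sN] : exists N, forall m, m \in s -> (absz m < N)%N.
  elim: s {us} => [|x s [N ih]]; first by exists 0%N.
  exists (maxn N (absz x).+1) => m; rewrite inE leq_max => /predU1P[->|/ih ->//].
  by rewrite leqnn orbT.
pose L := map Posz (iota 0 N.+1) ++ map Negz (iota 0 N).
have sub : {subset s <= L}.
  move=> m /sN mN; rewrite mem_cat; apply/orP; case: m mN => m mN; [left|right];
    by apply: map_f; rewrite mem_iota; lia.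
rewrite (le_trans (ler_sum_subset inv_sq_ge0 us sub))// big_cat !big_map /=.
have := sum_inv_sq_nat N => h.
have e1 : \sum_(j <- iota 1 N) inv_sq (Posz j) <= 2.
  rewrite (iotaDl 1 0) big_map (le_trans _ h)// /index_iota subn0.
  by apply: ler_sum => j _; rewrite /inv_sq add1n.
have e2 : \sum_(j <- iota 0 N) inv_sq (Negz j) <= 2.
  rewrite (le_trans _ h)// /index_iota subn0.
  by apply: ler_sum => j _; rewrite /inv_sq /= NegzE mulrNz sqrrN.
rewrite big_cons /inv_sq eqxx -/inv_sq; lra.
Qed.

Lemma sum_inv_sq_shift (s : seq int) k : uniq s -> \sum_(m <- s) inv_sq (m - k) <= 5.
Proof.
move=> us; rewrite -(big_map (fun m => m - k) xpredT inv_sq) sum_inv_sq//.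
by rewrite map_inj_uniq// => x y /addIr.
Qed.

End FiniteSums.

(** * Each coefficient is bounded by the L^1 norm when the frequency gaps grow *)

Section Ingham.
Context {R : realType} (lam : int -> R).
Implicit Types (s : seq int) (d : int -> R[i]).

(* With [x = lam k0 - lam j], the step [c] is [1 / (2 |x|)], or [del] if this is
   too large; the factor [1 - e(x c)] is then [2], or [|x c| <= 1/2]. *)
Lemma kill_frequency (s : seq int) (d : int -> R[i]) (T del x0 : R) (k0 j : int) :
  0 <= T -> 0 < del -> 0 < x0 -> x0 <= `|lam k0 - lam j| ->
  exists d' : int -> R[i],
    [/\ d' j = 0, forall m, d m = 0 -> d' m = 0,
        Num.min 1 (1 - cos (2 * pi * Num.min (x0 * del) 2^-1)) * cmod (d k0) <= cmod (d' k0) &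
        mean_norm T s d' lam <= 2 * mean_norm (T + del) s d lam].
Proof.
move=> T0 del0 x00 x0x; set x := lam k0 - lam j in x0x.
have xgt0 : 0 < `|x| by exact: lt_le_trans x0x.
set kap := Num.min _ _.
have half0 : 0 < 2^-1 :> R by lra.
suff [c [c0 cdel hc]] : exists c, [/\ 0 <= c, c <= del & kap <= cmod (1 - cexp2pi (x * c))].
  exists (fun k => d k * (1 - cexp2pi ((lam k - lam j) * c))); split.
  - by rewrite subrr mul0r cexp2pi0 subrr mulr0.
  - by move=> m ->; rewrite mul0r.
  - by rewrite cmodM mulrC ler_wpM2l ?cmod_ge0.
  - rewrite (le_trans (mean_norm_diff _ _ _ _ T0 c0))// ler_wpM2l//.
    by apply: mean_norm_mono; [exact: addr_ge0|rewrite lerD2l].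
have [h|h] := leP (`|x| * del) 2^-1.
  exists del; split => //; first exact: ltW.
  apply: (@le_trans _ _ (1 - cos (2 * pi * Num.min (x0 * del) 2^-1))).
    by rewrite /kap ge_min lexx orbT.
  apply: cexp2pi_diff_ge.
  - by rewrite le_min mulr_ge0 ?ltW.
  - by rewrite normrM (gtr0_norm del0) ge_min ler_wpM2r// ltW.
  - by rewrite normrM (gtr0_norm del0).
exists ((2 * `|x|)^-1); split.
- by rewrite invr_ge0 mulr_ge0.
- rewrite -[leLHS]mul1r ler_pdivrMr ?mulr_gt0//; move: h; lra.
- have xc : `|x * (2 * `|x|)^-1| = 2^-1.
    by rewrite normrM normfV normrM normr_id (ger0_norm (ler0n R 2)); field; rewrite gt_eqF.
  apply: (@le_trans _ _ 1); first by rewrite /kap ge_min lexx.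
  apply: (@le_trans _ _ (1 - cos (2 * pi * 2^-1))).
    by rewrite mulrAC divff ?pnatr_eq0// mul1r cospi; lra.
  by apply: cexp2pi_diff_ge; rewrite ?xc.
Qed.

(** One frequency is removed at a time. A removed coefficient stays 0 because each step preserves
    zeros; each step costs [del] of time, a factor 2 in the norm and a factor [kap] in the
    coefficient of [k0]. *)
Lemma kill_frequencies (s : seq int) (T del x0 kap : R) (k0 : int) (F : seq int) :
  0 < del -> 0 < x0 ->
  kap = Num.min 1 (1 - cos (2 * pi * Num.min (x0 * del) 2^-1)) -> 0 <= kap ->
  (forall j, j \in F -> x0 <= `|lam k0 - lam j|) ->
  0 <= T -> forall d : int -> R[i], exists d' : int -> R[i],
    [/\ forall j, j \in F -> d' j = 0, forall m, d m = 0 -> d' m = 0,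
        kap ^+ size F * cmod (d k0) <= cmod (d' k0) &
        mean_norm T s d' lam <= 2 ^+ size F * mean_norm (T + (size F)%:R * del) s d lam].
Proof.
move=> del0 x00 kapE kap0 + T0; elim: F => [|j F ih] hF d.
  by exists d; split => //=; rewrite expr0 mul1r// mul0r addr0.
have T1 : 0 <= T + (size F)%:R * del by rewrite addr_ge0// mulr_ge0// ltW.
have [|d1 [d1j d10 d1k d1n]] := @kill_frequency s d (T + (size F)%:R * del) del x0 k0 j T1 del0 x00.
  by apply: hF; rewrite mem_head.
have [|d' [d'F d'0 d'k d'n]] := ih _ d1.
  by move=> i iF; apply: hF; rewrite inE iF orbT.
exists d'; split => //=.
- by move=> i; rewrite inE => /predU1P[->|/d'F//]; exact: d'0.
- by move=> m /d10 /d'0.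
- rewrite exprSr -mulrA (le_trans _ d'k)// ler_wpM2l ?exprn_ge0//.
  by rewrite kapE.
- rewrite (le_trans d'n)// exprSr -mulrA ler_wpM2l ?exprn_ge0//.
  have -> : T + (size F).+1%:R * del = T + (size F)%:R * del + del.
    by rewrite -natr1; ring.
  exact: d1n.
Qed.

(** Only the finitely many pairs with both indices below [K] escape the linear growth. *)
Definition growing_gaps (c : R) (K : nat) := forall k m : int, k != m ->
  (K <= maxn (absz k) (absz m))%N ->
  c * (maxn (absz k) (absz m))%:R <= `|lam k - lam m|.

(** Among indices of size at most [K] there are finitely many gaps, all nonzero by injectivity; any
    other pair has a gap of at least [c]. *)
Lemma uniform_gap (c : R) (K : nat) : injective lam -> 0 < c -> growing_gaps c K ->
  exists2 x0, 0 < x0 & forall k m, k != m -> x0 <= `|lam k - lam m|.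
Proof.
move=> linj c0 gaps.
pose F := map Posz (iota 0 K.+1) ++ map Negz (iota 0 K).
have FK k : (absz k <= K)%N -> k \in F.
  rewrite mem_cat => kK; apply/orP; case: k kK => k kK; [left|right];
    by apply: map_f; rewrite mem_iota; lia.
pose L := [seq `|lam p.1 - lam p.2| | p <- [seq (k, m) | k <- F, m <- F] & p.1 != p.2].
have [|e e0 eL] := @seq_pos_lower_bound R L.
  move=> x /mapP[[k m]]; rewrite mem_filter/= => /andP[km _] ->.
  by rewrite normr_gt0 subr_eq0; apply: contra_neq km; exact: linj.
exists (Num.min e c) => [|k m km]; first by rewrite lt_min e0.
rewrite ge_min; have [KM|KM] := leqP (maxn (absz k) (absz m)) K.
  apply/orP; left; apply: eL; apply/mapP; exists (k, m) => //.
  rewrite mem_filter [X in X && _]km andTb.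
  by apply: allpairs_f; apply: FK; move: KM; rewrite geq_max => /andP[].
apply/orP; right; apply: le_trans (gaps _ _ km (ltnW KM)).
by rewrite ler_peMr ?(ltW c0)// ler1n; lia.
Qed.

(** Half of the time is spent on removing the small frequencies other than that of [k], the other
    half on a triple average centered at the largest remaining coefficient. *)
Lemma ingham_coef_bound (c : R) (K0 : nat) (T : R) :
  injective lam -> 0 < c -> growing_gaps c K0 -> 0 < T ->
  exists2 C, 0 < C & forall s d k, uniq s -> k \in s ->
    C * cmod (d k) <= mean_norm T s d lam.
Proof.
move=> linj c0 gaps T0.
have [x0 x00 gap0] := uniform_gap linj c0 gaps.
(* Three windows of length [tau] fill T / 2. *)
pose tau := T / 6.
have tau0 : 0 < tau by rewrite divr_gt0.
(* [K] is so large that all frequencies other than the central one contribute at most half of the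
   central term; 5 bounds the sum of [inv_sq]. *)
have [K [KK0 K1 Kbig]] : exists K : nat, [/\ (K0 <= K)%N, (1 <= K)%N &
    (c ^+ 3)^-1 * K%:R^-1 * 5 <= tau ^+ 3 / 2].
  pose B := 10 / (c ^+ 3 * tau ^+ 3).
  have B0 : 0 <= B by rewrite divr_ge0// mulr_ge0// exprn_ge0// ltW.
  pose K := maxn K0 (Num.truncn B).+1.
  have KB : B <= K%:R.
    rewrite (le_trans (ltW (truncnS_gt B)))// ler_nat; exact: leq_maxr.
  exists K; split; rewrite /K ?leq_max ?leqnn ?orbT//.
  have K0' : 0 < K%:R :> R by rewrite ltr0n /K leq_max orbT.
  have c3 : 0 < c ^+ 3 by rewrite exprn_gt0.
  have t3 : 0 < tau ^+ 3 by rewrite exprn_gt0.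
  rewrite -invfM mulrC ler_pdivrMr ?mulr_gt0//.
  move: KB; rewrite /B ler_pdivrMr ?mulr_gt0// -/K; lra.
(* Since [Negz j] is -(j + 1), this lists exactly the integers k with |k| < K. *)
pose F := map Posz (iota 0 K) ++ map Negz (iota 0 K.-1).
have FK k : (k \in F) = (absz k < K)%N.
  rewrite mem_cat; apply/idP/idP.
    by move=> /orP[] /mapP[j]; rewrite mem_iota/= add0n => jK ->/=; lia.
  move=> kK; apply/orP; case: k kK => k kK; [left|right];
    by apply: map_f; rewrite mem_iota; lia.
pose M := size F.
(* At most [M] removals, of time [del] each, use at most T / 2. *)
pose del := T / (2 * M%:R).
have M0 : (0 < M)%N by rewrite /M size_cat size_map size_iota; lia.
have M0R : 0 < M%:R :> R by rewrite ltr0n.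
have del0 : 0 < del by rewrite divr_gt0// mulr_gt0.
pose kap := Num.min 1 (1 - cos (2 * pi * Num.min (x0 * del) 2^-1)).
have half0 : 0 < 2^-1 :> R by lra.
have kap0 : 0 < kap.
  rewrite lt_min ltr01 one_sub_cos_gt0//.
    by rewrite lt_min mulr_gt0.
  by rewrite ge_min lexx orbT.
have kap1 : kap <= 1 by rewrite ge_min lexx.
exists (kap ^+ M * tau / 2 / 2 ^+ M).
  by rewrite !divr_gt0 ?mulr_gt0 ?exprn_gt0.
move=> s d k0 us k0s.
pose F0 := [seq j <- F | j != k0].
have F0M : (size F0 <= M)%N by rewrite /F0 size_filter count_size.
have F0E j : (j \in F0) = (j \in F) && (j != k0).
  by rewrite mem_filter andbC.
have T2 : 0 <= T / 2 by rewrite divr_ge0// ltW.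
have [|d' [d'F _ d'k d'n]] := @kill_frequencies s (T / 2) del x0 kap k0 F0 del0 x00 erefl
    (ltW kap0) _ T2 d.
  by move=> j; rewrite F0E => /andP[_ jk]; apply: gap0; rewrite eq_sym.
have {}d'n : mean_norm (T / 2) s d' lam <= 2 ^+ M * mean_norm T s d lam.
  rewrite (le_trans d'n)// ler_pM ?exprn_ge0 ?mean_norm_ge0//.
    by rewrite ler_weXn2l// ler1n.
  apply: mean_norm_mono.
    by rewrite addr_ge0// mulr_ge0// ltW.
  have : (size F0)%:R * del <= M%:R * del by rewrite ler_wpM2r ?(ltW del0)// ler_nat.
  have : M%:R * del = T / 2 by rewrite /del; field; rewrite gt_eqF.
  lra.
have {}d'k : kap ^+ M * cmod (d k0) <= cmod (d' k0).
  rewrite (le_trans _ d'k)// ler_wpM2r ?cmod_ge0//.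
  by rewrite ler_wiXn2l// ltW.
(* The average is centered at the largest remaining coefficient, which may sit elsewhere than [k0]
   but is at least as large as the one at [k0]. *)
have [ms mss msmax] := seq_argmax (fun m => cmod (d' m)) k0s.
set D := cmod (d' ms) in msmax.
suff main : D * tau / 2 <= mean_norm (T / 2) s d' lam.
  have h1 : kap ^+ M * cmod (d k0) <= D := le_trans d'k (msmax _ k0s).
  have -> : kap ^+ M * tau / 2 / 2 ^+ M * cmod (d k0) =
      kap ^+ M * cmod (d k0) * tau / 2 / 2 ^+ M by ring.
  rewrite ler_pdivrMr ?exprn_gt0// [leRHS]mulrC (le_trans _ (le_trans main d'n))//.
  by rewrite !ler_wpM2r// ltW.
have [D0|D0] := eqVneq D 0; first by rewrite D0 !mul0r mean_norm_ge0.
have {}D0 : 0 < D by rewrite lt_def D0 cmod_ge0.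
have nF0 m : cmod (d' m) != 0 -> m \notin F0.
  by apply: contra => /d'F ->; rewrite cmod0.
pose E m := exp_int tau (lam m - lam ms).
have up : cmod (\sum_(m <- s) d' m * E m ^+ 3) <= tau ^+ 2 * mean_norm (T / 2) s d' lam.
  under eq_bigr do rewrite exprSr mulrA.
  rewrite (le_trans (ler_cmod_exp_int_sum _ _ _ (fun m => lam m - lam ms)))//.
  rewrite mean_norm_mod (le_trans (mean_norm_average _ _ _ _ _ _ _))// ?(ltW tau0)//.
  by rewrite (_ : tau + _ = T / 2)// /tau; lra.
have lo : D * (tau ^+ 3 / 2) <= cmod (\sum_(m <- s) d' m * E m ^+ 3).
  rewrite (bigD1_seq ms)//= (le_trans _ (lerB_cmod _ _))//.
  rewrite {1}/E subrr exp_int0 ?(ltW tau0)// cmodM cmodX cmod_real (gtr0_norm tau0) -/D.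
  suff : cmod (\sum_(m <- s | m != ms) d' m * E m ^+ 3) <= D * (tau ^+ 3 / 2) by lra.
  rewrite (le_trans (ler_cmod_sum _ _ _))//.
  apply: (@le_trans _ _ (\sum_(m <- s) D * ((c ^+ 3)^-1 * K%:R^-1) * inv_sq m)); last first.
    by rewrite -mulr_sumr -mulrA ler_wpM2l ?(ltW D0)// (le_trans _ Kbig)//
      ler_wpM2l ?sum_inv_sq// mulr_ge0 ?invr_ge0// exprn_ge0// ltW.
  have term0 m : 0 <= D * ((c ^+ 3)^-1 * K%:R^-1) * inv_sq m.
    by rewrite mulr_ge0 ?inv_sq_ge0// mulr_ge0 ?(ltW D0)// mulr_ge0 ?invr_ge0// exprn_ge0// ltW.
  rewrite big_mkcond big_seq [leRHS]big_seq; apply: ler_sum => m ms_in.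
  case: ifP => // mms; have [->|dm0] := eqVneq (d' m) 0; first by rewrite mul0r cmod0.
  have m_F0 : m \notin F0.
    by apply: nF0; apply: contra_neq dm0; exact: cmod_eq0.
  have ms_F0 : ms \notin F0 by apply: nF0; rewrite gt_eqF.
  (* The only index below [K] that was not removed is [k0], so two distinct surviving indices cannot
     both be small. *)
  have KM : (K <= maxn (absz m) (absz ms))%N.
    move: m_F0 ms_F0; rewrite !F0E !FK !negb_and -!leqNgt !negbK leq_max.
    case/orP => [->//|/eqP mk]; case/orP => [->|/eqP msk]; first by rewrite orbT.
    by rewrite mk msk eqxx in mms.
  have gap := gaps m ms mms (leq_trans KK0 KM).
  set mx := maxn _ _ in KM gap.
  have mx0 : 0 < mx%:R :> R by rewrite ltr0n (leq_trans K1 KM).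
  have lam0 : 0 < `|lam m - lam ms| by rewrite (lt_le_trans _ gap)// mulr_gt0.
  have En : cmod (E m) <= (c * mx%:R)^-1.
    rewrite (le_trans (ler_cmod_exp_int_inv _ _))// ?(ltW tau0)//.
      by rewrite -normr_gt0.
    by rewrite lef_pV2 ?posrE// mulr_gt0.
  rewrite cmodM cmodX -mulrA ler_pM ?cmod_ge0 ?exprn_ge0 ?cmod_ge0 ?msmax//.
  rewrite (le_trans (_ : _ <= ((c * mx%:R)^-1) ^+ 3))//.
    by rewrite lerXn2r ?nnegrE ?cmod_ge0// invr_ge0 mulr_ge0// ltW.
  (* Of the three factors 1/mx, one gives 1/K and two give [inv_sq m], as [mx] is at least [K] and
     at least [absz m]. *)
  rewrite exprVn exprMn invfM -mulrA ler_wpM2l ?invr_ge0 ?exprn_ge0 ?(ltW c0)//.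
  rewrite exprS invfM ler_pM ?invr_ge0 ?exprn_ge0//.
    by rewrite lef_pV2 ?posrE ?ler_nat// ltr0n.
  rewrite /inv_sq; case: eqP => [m0|/eqP m0].
    by rewrite invf_le1 ?exprn_gt0// exprn_ege1// ler1n (leq_trans K1 KM).
  have am0 : 0 < (absz m)%:R :> R by rewrite ltr0n absz_gt0.
  have -> : (m%:~R : R) ^+ 2 = (absz m)%:R ^+ 2.
    by rewrite -[LHS]real_normK ?num_real// natr_absz intr_norm.
  rewrite lef_pV2 ?posrE ?exprn_gt0// lerXn2r ?nnegrE ?ler0n// ler_nat.
  exact: leq_maxl.
have t2 : 0 < tau ^+ 2 by rewrite exprn_gt0.
have := le_trans lo up; rewrite (exprS tau 2) => h.
rewrite -(ler_pM2l t2); move: h; lra.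
Qed.

End Ingham.

(** * Growth of real polynomials and gaps between their values at integers *)

Section PolynomialGrowth.
Context {R : realType}.
Implicit Types (p : {poly R}) (x y X : R).

Lemma low_terms_upper p n : exists2 A, 0 < A & forall y X, `|y| <= X -> 1 <= X ->
  `|\sum_(i < n) p`_i * y ^+ i| <= A * X ^+ n.-1.
Proof.
exists (1 + \sum_(i < n) `|p`_i|).
  by rewrite ltr_pwDl// sumr_ge0.
move=> y X yX X1; have X0 : 0 <= X by lra.
rewrite (le_trans (ler_norm_sum _ _ _))//.
apply: (@le_trans _ _ ((\sum_(i < n) `|p`_i|) * X ^+ n.-1)); last first.
  by rewrite ler_wpM2r ?exprn_ge0//; lra.
rewrite mulr_suml; apply: ler_sum => i _; rewrite normrM ler_wpM2l// normrX.
rewrite (@le_trans _ _ (X ^+ i))//; first by rewrite lerXn2r ?nnegrE.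
by rewrite ler_weXn2l//; case: n i => [[]//|n i]; rewrite -ltnS /= ltn_ord.
Qed.

Lemma poly_upper p : exists2 C, 0 < C & forall y X, `|y| <= X -> 1 <= X ->
  `|p.[y]| <= C * X ^+ (size p).-1.
Proof.
have [C C0 H] := low_terms_upper p (size p).
by exists C => // y X yX X1; rewrite horner_coef H.
Qed.

Lemma horner_lead p n x : size p = n.+1 ->
  p.[x] = lead_coef p * x ^+ n + \sum_(i < n) p`_i * x ^+ i.
Proof. by move=> sp; rewrite horner_coef sp big_ord_recr /= addrC lead_coefE sp. Qed.

(** From |x| >= 1 + 2 A / b on, the lower terms are at most half of the leading one. *)
Lemma poly_lower p : p != 0 -> exists2 c, 0 < c & exists2 K, 1 <= K &
  forall x, K <= `|x| -> c * `|x| ^+ (size p).-1 <= `|p.[x]|.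
Proof.
move=> p0; case sp: (size p) => [|n].
  by move/eqP: sp; rewrite size_poly_eq0 (negbTE p0).
have b0 : 0 < `|lead_coef p| by rewrite normr_gt0 lead_coef_eq0.
have [A A0 HA] := low_terms_upper p n.
set b := `|lead_coef p| in b0.
exists (b / 2); first by rewrite divr_gt0.
exists (1 + 2 * A / b); first by rewrite lerDl divr_ge0 ?mulr_ge0// ltW.
move=> x xK.
have x1 : 1 <= `|x| by rewrite (le_trans _ xK)// lerDl divr_ge0 ?mulr_ge0// ltW.
have hA : 2 * A <= b * `|x|.
  have : 2 * A / b <= `|x| by rewrite (le_trans _ xK)// lerDr.
  by rewrite ler_pdivrMr//; lra.
rewrite (horner_lead _ sp)/= (le_trans _ (lerB_normD _ _))// normrM normrX -/b.
have := HA x `|x| (lexx _) x1.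
(* In degree 0 the exponent [n.-1] is 0 instead of -1, but then there are no lower terms. *)
case: n {sp HA} => [|n]; last first.
  rewrite /= exprS => h; have : 0 <= `|x| ^+ n by rewrite exprn_ge0.
  set r := \sum_(i < _) _ in h *; set y := `|x| ^+ n in h * => y0.
  nra.
by rewrite !big_ord0 normr0 expr0; lra.
Qed.

Lemma mvt_between p (lo hi x y : R) : lo <= x <= hi -> lo <= y <= hi ->
  exists2 z, lo <= z <= hi & p.[x] - p.[y] = p^`().[z] * (x - y).
Proof.
move=> xI yI; have [xy|yx|->] := ltgtP x y.
- have [z] := poly_mvt p xy; rewrite in_itv/= => /andP[z1 z2] E.
  exists z; first by move: xI yI => /andP[? ?] /andP[? ?]; lra.
  by rewrite -opprB E -mulrN opprB.
- have [z] := poly_mvt p yx; rewrite in_itv/= => /andP[z1 z2] E.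
  by exists z => //; move: xI yI => /andP[? ?] /andP[? ?]; lra.
- by exists y => //; rewrite !subrr mulr0.
Qed.

(** |x^n - y^n| is at least |x|^(n-1) (|x| - |y|), and the lower terms of both values together are
    at most 2 A |x|^(n-1). The choice of [C0] makes this at most half of the leading part. *)
Lemma poly_gap_lower p n : size p = n.+1 -> (0 < n)%N ->
  exists2 c, 0 < c & exists2 C0, 1 <= C0 &
  forall x y, 1 <= `|x| -> C0 <= `|x| - `|y| ->
  c * (`|x| ^+ n.-1 * (`|x| - `|y|)) <= `|p.[x] - p.[y]|.
Proof.
move=> sp n0.
have b0 : 0 < `|lead_coef p| by rewrite normr_gt0 lead_coef_eq0 -size_poly_eq0 sp.
set b := `|lead_coef p| in b0.
have [A A0 HA] := low_terms_upper p n.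
exists (b / 2); first by rewrite divr_gt0.
exists (1 + 4 * A / b); first by rewrite lerDl divr_ge0 ?mulr_ge0// ltW.
move=> x y x1 xy.
have hA : 4 * A <= b * (`|x| - `|y|).
  have : 4 * A / b <= `|x| - `|y| by rewrite (le_trans _ xy)// lerDr.
  by rewrite ler_pdivrMr//; lra.
have yx : `|y| <= `|x|.
  by rewrite -subr_ge0 (le_trans _ xy)// addr_ge0// divr_ge0 ?mulr_ge0// ltW.
have hx := HA x `|x| (lexx _) x1; have hy := HA y `|x| yx x1.
rewrite !(horner_lead _ sp).
set rx := \sum_(i < _) _ in hx *; set ry := \sum_(i < _) _ in hy *.
have main : `|x| ^+ n.-1 * (`|x| - `|y|) <= `|x ^+ n - y ^+ n|.
  rewrite (le_trans _ (lerB_dist _ _))// !normrX -{2 3}(prednK n0) mulrBr.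
  rewrite -exprSr lerD2l lerN2 exprSr ler_wpM2r// lerXn2r ?nnegrE//.
have -> : lead_coef p * x ^+ n + rx - (lead_coef p * y ^+ n + ry) =
  lead_coef p * (x ^+ n - y ^+ n) + (rx - ry) by ring.
rewrite (le_trans _ (lerB_normD _ _))// normrM -/b.
have := ler_normB rx ry.
set u := `|x ^+ n - y ^+ n| in main *; set v := `|rx - ry|.
have : 0 <= `|x| ^+ n.-1 by rewrite exprn_ge0.
set X := `|x| ^+ n.-1 in main hx hy *; set w := `|x| - `|y| in hA main *.
move=> X0 hv.
have : b * (X * w) <= b * u by rewrite ler_wpM2l// ltW.
have : 4 * A * X <= b * w * X by rewrite ler_wpM2r.
move: hx hy hv; lra.
Qed.

(** By the mean value theorem: beyond [K] the derivative has size at least c z^(n-1), and the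
    intermediate point z is at least the smaller of x and y. *)
Lemma poly_slope p n : size p = n.+1 -> (0 < n)%N ->
  exists2 c, 0 < c & exists2 K, 1 <= K &
  forall x y, K <= x -> K <= y ->
  c * `|x - y| * (Num.min x y) ^+ n.-1 <= `|p.[x] - p.[y]|.
Proof.
move=> sp n0; have sd : size p^`() = n by rewrite polyorder.size_deriv sp.
have d0 : p^`() != 0 by rewrite -size_poly_gt0 sd.
have [c c0 [K K1 H]] := poly_lower d0.
exists c => //; exists K => // x y xK yK.
have xI : Num.min x y <= x <= Num.max x y by rewrite ge_min le_max lexx.
have yI : Num.min x y <= y <= Num.max x y by rewrite ge_min le_max lexx !orbT.
have [z /andP[z1 _] ->] := mvt_between p xI yI.
have mK : K <= Num.min x y by rewrite le_min xK.
have zK : K <= `|z| by rewrite ger0_norm; lra.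
rewrite normrM mulrAC ler_wpM2r// (le_trans _ (H z zK))// sd ler_wpM2l ?(ltW c0)//.
by rewrite lerXn2r ?nnegrE// ?ger0_norm//; lra.
Qed.

Lemma poly_slope_upper p n : size p = n.+1 ->
  exists2 C, 0 < C & forall x y X, `|x| <= X -> `|y| <= X -> 1 <= X ->
  `|p.[x] - p.[y]| <= C * X ^+ n.-1 * `|x - y|.
Proof.
move=> sp; have sd : size p^`() = n by rewrite polyorder.size_deriv sp.
have [C C0 H] := poly_upper p^`().
exists C => // x y X hx hy X1.
have xX : - X <= x <= X by rewrite -ler_norml.
have yX : - X <= y <= X by rewrite -ler_norml.
have [z zX ->] := mvt_between p xX yX.
by rewrite normrM ler_wpM2r// -sd H// ler_norml.
Qed.

(** p(x) - p(s - x) is a polynomial in x that vanishes at s/2. If it were constant it would be 0,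
    and p would take the same value at the distinct integers |s| + 1 and s - (|s| + 1). Hence it has
    positive degree and grows at least linearly. *)
Lemma poly_reflect_gap p (s : int) : injective (fun k : int => p.[k%:~R]) ->
  exists2 c, 0 < c & exists2 K, 1 <= K & forall k : int, K <= `|k%:~R : R| ->
  c * `|k%:~R : R| <= `|p.[k%:~R] - p.[(s - k)%:~R]|.
Proof.
move=> inj.
pose D := p - (p \Po (s%:~R%:P - 'X)).
have DE x : D.[x] = p.[x] - p.[s%:~R - x] by rewrite /D !(hornerE, horner_comp).
have Ds : (1 < size D)%N.
  rewrite ltnNge; apply/negP => /size1_polyC DC.
  have D0 x : D.[x] = 0.
    have h : D.[s%:~R / 2] = 0.
      by rewrite DE (_ : s%:~R - s%:~R / 2 = s%:~R / 2) ?subrr//; lra.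
    by move: h; rewrite DC !hornerC.
  have := D0 (`|s| + 1)%:~R; rewrite DE -intrB => /eqP; rewrite subr_eq0 => /eqP /inj.
  lia.
have D0 : D != 0 by rewrite -size_poly_gt0; exact: ltn_trans Ds.
have [c c0 [K K1 H]] := poly_lower D0.
exists c => //; exists K => // k kK.
rewrite intrB -DE (le_trans _ (H _ kK))// ler_wpM2l ?(ltW c0)//.
rewrite -[leLHS]expr1 ler_weXn2l//; first exact: le_trans kK.
by rewrite -ltnS prednK// (ltn_trans _ Ds).
Qed.

(** Only finitely many [s] are involved: the constants are combined by minimum and maximum, by
    induction on [S]. *)
Lemma poly_reflect_gap_unif p (S : nat) : injective (fun k : int => p.[k%:~R]) ->
  exists2 c, 0 < c & exists2 K, 1 <= K & forall (s k : int), (absz s < S)%N ->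
  K <= `|k%:~R : R| -> c * `|k%:~R : R| <= `|p.[k%:~R] - p.[(s - k)%:~R]|.
Proof.
move=> inj; elim: S => [|S [c c0 [K K1 H]]]; first by exists 1 => //; exists 1.
have [c1 c10 [K11 K111 H1]] := poly_reflect_gap (Posz S) inj.
have [c2 c20 [K2 K21 H2]] := poly_reflect_gap (- Posz S) inj.
exists (Num.min c (Num.min c1 c2)); first by rewrite !lt_min c0 c10.
exists (Num.max K (Num.max K11 K2)); first by rewrite le_max K1.
move=> s k sS; rewrite !ge_max => /and3P[kK kK1 kK2].
have aux (c' b : R) : Num.min c (Num.min c1 c2) <= c' ->
    c' * `|k%:~R : R| <= b -> Num.min c (Num.min c1 c2) * `|k%:~R : R| <= b.
  by move=> h; apply: le_trans; rewrite ler_wpM2r.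
have [sS'|sS'] := ltnP (absz s) S.
  by apply: (aux c); [rewrite ge_min lexx|exact: H].
have [->|->] : s = Posz S \/ s = - Posz S by move: sS sS'; clear; lia.
  by apply: (aux c1); [rewrite !ge_min lexx orbT|exact: H1].
by apply: (aux c2); [rewrite !ge_min lexx !orbT|exact: H2].
Qed.

Lemma absz_int_norm (k : int) : (absz k)%:R = `|k%:~R : R| :> R.
Proof. by rewrite natr_absz intr_norm. Qed.

Lemma size_comp_opp p : size (p \Po (- 'X)) = size p.
Proof. by rewrite size_comp_poly2// size_polyN size_polyX. Qed.

Lemma horner_comp_opp p x : (p \Po (- 'X)).[x] = p.[- x].
Proof. by rewrite !(hornerE, horner_comp). Qed.

(** With |m| <= |k|: if |k| - |m| is large the leading term decides. Otherwise, for equal signs the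
    derivative has size N^(n-1) >= N with N = |k|, and for opposite signs k + m is bounded, so that
    m is a reflection of k. *)
Lemma poly_growing_gaps p n : size p = n.+1 -> (2 <= n)%N ->
  injective (fun k : int => p.[k%:~R]) ->
  exists2 c, 0 < c & exists K, growing_gaps (fun k : int => p.[k%:~R]) c K.
Proof.
move=> sp n2 inj; have n0 : (0 < n)%N by exact: ltnW.
have [c1 c10 [C0 C01 H1]] := poly_gap_lower sp n0.
have [c2 c20 [K2 K21 H2]] := poly_slope sp n0.
have [|c3 c30 [K3 K31 H3]] := @poly_slope (p \Po (- 'X)) n _ n0.
  by rewrite size_comp_opp.
pose S := (Num.truncn C0).+1.
have SC : C0 < S%:R by exact: truncnS_gt.
have [c4 c40 [K4 K41 H4]] := poly_reflect_gap_unif S inj.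
pose c := Num.min c1 (Num.min (c2 / 2) (Num.min (c3 / 2) c4)).
have cc1 : c <= c1 by rewrite ge_min lexx.
have cc2 : c <= c2 / 2 by rewrite !ge_min lexx !orbT.
have cc3 : c <= c3 / 2 by rewrite !ge_min lexx !orbT.
have cc4 : c <= c4 by rewrite !ge_min lexx !orbT.
have c0 : 0 < c by rewrite !lt_min c10 c40 !divr_gt0.
exists c => //.
pose B := 2 * (C0 + K2 + K3 + K4); exists (Num.truncn B).+1 => k m.
wlog mk : k m / (absz m <= absz k)%N.
  move=> H km KM; have [mk|mk] := orP (leq_total (absz m) (absz k)); first exact: H.
  by rewrite distrC maxnC; apply: H => //; rewrite 1?eq_sym// maxnC.
move=> km; rewrite (maxn_idPl mk) => KM.
have kB : B <= `|k%:~R : R|.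
  by rewrite -absz_int_norm (le_trans (ltW (truncnS_gt _)))// ler_nat.
rewrite absz_int_norm; set N : R := `|k%:~R : R| in kB *.
have [N1 KN2 KN3 KN4 CN] : [/\ 1 <= N, K2 <= N / 2, K3 <= N / 2, K4 <= N & C0 <= N / 2].
  by move: kB C01 K21 K31 K41; rewrite /B; clear; split; lra.
have NX (e : nat) (X : R) : (0 < e)%N -> 1 <= X -> X <= X ^+ e.
  by move=> e0 X1; rewrite -[leLHS]expr1 ler_weXn2l.
have n10 : (0 < n.-1)%N by rewrite -ltnS prednK.
have N0 : 0 <= N by lra.
(* In the far case |k|^(n-1) already supplies the factor N, because n >= 2. *)
have [far|near] := leP C0 (N - `|m%:~R : R|).
  rewrite (le_trans _ (H1 _ _ N1 far))//.
  have h : N <= N ^+ n.-1 by exact: NX.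
  have h2 : N * 1 <= N ^+ n.-1 * (N - `|m%:~R : R|) by rewrite ler_pM//; lra.
  by rewrite mulr1 in h2; rewrite ler_pM// ltW.
have NN : N / 2 <= N by move: N0; clear; lra.
have mN : `|m%:~R : R| <= N by rewrite /N -!absz_int_norm ler_nat.
have mB : N / 2 <= `|m%:~R : R| by move: near CN; clear; lra.
have km1 : 1 <= `|k%:~R - m%:~R| :> R.
  by rewrite -intrB -intr_norm -[1]/(1%:~R) ler_int; move: km; clear; lia.
have slope (x y c' K' : R) (f : {poly R}) : 1 <= K' -> 0 < c' -> c <= c' / 2 ->
    (forall x y, K' <= x -> K' <= y ->
      c' * `|x - y| * Num.min x y ^+ n.-1 <= `|f.[x] - f.[y]|) ->
    N / 2 <= x -> N / 2 <= y -> K' <= N / 2 -> 1 <= `|x - y| -> c * N <= `|f.[x] - f.[y]|.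
  move=> K'1 c'0 cc' H Nx Ny KN xy.
  rewrite (le_trans _ (H x y (le_trans KN Nx) (le_trans KN Ny)))//.
  have h1 : N / 2 <= Num.min x y by rewrite le_min Nx.
  have h2 : N / 2 <= Num.min x y ^+ n.-1
    by apply: (le_trans h1); apply: NX => //; exact: le_trans (le_trans K'1 KN) h1.
  have h3 : 1 * (N / 2) <= `|x - y| * Num.min x y ^+ n.-1
    by apply: ler_pM => //; move: N0; clear; lra.
  rewrite -mulrA; move: h3 N0 cc' c'0; clear; set Z := _ * _ ^+ _; nra.
have [k0|k0] := leP 0 k; have [m0|m0] := leP 0 m.
- have kE : k%:~R = N by rewrite /N ger0_norm// ler0z.
  have mE : m%:~R = `|m%:~R : R| :> R by rewrite ger0_norm// ler0z.
  move: km1; rewrite kE mE => km1.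
  exact: (slope _ _ c2 K2 p K21 c20 cc2 H2 NN mB KN2 km1).
(* Opposite signs: |k + m| = |k| - |m| < [C0], so the reflection bound applies with s = k + m. *)
- have -> : m = (k + m) - k by ring.
  rewrite (le_trans _ (H4 _ _ _ _))//.
  + by rewrite ler_wpM2r.
  + rewrite -(ltr_nat R) (lt_trans _ SC)// (le_lt_trans _ near)//.
    rewrite absz_int_norm.
    by rewrite -intr_norm /N -!intr_norm -intrB ler_int; move: k0 m0 mk; clear; lia.
- have -> : m = (k + m) - k by ring.
  rewrite (le_trans _ (H4 _ _ _ _))//.
  + by rewrite ler_wpM2r.
  + rewrite -(ltr_nat R) (lt_trans _ SC)// (le_lt_trans _ near)//.
    rewrite absz_int_norm.
    by rewrite -intr_norm /N -!intr_norm -intrB ler_int; move: k0 m0 mk; clear; lia.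
(* Both indices negative: the slope bound is used for p(-X). *)
- have kE : - k%:~R = N by rewrite /N ltr0_norm// ltrz0.
  have mE : - m%:~R = `|m%:~R : R| :> R by rewrite ltr0_norm// ltrz0.
  have -> : p.[k%:~R] - p.[m%:~R] =
      (p \Po (- 'X)).[- k%:~R] - (p \Po (- 'X)).[- m%:~R].
    by rewrite !horner_comp_opp !opprK.
  have {km1} : 1 <= `|- k%:~R - - m%:~R| :> R by rewrite opprK addrC distrC.
  rewrite kE mE => km1.
  exact: (slope _ _ c3 K3 _ K31 c30 cc3 H3 NN mB KN3 km1).
Qed.

(** If the sums differ by at least 1, the first derivative contributes order N^(n-1), while the
    variation of p' over the window contributes only L^2 N^(n-2). If they agree, the expression is a
    second difference p''(w) h (y2 - x1) with h = y1 - x1. *)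
Lemma poly_second_difference p n : size p = n.+1 -> (2 <= n)%N ->
  exists2 c, 0 < c & exists2 C, 1 <= C & forall N L, C <= N -> 1 <= L -> C * L ^+ 2 <= N ->
  forall x1 x2 y1 y2, `|x1 - N| <= L -> `|x2 - N| <= L -> `|y1 - N| <= L -> `|y2 - N| <= L ->
  (1 <= `|x1 + x2 - y1 - y2| ->
     c * N <= `|p.[x1] + p.[x2] - (p.[y1] + p.[y2])|) /\
  (x1 + x2 = y1 + y2 ->
     c * (`|x1 - y1| * `|x1 - y2|) <= `|p.[x1] + p.[x2] - (p.[y1] + p.[y2])|).
Proof.
move=> sp n2; case: n sp n2 => [//|[//|n]] sp _.
have sd : size p^`() = n.+2 by rewrite polyorder.size_deriv sp.
have sdd : size p^`()^`() = n.+1 by rewrite polyorder.size_deriv sd.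
have d0 : p^`() != 0 by rewrite -size_poly_gt0 sd.
have dd0 : p^`()^`() != 0 by rewrite -size_poly_gt0 sdd.
have [c1 c10 [K1 K11 H1]] := poly_lower d0.
have [c2 c20 [K2 K21 H2]] := poly_lower dd0.
have [C2 C20 H3] := poly_upper p^`()^`().
rewrite sd sdd /= in H1 H2 H3.
pose g := c1 / 2 ^+ n.+1.
have g0 : 0 < g by rewrite divr_gt0 ?exprn_gt0.
(* The last summand makes the error term 4 C2 (2 N)^n L^2 at most half of the main term g
   N^(n+1). *)
pose C := 2 + 2 * K1 + 2 * K2 + 8 * C2 * 2 ^+ n / g.
have C8 : 0 <= 8 * C2 * 2 ^+ n / g.
  by rewrite divr_ge0 ?(ltW g0)// mulr_ge0 ?exprn_ge0// mulr_ge0// ltW.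
exists (Num.min c2 (g / 2)); first by rewrite lt_min c20 divr_gt0.
exists C; first by rewrite /C; lra.
move=> N L CN L1 CLN x1 x2 y1 y2 hx1 hx2 hy1 hy2.
have [N1 NK1 NK2] : [/\ 1 <= N, K1 <= N / 2 & K2 <= N / 2].
  by move: CN C8 K11 K21; rewrite /C; clear; split; lra.
have N0 : 0 <= N := le_trans ler01 N1.
have Nh1 : 1 <= N / 2 := le_trans K11 NK1.
have L0 : 0 <= L := le_trans ler01 L1.
have L2 : 1 <= L ^+ 2 by rewrite exprn_ege1.
have LL2 : L <= L ^+ 2 by rewrite expr2 ler_peMr//; lra.
have LN : L <= N / 2.
  have : 2 * L ^+ 2 <= C * L ^+ 2.
    by rewrite ler_wpM2r ?exprn_ge0//; move: C8 K11 K21; rewrite /C; clear; lra.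
  by move: CLN LL2; clear; lra.
have box x : `|x - N| <= L -> N - L <= x <= N + L by rewrite ler_distl.
have big z : N - L <= z <= N + L -> N / 2 <= `|z| /\ `|z| <= 2 * N.
  by move=> /andP[za zb]; move: LN N0 za zb; clear => *; rewrite ger0_norm; lra.
have [bx1 bx2 by1 by2] : [/\ N - L <= x1 <= N + L, N - L <= x2 <= N + L,
  N - L <= y1 <= N + L & N - L <= y2 <= N + L] by split; exact: box.
have pow1 z m : N - L <= z <= N + L -> (N / 2) ^+ m <= `|z| ^+ m.
  by move=> /big[? ?]; rewrite lerXn2r ?nnegrE// divr_ge0.
split=> [S1|S0].
- have [z1 hz1 E1] := mvt_between p bx1 by1.
  have [z2 hz2 E2] := mvt_between p bx2 by2.
  have [w hw E3] := mvt_between p^`() hz2 hz1.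
  have -> : p.[x1] + p.[x2] - (p.[y1] + p.[y2]) =
     (x1 + x2 - y1 - y2) * p^`().[z1] + (x2 - y2) * (p^`()^`().[w] * (z2 - z1)).
    rewrite -E3; have -> : p.[x1] + p.[x2] - (p.[y1] + p.[y2]) =
      (p.[x1] - p.[y1]) + (p.[x2] - p.[y2]) by ring.
    by rewrite E1 E2; ring.
  rewrite (le_trans _ (lerB_normD _ _))//.
  have Nn : N <= N ^+ n.+1 by rewrite -[leLHS]expr1 ler_weXn2l.
  have A1 : g * N ^+ n.+1 <= `|(x1 + x2 - y1 - y2) * p^`().[z1]|.
    rewrite normrM -[leLHS]mul1r ler_pM ?mulr_ge0 ?exprn_ge0 ?(ltW c10)//.
    have [z1a z1b] := big _ hz1.
    rewrite (le_trans _ (H1 _ (le_trans NK1 z1a)))//.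
    rewrite /g mulrAC -mulrA ler_wpM2l ?(ltW c10)// (le_trans _ (pow1 _ n.+1 hz1))//.
    by rewrite expr_div_n.
  have A2 : `|(x2 - y2) * (p^`()^`().[w] * (z2 - z1))| <= g / 2 * N ^+ n.+1.
    have [wa wb] := big _ hw.
    have e1 : `|x2 - y2| <= 2 * L.
      by move: bx2 by2; clear => /andP[? ?] /andP[? ?]; rewrite ler_norml; lra.
    have e2 : `|z2 - z1| <= 2 * L.
      by move: hz1 hz2; clear => /andP[? ?] /andP[? ?]; rewrite ler_norml; lra.
    have e3 : `|p^`()^`().[w]| <= C2 * (2 * N) ^+ n.
      by apply: H3 => //; move: N1; clear; lra.
    rewrite !normrM.
    apply: (@le_trans _ _ (2 * L * (C2 * (2 * N) ^+ n * (2 * L)))).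
      by rewrite ler_pM ?mulr_ge0// ler_pM.
    have h : 8 * C2 * 2 ^+ n / g * L ^+ 2 <= N.
      by rewrite (le_trans _ CLN)// ler_wpM2r ?exprn_ge0//; move: K11 K21; rewrite /C; clear; lra.
    have {}h : 8 * C2 * 2 ^+ n * L ^+ 2 <= g * N.
      by move: h; rewrite mulrAC ler_pdivrMr// [N * g]mulrC.
    have Nn0 : 0 <= N ^+ n by rewrite exprn_ge0.
    rewrite exprMn exprS.
    have := ler_wpM2r Nn0 h; clear; set M := N ^+ n; set T := 2 ^+ n; lra.
  have : Num.min c2 (g / 2) * N <= g / 2 * N ^+ n.+1.
    rewrite ler_pM//; last by rewrite ge_min lexx orbT.
    by rewrite le_min !ltW ?divr_gt0.
  by move: A1 A2; clear; lra.
- pose h := y1 - x1.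
  have hE : h = x2 - y2 by rewrite /h; lra.
  have e1 : x1 + h = y1 by rewrite /h; ring.
  have e2 : y2 + h = x2 by rewrite hE; ring.
  pose q := (p \Po ('X + h%:P)) - p.
  have qE x : q.[x] = p.[x + h] - p.[x] by rewrite /q !(hornerE, horner_comp).
  have dqE x : q^`().[x] = p^`().[x + h] - p^`().[x].
    by rewrite /q derivB deriv_comp derivD derivX derivC addr0 mulr1 !(hornerE, horner_comp).
  have -> : p.[x1] + p.[x2] - (p.[y1] + p.[y2]) = q.[y2] - q.[x1].
    by rewrite !qE e1 e2; ring.
  pose lo := Num.min x1 y2; pose hi := Num.max x1 y2.
  have xI : lo <= x1 <= hi by rewrite ge_min le_max lexx.
  have yI : lo <= y2 <= hi by rewrite ge_min le_max lexx !orbT.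
  have [z /andP[zlo zhi] ->] := mvt_between q yI xI.
  have zb : N - L <= z <= N + L.
    apply/andP; split.
      by rewrite (le_trans _ zlo)// le_min; move: bx1 by2 => /andP[-> _] /andP[-> _].
    by rewrite (le_trans zhi)// ge_max; move: bx1 by2 => /andP[_ ->] /andP[_ ->].
  (* z lies between x1 and y2, hence z + h lies between x1 + h = y1 and y2 + h = x2. *)
  have zhb : N - L <= z + h <= N + L.
    have hlo : lo + h <= z + h by rewrite lerD2r.
    have hhi : z + h <= hi + h by rewrite lerD2r.
    apply/andP; split.
      rewrite (le_trans _ hlo)// /lo minEle; case: ifP => _.
        by rewrite e1; case/andP: by1.
      by rewrite e2; case/andP: bx2.
    rewrite (le_trans hhi)// /hi maxEle; case: ifP => _.
      by rewrite e2; case/andP: bx2.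
    by rewrite e1; case/andP: by1.
  have [w hw E] := mvt_between p^`() zhb zb.
  rewrite dqE E (_ : z + h - z = h); last by ring.
  have [wa wb] := big _ hw.
  have c2w : c2 <= `|p^`()^`().[w]|.
    rewrite (le_trans _ (H2 _ (le_trans NK2 wa)))//.
    by rewrite ler_peMr ?(ltW c20)// exprn_ege1// (le_trans Nh1 wa).
  have m0 : 0 <= Num.min c2 (g / 2) by rewrite le_min !ltW ?divr_gt0.
  rewrite (distrC x1 y1) (distrC x1 y2) -/h !normrM -mulrA.
  by rewrite ler_pM ?mulr_ge0// ge_min c2w.
Qed.

End PolynomialGrowth.

(** * Fourth moments of sums over a short block of positive indices *)

Section FourthMoment.
Context {R : realType}.
Implicit Types (p : {poly R}) (s : seq int) (b : int -> R[i]).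

Definition freq p (k : int) : R := p.[k%:~R].

(** The ball contains 2 L + 1 integers, at most 3 L since L > 0. *)
Lemma size_int_ball s (k0 : int) (L : nat) : uniq s -> (0 < L)%N ->
  (forall k, k \in s -> (absz (k - k0)%R <= L)%N) -> (size s <= 3 * L)%N.
Proof.
move=> us L0 sL.
pose r := [seq k0 - Posz L + Posz j | j <- iota 0 (L + L).+1].
apply: (@leq_trans (size r)); last by rewrite size_map size_iota; lia.
apply: uniq_leq_size => // k /sL kL; apply/mapP.
exists (absz (k - k0 + Posz L)); last by lia.
by rewrite mem_iota; lia.
Qed.

Lemma inv_sqN (h : int) : inv_sq (- h) = inv_sq h :> R.
Proof. by rewrite /inv_sq oppr_eq0 mulrNz sqrrN. Qed.

Lemma inv_prod_le_inv_sq (h d : int) : h != 0 -> d != 0 ->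
  (`|h%:~R| * `|d%:~R|)^-1 <= inv_sq h + inv_sq d :> R.
Proof.
move=> h0 d0; rewrite /inv_sq (negbTE h0) (negbTE d0).
rewrite -[h%:~R ^+ 2]real_normK ?num_real// -[d%:~R ^+ 2]real_normK ?num_real//.
rewrite invfM -!exprVn; set x := _^-1; set y := _^-1.
have : 0 <= (x - y) ^+ 2 by rewrite sqr_ge0.
have : 0 <= x * y by rewrite mulr_ge0 ?invr_ge0.
nra.
Qed.

(** Both bounds on [exp_int] are used: 1/|Lam| with the second difference estimate, and T when k1
    equals m1 or m2, where [inv_sq 0 = 1] covers it. The product |k1 - m1| |k1 - m2| is decoupled
    into a sum of two [inv_sq] so that it can be summed freely. *)
Lemma exp_int_quad_le p n (T : R) : size p = n.+1 -> (2 <= n)%N -> 0 <= T ->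
  exists2 A, 0 < A & exists K, forall N L : nat, (K <= N)%N -> (0 < L)%N ->
    (K * L ^ 2 <= N)%N -> forall k1 k2 m1 m2 : int,
    (absz (k1 - Posz N)%R <= L)%N -> (absz (k2 - Posz N)%R <= L)%N ->
    (absz (m1 - Posz N)%R <= L)%N -> (absz (m2 - Posz N)%R <= L)%N ->
    cmod (exp_int T (freq p k1 + freq p k2 - (freq p m1 + freq p m2))) <=
    A * (N%:R^-1 + (k2 == m1 + m2 - k1)%:R * (inv_sq (k1 - m1) + inv_sq (k1 - m2))).
Proof.
move=> sp n2 T0.
have [c c0 [C C1 H]] := poly_second_difference sp n2.
exists (T + c^-1); first by rewrite ltr_wpDl ?invr_gt0.
exists (Num.truncn C).+1 => N L KN L0 KLN k1 k2 m1 m2 hk1 hk2 hm1 hm2.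
have CK : C <= (Num.truncn C).+1%:R by exact/ltW/truncnS_gt.
have CN : C <= N%:R by rewrite (le_trans CK)// ler_nat.
have L1 : 1 <= L%:R :> R by rewrite ler1n.
have CLN : C * L%:R ^+ 2 <= N%:R.
  rewrite (@le_trans _ _ ((Num.truncn C).+1%:R * L%:R ^+ 2))//.
    by rewrite ler_wpM2r ?exprn_ge0.
  by rewrite -natrX -natrM ler_nat.
have N0 : 0 < N%:R :> R by rewrite (lt_le_trans _ CN)// (lt_le_trans _ C1).
have ball (k : int) : (absz (k - Posz N)%R <= L)%N -> `|k%:~R - N%:R| <= L%:R :> R.
  by rewrite -(ler_nat R) absz_int_norm intrB.
have [H1 H2] := H _ _ CN L1 CLN _ _ _ _ (ball _ hk1) (ball _ hk2) (ball _ hm1) (ball _ hm2).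
rewrite -/(freq p k1) -/(freq p k2) -/(freq p m1) -/(freq p m2) in H1 H2.
set Lam := freq p k1 + freq p k2 - (freq p m1 + freq p m2) in H1 H2 *.
have cT : c^-1 <= T + c^-1 by rewrite lerDr.
have A0 : 0 <= T + c^-1 by rewrite addr_ge0// invr_ge0 ltW.
have inv_le (x : R) : 0 < x -> c * x <= `|Lam| -> cmod (exp_int T Lam) <= (T + c^-1) * x^-1.
  move=> x0 h; have lam0 : 0 < `|Lam| by rewrite (lt_le_trans _ h)// mulr_gt0.
  rewrite (le_trans (ler_cmod_exp_int_inv _ _))//; first by rewrite -normr_gt0.
  rewrite (@le_trans _ _ (c * x)^-1)//; first by rewrite lef_pV2 ?posrE// mulr_gt0.
  by rewrite invfM ler_wpM2r// invr_ge0 ltW.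
case: eqP => [S0|/eqP S0]; last first.
  rewrite mul0r addr0; apply: inv_le => //; apply: H1.
  by rewrite -intrD -!intrB -intr_norm -[1]/(1%:~R) ler_int; move: S0; clear; lia.
rewrite mul1r.
have {H1}H2 : c * (`|(k1 - m1)%:~R| * `|(k1 - m2)%:~R|) <= `|Lam|.
  rewrite !intrB; apply: H2; rewrite -!intrD; congr (_%:~R).
  by rewrite S0; ring.
have iN : 0 <= (T + c^-1) * N%:R^-1 by rewrite mulr_ge0// invr_ge0 ltW.
rewrite mulrDr (le_trans _ (_ : (T + c^-1) * (inv_sq (k1 - m1) + inv_sq (k1 - m2)) <= _))//;
  last by rewrite lerDr.
have TA : T <= T + c^-1 by rewrite lerDl invr_ge0 ltW.
have [h0|h0] := eqVneq (k1 - m1) 0.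
  rewrite h0 {1}/inv_sq eqxx (le_trans (ler_cmod_exp_int _ _))//.
  by rewrite (le_trans TA)// ler_peMr// lerDl inv_sq_ge0.
have [d0|d0] := eqVneq (k1 - m2) 0.
  rewrite d0 {2}/inv_sq eqxx (le_trans (ler_cmod_exp_int _ _))//.
  by rewrite (le_trans TA)// ler_peMr// lerDr inv_sq_ge0.
rewrite (le_trans (inv_le _ _ H2))//.
  by rewrite mulr_gt0// normr_gt0 intr_eq0.
by rewrite ler_wpM2l// inv_prod_le_inv_sq.
Qed.

(** The term 1/N over all quadruples gives |s|^4 / N. The quadruples with k1 + k2 = m1 + m2 give at
    most 10 |s|^2. With |s| <= 3 L and L^2 <= N the total is at most (81 + 90) L^2. *)
Lemma fourth_moment_pos p n (T : R) : size p = n.+1 -> (2 <= n)%N -> 0 <= T ->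
  exists2 A, 0 < A & exists K, forall N L : nat, (K <= N)%N -> (0 < L)%N ->
    (K * L ^ 2 <= N)%N -> forall s b B, uniq s ->
    (forall k, k \in s -> (absz (k - Posz N)%R <= L)%N) ->
    (forall k, k \in s -> cmod (b k) <= B) ->
    int0 T (fun t => cmod (trig_sum s b (freq p) t) ^+ 4) <= A * B ^+ 4 * L%:R ^+ 2.
Proof.
move=> sp n2 T0; have [A A0 [K H]] := exp_int_quad_le sp n2 T0.
exists (A * 171); first by rewrite mulr_gt0.
exists K.+1 => N L KN L0 KLN s b B us sN sB.
have {}H := H N L (ltnW KN) L0 (leq_trans (leq_mul (leqnSn _) (leqnn _)) KLN).
have L2N : (L ^ 2 <= N)%N by rewrite (leq_trans _ KLN)// leq_pmull.
have N0 : 0 < N%:R :> R by rewrite ltr0n (leq_trans _ KN).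
have B4 : 0 <= B ^+ 4 by rewrite -[4%N]/(2 * 2)%N exprM exprn_even_ge0.
rewrite (le_trans (int0_cmod4_le _ _ _ _))//.
pose e k1 m1 m2 : R := inv_sq (k1 - m1) + inv_sq (k1 - m2).
have e0 k1 m1 m2 : 0 <= e k1 m1 m2 by rewrite addr_ge0 ?inv_sq_ge0.
apply: (@le_trans _ _ (\sum_(k1 <- s) \sum_(k2 <- s) \sum_(m1 <- s) \sum_(m2 <- s)
   (A * B ^+ 4) * (N%:R^-1 + (k2 == m1 + m2 - k1)%:R * e k1 m1 m2))).
  rewrite big_seq [leRHS]big_seq; apply: ler_sum => k1 k1s.
  rewrite big_seq [leRHS]big_seq; apply: ler_sum => k2 k2s.
  rewrite big_seq [leRHS]big_seq; apply: ler_sum => m1 m1s.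
  rewrite big_seq [leRHS]big_seq; apply: ler_sum => m2 m2s.
  have B0 : 0 <= B by rewrite (le_trans (cmod_ge0 _) (sB _ k1s)).
  have bB : cmod (b k1) * cmod (b k2) * (cmod (b m1) * cmod (b m2)) <= B ^+ 4.
    have -> : B ^+ 4 = B * B * (B * B) by ring.
    by rewrite !ler_pM ?mulr_ge0 ?cmod_ge0 ?sB.
  rewrite [A * B ^+ 4]mulrC -[leRHS]mulrA ler_pM ?mulr_ge0 ?cmod_ge0//.
  by apply: H; exact: sN.
have sM : (size s <= 3 * L)%N by exact: size_int_ball sN.
set M : R := (size s)%:R.
have ML : M <= 3 * L%:R by rewrite -natrM ler_nat.
have M0 : 0 <= M by [].
have cst (x : R) : \sum_(k <- s) x = M * x.
  by rewrite big_const_seq count_predT iter_addr_0 mulr_natl.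
have main : \sum_(k1 <- s) \sum_(k2 <- s) \sum_(m1 <- s) \sum_(m2 <- s)
   (N%:R^-1 + (k2 == m1 + m2 - k1)%:R * e k1 m1 m2) <= M ^+ 4 * N%:R^-1 + 10 * M ^+ 2.
  under eq_bigr do under eq_bigr do under eq_bigr do rewrite big_split /= cst.
  under eq_bigr do under eq_bigr do rewrite big_split /= cst.
  under eq_bigr do rewrite big_split /= cst.
  rewrite big_split /= cst; apply: lerD; first by rewrite !exprS expr0 mulr1 !mulrA.
  (* The sum over k2 collapses: given k1, m1 and m2, at most one k2 satisfies the equation. *)
  apply: (@le_trans _ _ (\sum_(k1 <- s) \sum_(m1 <- s) \sum_(m2 <- s) e k1 m1 m2)).
    apply: ler_sum => k1 _; rewrite exchange_big /=; apply: ler_sum => m1 _.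
    rewrite exchange_big /=; apply: ler_sum => m2 _.
    rewrite -mulr_suml -[leRHS]mul1r ler_wpM2r//.
    rewrite -natr_sum lern1.
    have -> : (\sum_(k2 <- s) (k2 == (m1 + m2 - k1)%R) = count_mem (m1 + m2 - k1)%R s)%N.
      by rewrite -sum1_count [RHS]big_mkcond; apply: eq_bigr => k _ /=; case: eqP.
    by rewrite count_uniq_mem// leq_b1.
  have s5 k : \sum_(m <- s) inv_sq (k - m) <= 5 :> R.
    by under eq_bigr do rewrite -inv_sqN opprB; exact: sum_inv_sq_shift.
  apply: (@le_trans _ _ (\sum_(k1 <- s) (M * 5 + M * 5))); last first.
    by rewrite cst expr2; move: M0; clear; lra.
  apply: ler_sum => k1 _; under eq_bigr do rewrite big_split /= cst.
  rewrite big_split /= cst lerD//; last by rewrite ler_wpM2l.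
  by rewrite -mulr_sumr ler_wpM2l.
under eq_bigr do under eq_bigr do under eq_bigr do rewrite -mulr_sumr.
under eq_bigr do under eq_bigr do rewrite -mulr_sumr.
under eq_bigr do rewrite -mulr_sumr.
rewrite -mulr_sumr.
have AB : 0 <= A * B ^+ 4 by rewrite mulr_ge0// ltW.
rewrite (le_trans (ler_wpM2l AB main))//.
have -> : A * 171 * B ^+ 4 * L%:R ^+ 2 = A * B ^+ 4 * (171 * L%:R ^+ 2) by ring.
rewrite ler_wpM2l//.
have M2 : M ^+ 2 <= 9 * L%:R ^+ 2.
  by rewrite (_ : 9 * _ = (3 * L%:R) ^+ 2); [rewrite lerXn2r ?nnegrE ?mulr_ge0|ring].
have L2N' : (L%:R : R) ^+ 2 * N%:R^-1 <= 1.
  by rewrite ler_pdivrMr// mul1r -natrX ler_nat.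
have M4 : M ^+ 4 * N%:R^-1 <= 81 * L%:R ^+ 2.
  apply: (@le_trans _ _ ((9 * L%:R ^+ 2) ^+ 2 * N%:R^-1)).
    rewrite ler_wpM2r ?invr_ge0 ?(ltW N0)// (exprM M 2 2) expr2 [leRHS]expr2.
    by rewrite ler_pM ?exprn_ge0.
  have -> : (9 * (L%:R : R) ^+ 2) ^+ 2 * N%:R^-1 = 81 * (L%:R ^+ 2 * (L%:R ^+ 2 * N%:R^-1)) by ring.
  by rewrite ler_wpM2l// ler_piMr// exprn_ge0.
by move: M2 M4; clear; lra.
Qed.

End FourthMoment.

(** * Frequency localization, comparison of L^1, L^2 and L^4 norms, and tails *)

Section Localization.
Context {R : realType}.
Local Open Scope complex_scope.
Implicit Types (p : {poly R}) (s : seq int) (b d : int -> R[i]) (lam : int -> R).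

Lemma mean_normZ T w s d lam :
  mean_norm T s (fun k => w * d k) lam = cmod w * mean_norm T s d lam.
Proof.
rewrite /mean_norm -int0Z; last exact: continuous_cmod_trig.
by apply: eq_int0 => t; rewrite trig_sumZ cmodM.
Qed.

(** The r-fold window average at frequency [l], divided by tau^r. Its multiplier is at most 1
    everywhere, at least 2^-r within distance 1 / (2 pi tau) of [l], and small far from [l]. *)
Lemma local_average lam (T tau l : R) (r : nat) s d :
  0 <= T -> 0 < tau -> r%:R * tau <= T / 2 -> exists b,
  [/\ mean_norm (T / 2) s b lam <= mean_norm T s d lam,
      forall k, cmod (b k) <= cmod (d k),
      forall k, 2 * pi * (`|lam k - l| * tau) <= 1 -> cmod (d k) <= 2 ^+ r * cmod (b k) &
      forall k, 0 < `|lam k - l| ->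
        cmod (b k) <= cmod (d k) * ((`|lam k - l| * tau)^-1) ^+ r].
Proof.
move=> T0 tau0 rT; have tr0 : 0 < tau ^+ r by rewrite exprn_gt0.
pose w : R[i] := ((tau ^+ r)^-1)%:C.
have cw : cmod w = (tau ^+ r)^-1 by rewrite cmod_real ger0_norm// invr_ge0 ltW.
exists (fun k => w * (d k * exp_int tau (lam k - l) ^+ r)).
have T2 : 0 <= T / 2 by rewrite divr_ge0.
split=> [|k|k h|k h].
- rewrite mean_normZ cw ler_pdivrMl//.
  rewrite (le_trans (mean_norm_average _ _ _ _ _ T2 (ltW tau0)))// ler_wpM2l ?(ltW tr0)//.
  apply: mean_norm_mono; first by rewrite addr_ge0// mulr_ge0// ltW.
  by move: rT; clear; lra.
- rewrite !cmodM cmodX cw ler_pdivrMl// mulrC ler_wpM2r ?cmod_ge0//.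
  by rewrite lerXn2r ?nnegrE ?cmod_ge0 ?(ltW tau0)// ler_cmod_exp_int// ltW.
- have h2 := exp_int_ge_half (ltW tau0) h.
  have h3 : tau ^+ r <= 2 ^+ r * cmod (exp_int tau (lam k - l)) ^+ r.
    rewrite -exprMn lerXn2r ?nnegrE ?(ltW tau0) ?mulr_ge0 ?cmod_ge0//.
    by move: h2; clear; lra.
  rewrite !cmodM cmodX cw; set e := cmod (exp_int _ _) in h3 *.
  have -> : 2 ^+ r * ((tau ^+ r)^-1 * (cmod (d k) * e ^+ r)) =
    cmod (d k) * ((tau ^+ r)^-1 * (2 ^+ r * e ^+ r)) by ring.
  by rewrite ler_peMr ?cmod_ge0// ler_pdivlMl// mulr1.
- rewrite !cmodM cmodX cw mulrCA ler_wpM2l ?cmod_ge0// ler_pdivrMl//.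
  rewrite -exprMn lerXn2r ?nnegrE ?cmod_ge0//.
    by rewrite mulr_ge0 ?invr_ge0 ?mulr_ge0 ?(ltW tau0)// ltW.
  rewrite (le_trans (ler_cmod_exp_int_inv (ltW tau0) _))//; first by rewrite -normr_gt0.
  by rewrite invfM mulrCA divff ?mulr1// gt_eqF.
Qed.

(* |F|^2 <= H |F| + |F|^4 / H^2 pointwise, according to whether |F| <= H. *)
Lemma l2_le_l1_l4 lam (T H g B : R) s b : 0 <= T -> 0 < H -> 0 < g -> uniq s ->
  (forall k, k \in s -> cmod (b k) <= B) ->
  (forall k m, k \in s -> m \in s -> k != m -> g <= `|lam k - lam m|) ->
  T * (\sum_(k <- s) cmod (b k) ^+ 2) <= (size s)%:R ^+ 2 * B ^+ 2 / g +
    H * mean_norm T s b lam + int0 T (fun t => cmod (trig_sum s b lam t) ^+ 4) / H ^+ 2.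
Proof.
move=> T0 H0 g0 us bB gap.
have cf := continuous_cmod_trig (s := s) (d := b) (lam := lam).
have cfX := @continuous_cmod_trigX R int s b lam.
have H20 : 0 < H ^+ 2 by rewrite exprn_gt0.
have h1 : int0 T (fun t => cmod (trig_sum s b lam t) ^+ 2) <=
    H * mean_norm T s b lam + int0 T (fun t => cmod (trig_sum s b lam t) ^+ 4) / H ^+ 2.
  rewrite -int0Z// [X in _ + X]mulrC -int0Z; last exact: cfX.
  rewrite -int0D; last 2 first.
  - by move=> t; apply: cvgM; [exact: cvg_cst|exact: cf].
  - by move=> t; apply: cvgM; [exact: cvg_cst|exact: cfX].
  apply: le_int0; first exact: cfX.
    move=> t; apply: cvgD; apply: cvgM; try exact: cvg_cst; [exact: cf|exact: cfX].
  move=> t _; set x := cmod _.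
  have x0 : 0 <= x by exact: cmod_ge0.
  have [xH|/ltW xH] := leP x H.
    apply: (@le_trans _ _ (H * x)); first by rewrite expr2 ler_wpM2r.
    by rewrite lerDl mulr_ge0 ?exprn_ge0 ?invr_ge0 ?(ltW H20).
  apply: (@le_trans _ _ ((H ^+ 2)^-1 * x ^+ 4)); last by rewrite lerDr mulr_ge0 ?(ltW H0).
  rewrite mulrC ler_pdivlMr// (exprM x 2 2) [leRHS]expr2 ler_wpM2l ?exprn_ge0//.
  by rewrite lerXn2r ?nnegrE ?(ltW H0).
have h2 := int0_cmod2_ge b lam us T0.
have h3 : \sum_(k <- s) \sum_(m <- s | m != k)
     cmod (b k) * cmod (b m) * cmod (exp_int T (lam k - lam m)) <=
     (size s)%:R ^+ 2 * B ^+ 2 / g.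
  have gi : 0 <= g^-1 by rewrite invr_ge0 ltW.
  apply: (@le_trans _ _ (\sum_(k <- s) \sum_(m <- s) B ^+ 2 / g)); last first.
    have cst (x : R) : \sum_(k <- s) x = (size s)%:R * x.
      by rewrite big_const_seq count_predT iter_addr_0 mulr_natl.
    by rewrite !cst expr2 !mulrA.
  rewrite big_seq [leRHS]big_seq; apply: ler_sum => k ks.
  rewrite big_mkcond big_seq [leRHS]big_seq; apply: ler_sum => m ms.
  have B0 : 0 <= B by rewrite (le_trans (cmod_ge0 _) (bB _ ks)).
  case: ifP => [mk|_]; last by rewrite mulr_ge0 ?exprn_ge0.
  rewrite expr2 !ler_pM ?mulr_ge0 ?cmod_ge0 ?bB//.
  have gkm : g <= `|lam k - lam m| by apply: gap => //; rewrite eq_sym.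
  have lkm : 0 < `|lam k - lam m| by exact: lt_le_trans gkm.
  rewrite (le_trans (ler_cmod_exp_int_inv T0 _))//; first by rewrite -normr_gt0.
  by rewrite lef_pV2.
by move: h1 h2 h3; clear; lra.
Qed.

(** The negative indices are reflected, which turns p into p(-X); the two halves are joined by |z +
    w|^4 <= 8 (|z|^4 + |w|^4). *)
Lemma fourth_moment p n (T : R) : size p = n.+1 -> (2 <= n)%N -> 0 <= T ->
  exists2 A, 0 < A & exists K, forall N L : nat, (K <= N)%N -> (0 < L)%N ->
    (K * L ^ 2 <= N)%N -> forall s b B, uniq s ->
    (forall k, k \in s -> (absz (Posz (absz k) - Posz N)%R <= L)%N) ->
    (forall k, k \in s -> cmod (b k) <= B) ->
    int0 T (fun t => cmod (trig_sum s b (freq p) t) ^+ 4) <= A * B ^+ 4 * L%:R ^+ 2.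
Proof.
move=> sp n2 T0.
have [A1 A10 [K1 H1]] := fourth_moment_pos sp n2 T0.
have [|A2 A20 [K2 H2]] := @fourth_moment_pos R (p \Po (- 'X)) n T _ n2 T0.
  by rewrite size_comp_opp.
exists (8 * (A1 + A2)); first by rewrite mulr_gt0// addr_gt0.
exists (maxn K1 K2) => N L; rewrite geq_max => /andP[K1N K2N] L0 KLN s b B us sN bB.
have K1L : (K1 * L ^ 2 <= N)%N by rewrite (leq_trans _ KLN)// leq_mul2r leq_maxl orbT.
have K2L : (K2 * L ^ 2 <= N)%N by rewrite (leq_trans _ KLN)// leq_mul2r leq_maxr orbT.
pose sp0 := [seq k <- s | 0 <= k]; pose sn := [seq k <- s | ~~ (0 <= k)].
pose sn' := map -%R sn; pose b' k := b (- k).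
have E t : trig_sum s b (freq p) t =
    trig_sum sp0 b (freq p) t + trig_sum sn' b' (freq (p \Po (- 'X))) t.
  rewrite /trig_sum /sn' big_map /sp0 /sn !big_filter (bigID (fun k => 0 <= k)) /=.
  congr (_ + _); apply: eq_bigr => k _; rewrite /b' opprK.
  by rewrite /freq horner_comp_opp mulrNz opprK.
have {}H1 := H1 N L K1N L0 K1L sp0 b B (filter_uniq _ us).
have {}H2 := H2 N L K2N L0 K2L sn' b' B.
have h1 : int0 T (fun t => cmod (trig_sum sp0 b (freq p) t) ^+ 4) <= A1 * B ^+ 4 * L%:R ^+ 2.
  apply: H1 => k; rewrite mem_filter => /andP[k0 ks]; last exact: bB.
  by have := sN k ks; move: k0; clear; lia.
have h2 : int0 T (fun t => cmod (trig_sum sn' b' (freq (p \Po (- 'X))) t) ^+ 4) <=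
    A2 * B ^+ 4 * L%:R ^+ 2.
  apply: H2.
  - by rewrite map_inj_uniq ?filter_uniq//; exact: oppr_inj.
  - move=> _ /mapP[k + ->]; rewrite mem_filter => /andP[k0 ks].
    by have := sN k ks; move: k0; clear; lia.
  - move=> _ /mapP[k + ->]; rewrite mem_filter => /andP[_ ks].
    by rewrite /b' opprK; exact: bB.
have cX := @continuous_cmod_trigX R int.
apply: (@le_trans _ _ (int0 T (fun t => 8 * cmod (trig_sum sp0 b (freq p) t) ^+ 4 +
   8 * cmod (trig_sum sn' b' (freq (p \Po (- 'X))) t) ^+ 4))).
  apply: le_int0; first exact: cX.
    by move=> t; apply: cvgD; apply: cvgM; (exact: cvg_cst || exact: cX).
  move=> t _; rewrite E; set z := trig_sum sp0 _ _ _; set w := trig_sum sn' _ _ _.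
  have := ler_cmodD z w; have := cmod_ge0 (z + w).
  have := cmod_ge0 z; have := cmod_ge0 w.
  move: (cmod (z + w)) (cmod z) (cmod w) => x y v v0 y0 x0 xyv.
  have : x ^+ 2 <= 2 * (y ^+ 2 + v ^+ 2).
    have : 0 <= (y - v) ^+ 2 by rewrite sqr_ge0.
    have : x ^+ 2 <= (y + v) ^+ 2 by rewrite lerXn2r ?nnegrE ?addr_ge0.
    by clear; lra.
  move=> h.
  have : (x ^+ 2) ^+ 2 <= (2 * (y ^+ 2 + v ^+ 2)) ^+ 2.
    by rewrite lerXn2r ?nnegrE ?mulr_ge0 ?addr_ge0 ?sqr_ge0.
  have : 0 <= (y ^+ 2 - v ^+ 2) ^+ 2 by rewrite sqr_ge0.
  by clear; lra.
rewrite int0D; last 2 first.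
- by move=> t; apply: cvgM; [exact: cvg_cst|exact: cX].
- by move=> t; apply: cvgM; [exact: cvg_cst|exact: cX].
rewrite !int0Z; last 2 first.
- exact: cX.
- exact: cX.
by move: h1 h2; clear; lra.
Qed.

(** Of the r + 2 powers, r give the gain L^-r and two make the sum converge. The distance from |k|
    to N is |k - N| or |k + N|, hence two sums of [inv_sq], each at most 5. *)
Lemma tail_sum (N L r : nat) (X : R) s : uniq s -> (0 < L)%N -> 0 <= X ->
  \sum_(k <- s | (L < absz (Posz (absz k) - Posz N)%R)%N)
     (X / (absz (Posz (absz k) - Posz N)%R)%:R) ^+ r.+2 <= 10 * X ^+ r.+2 / L%:R ^+ r.
Proof.
move=> us L0 X0.
have L0R : 0 < L%:R :> R by rewrite ltr0n.
have c0 : 0 <= X ^+ r.+2 / L%:R ^+ r by rewrite divr_ge0 ?exprn_ge0.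
apply: (@le_trans _ _ (\sum_(k <- s) (X ^+ r.+2 / L%:R ^+ r) *
    (inv_sq (k - Posz N) + inv_sq (k - (- Posz N))))); last first.
  have -> : 10 * X ^+ r.+2 / L%:R ^+ r = X ^+ r.+2 / L%:R ^+ r * 10 by ring.
  rewrite -mulr_sumr ler_wpM2l//.
  rewrite big_split /= (le_trans (lerD (sum_inv_sq_shift _ us) (sum_inv_sq_shift _ us)))//.
  by clear; lra.
rewrite big_mkcond; apply: ler_sum => k _; case: ifP => [hk|_]; last first.
  by rewrite mulr_ge0// addr_ge0// inv_sq_ge0.
set h := absz _ in hk *.
have h0 : 0 < h%:R :> R by rewrite ltr0n (leq_ltn_trans _ hk).
have hinv : inv_sq (Posz h) <= inv_sq (k - Posz N) + inv_sq (k - (- Posz N)) :> R.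
  have [->|[->|[->|->]]] : Posz h = k - Posz N \/ Posz h = - (k - Posz N) \/
      Posz h = k - - Posz N \/ Posz h = - (k - - Posz N).
    by rewrite /h; clear; lia.
  by rewrite lerDl inv_sq_ge0.
  by rewrite inv_sqN lerDl inv_sq_ge0.
  by rewrite lerDr inv_sq_ge0.
  by rewrite inv_sqN lerDr inv_sq_ge0.
rewrite (le_trans _ (ler_wpM2l c0 hinv))//.
rewrite expr_div_n -[leRHS]mulrA ler_wpM2l ?exprn_ge0//.
rewrite /inv_sq; have -> : (Posz h == 0) = false by apply/negbTE; move: hk; clear; lia.
rewrite -addn2 exprD invfM ler_wpM2r ?invr_ge0 ?exprn_ge0//.
by rewrite lef_pV2 ?posrE ?exprn_gt0// lerXn2r ?nnegrE// ler_nat ltnW.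
Qed.

End Localization.

(** * The sum of the coefficients over blocks of length of order q^8 *)

Section BlockEstimate.
Context {R : realType}.
Implicit Types (p : {poly R}) (s : seq int) (b d : int -> R[i]) (lam : int -> R).

(** The discarded terms are bounded at every time by the sum of their moduli. *)
Lemma mean_norm_filter T s b lam (P : pred int) : 0 <= T ->
  mean_norm T [seq k <- s | P k] b lam <=
  mean_norm T s b lam + T * \sum_(k <- s | ~~ P k) cmod (b k).
Proof.
move=> T0; set e := \sum_(_ <- _ | _) _.
have -> : mean_norm T s b lam + T * e =
    int0 T (fun t => cmod (trig_sum s b lam t) + e).
  rewrite int0D; last 2 first.
  - exact: continuous_cmod_trig.
  - by move=> t; exact: cvg_cst.
  by rewrite int0_cst// [e * T]mulrC.
apply: le_int0; first exact: continuous_cmod_trig.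
  by move=> t; apply: cvgD; [exact: continuous_cmod_trig|exact: cvg_cst].
move=> t _.
have E : trig_sum s b lam t = trig_sum [seq k <- s | P k] b lam t +
    trig_sum [seq k <- s | ~~ P k] b lam t.
  by rewrite /trig_sum !big_filter (bigID P).
have := lerB_cmod (trig_sum [seq k <- s | P k] b lam t) (trig_sum [seq k <- s | ~~ P k] b lam t).
have := trig_sum_le [seq k <- s | ~~ P k] b lam t.
by rewrite -E big_filter -/e; clear; lra.
Qed.

Lemma size_two_int_balls s (N L : nat) : uniq s -> (0 < L)%N ->
  (forall k, k \in s -> (absz (Posz (absz k) - Posz N)%R <= L)%N) -> (size s <= 6 * L)%N.
Proof.
move=> us L0 sN; rewrite -(count_predC (fun k => 0 <= k)) -!size_filter.
rewrite (_ : 6 * L = 3 * L + 3 * L)%N; last by clear; lia.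
apply: leq_add.
  apply: (@size_int_ball _ (Posz N)) => //; first exact: filter_uniq.
  move=> k; rewrite mem_filter => /andP[k0 /sN]; move: k0; clear; lia.
apply: (@size_int_ball _ (- Posz N)) => //; first exact: filter_uniq.
move=> k; rewrite mem_filter /= => /andP[k0 /sN]; move: k0; clear; lia.
Qed.

Lemma absz_dist_le (k k0 : int) : (absz (Posz (absz k) - Posz (absz k0))%R <= absz (k - k0))%N.
Proof. by lia. Qed.

(** An 18-fold average at the frequency of [k0], with windows of order 1 / (q^8 N^(n-1)). Within q^8
    of [k0] the frequencies are close enough for the multiplier to be at least 2^-18; where |k| is
    farther than q^9 from N they are so distant that the total contribution is bounded. *)
Lemma localize_block p n (T : R) : size p = n.+1 -> (2 <= n)%N -> 0 < T ->
  exists2 A, 0 < A & exists q0 : nat, forall (q N : nat) (k0 : int), (q0 <= q)%N ->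
  (q ^ 20 <= N)%N -> absz k0 = N -> forall s d B, uniq s -> 0 <= B ->
  (forall k, k \in s -> cmod (d k) <= B) -> exists b,
  [/\ mean_norm (T / 2) s b (freq p) <= mean_norm T s d (freq p),
      forall k, cmod (b k) <= cmod (d k),
      forall k, (absz (k - k0)%R <= q ^ 8)%N -> cmod (d k) <= 2 ^+ 18 * cmod (b k) &
      \sum_(k <- s | (q ^ 9 < absz (Posz (absz k) - Posz N)%R)%N) cmod (b k) <= A * B].
Proof.
move=> sp n2 T0; have n0 : (0 < n)%N by exact: ltnW.
have [c1 c10 [C0 C01 Hgap]] := poly_gap_lower sp n0.
have [Cs Cs0 Hup] := poly_slope_upper sp.
pose A1 := 2 * pi * Cs * 2 ^+ n.-1 / c1.
have pi0 := pi_gt0 R; have pi2 := pi_ge2 R.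
have A10 : 0 < A1 by rewrite divr_gt0 ?mulr_gt0 ?exprn_gt0.
exists (10 * A1 ^+ 18); first by rewrite mulr_gt0 ?exprn_gt0.
(* q >= [C0] makes the gap bound applicable; the other summand ensures that 18 windows fit into T /
   2. *)
exists (Num.truncn (C0 + 36 / (T * Cs))).+1 => q N k0 qq0 qN k0N s d B us B0 dB.
have CT : 0 <= 36 / (T * Cs) by rewrite divr_ge0// mulr_ge0 ?ltW.
set Q : R := q%:R; set NR : R := N%:R.
have Qbig : C0 + 36 / (T * Cs) <= Q.
  by rewrite (le_trans (ltW (truncnS_gt _)))// ler_nat.
have Q1 : 1 <= Q by move: Qbig CT C01; clear; lra.
have Q0 : 0 < Q by exact: lt_le_trans Q1.
have C0Q : C0 <= Q by move: Qbig CT; clear; lra.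
have q0 : (0 < q)%N by rewrite -(ltr0n R).
have qN' m : (m <= 20)%N -> (q ^ m <= N)%N.
  by move=> m20; rewrite (leq_trans _ qN)// leq_pexp2l.
have N0 : (0 < N)%N by rewrite (leq_trans _ qN)// expn_gt0 q0.
have N1 : 1 <= NR by rewrite ler1n.
have QX m : (0 < m)%N -> Q <= Q ^+ m by move=> m0; rewrite -[leLHS]expr1 ler_weXn2l.
pose U := Cs * 2 ^+ n.-1 * NR ^+ n.-1.
have UCs : Cs <= U.
  by rewrite /U -mulrA ler_peMr ?(ltW Cs0)// mulr_ege1// exprn_ege1// ler1n.
have U0 : 0 < U by exact: lt_le_trans UCs.
(* [U] bounds the slope of [freq p] for indices up to 2 N, so U Q^8 bounds the frequency distance on
   the inner block. The window is 1 / V. *)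
pose V := 2 * pi * (U * Q ^+ 8).
have NR0 : 0 < NR by rewrite ltr0n.
have V0 : 0 < V by rewrite /V !mulr_gt0 ?exprn_gt0.
have VT : 36 / T <= V.
  have h : 36 / T <= Cs * Q.
    have : 36 / (T * Cs) <= Q by move: Qbig C01; clear; lra.
    by rewrite invfM mulrA ler_pdivrMr// [Q * _]mulrC.
  rewrite (le_trans h)// -[leLHS]mul1r ler_pM//.
  - by rewrite mulr_ge0 ?ltW.
  - by move: pi2; clear; lra.
  - by rewrite ler_pM// ?(ltW Cs0) ?(ltW Q0)// QX.
have tau18 : 18%:R * V^-1 <= T / 2.
  rewrite ler_pdivrMr//; move: VT; rewrite ler_pdivrMr//; clear; lra.
have Vi0 : 0 < V^-1 by rewrite invr_gt0.
have [b [b1 b2 b3 b4]] := local_average (freq p) (freq p k0) s d (ltW T0) Vi0 tau18.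
have k0R : `|k0%:~R : R| = NR by rewrite -absz_int_norm k0N.
exists b; split=> //.
- move=> k hk; apply: b3.
  have hkR : `|k%:~R - k0%:~R| <= Q ^+ 8 :> R.
    by rewrite -intrB -absz_int_norm /Q -natrX ler_nat.
  have Q8N : Q ^+ 8 <= NR by rewrite /Q -natrX ler_nat qN'.
  have k2N : `|k%:~R : R| <= 2 * NR.
    have -> : k%:~R = (k%:~R - k0%:~R) + k0%:~R :> R by rewrite subrK.
    rewrite (le_trans (ler_normD _ _))// k0R.
    by move: hkR Q8N; clear; lra.
  have N2 : 1 <= 2 * NR by move: N1; clear; lra.
  have k02 : `|k0%:~R : R| <= 2 * NR by rewrite k0R; move: N1; clear; lra.
  have := Hup _ _ _ k2N k02 N2; rewrite -/(freq p k) -/(freq p k0) => h.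
  rewrite mulrA ler_pdivrMr// mul1r /V ler_wpM2l ?mulr_ge0 ?(ltW pi0)//.
  by rewrite (le_trans h)// /U exprMn mulrA ler_wpM2l// ltW// -mulrA.
- pose X := A1 * Q ^+ 8.
  have X0 : 0 <= X by rewrite mulr_ge0 ?exprn_ge0 ?(ltW A10) ?(ltW Q0).
  have q90 : (0 < q ^ 9)%N by rewrite expn_gt0 q0.
  have := @tail_sum R N (q ^ 9) 16 X s us q90 X0.
  (* The exponent 18 is chosen so that the powers of q cancel: 8 * 18 = 9 * 16. *)
  have -> : 10 * X ^+ 18 / (q ^ 9)%:R ^+ 16 = 10 * A1 ^+ 18.
    rewrite /X natrX -/Q exprMn -!exprM mulrA mulfK//.
    by rewrite expf_neq0// gt_eqF.
  move=> h.
  rewrite [leRHS]mulrC (le_trans _ (ler_wpM2l B0 h))// mulr_sumr.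
  rewrite big_seq_cond [leRHS]big_seq_cond; apply: ler_sum => k /andP[ks hk].
  set hh := absz _ in hk *.
  have hh0 : 0 < hh%:R :> R by rewrite ltr0n (leq_ltn_trans _ hk).
  have hhR : hh%:R = `|(`|k%:~R : R| - NR)|.
    by rewrite /hh absz_int_norm intrB -!pmulrn absz_int_norm.
  have C0hh : C0 <= hh%:R.
    rewrite (le_trans C0Q)// (le_trans (QX 9%N _))// /Q -natrX ler_nat.
    exact: ltnW.
  (* The gap bound takes the index of larger modulus first; in both cases that modulus is at least
     N. *)
  have lower : c1 * (NR ^+ n.-1 * hh%:R) <= `|freq p k - freq p k0|.
    have [kN|Nk] := leP `|k%:~R : R| NR.
      have hE : hh%:R = `|k0%:~R| - `|k%:~R| :> R.
        by rewrite hhR k0R distrC ger0_norm// subr_ge0.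
      by rewrite distrC -k0R hE; apply: Hgap; rewrite ?k0R// -k0R -hE.
    have hE : hh%:R = `|k%:~R| - `|k0%:~R| :> R.
      by rewrite hhR k0R ger0_norm// subr_ge0 ltW.
    rewrite (le_trans _ (Hgap k%:~R k0%:~R _ _))//; last 2 first.
    - by rewrite (le_trans N1)// ltW.
    - by rewrite -hE.
    rewrite -hE ler_wpM2l ?(ltW c10)// ler_wpM2r// lerXn2r ?nnegrE ?(le_trans ler01 N1)//.
    exact: ltW.
  have N1n : 0 < NR ^+ n.-1 by rewrite exprn_gt0// (lt_le_trans ltr01 N1).
  have low0 : 0 < c1 * (NR ^+ n.-1 * hh%:R) by rewrite !mulr_gt0.
  have x0 : 0 < `|freq p k - freq p k0| by rewrite (lt_le_trans low0).
  rewrite (le_trans (b4 k x0))// ler_pM ?cmod_ge0 ?dB//.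
    by rewrite exprn_ge0// invr_ge0 mulr_ge0// ltW.
  have Xh : 0 <= X / hh%:R by exact: divr_ge0.
  have xV : 0 <= (`|freq p k - freq p k0| / V)^-1.
    by rewrite invr_ge0 divr_ge0// ltW.
  suff : (`|freq p k - freq p k0| / V)^-1 <= X / hh%:R by move=> ?; rewrite lerXn2r.
  rewrite invfM invrK.
  apply: (@le_trans _ _ ((c1 * (NR ^+ n.-1 * hh%:R))^-1 * V)).
    by rewrite ler_wpM2r ?(ltW V0)// lef_pV2.
  rewrite le_eqVlt; apply/orP; left; apply/eqP.
  rewrite /V /X /A1 /U; field.
  by rewrite !gt_eqF.
Qed.

(** Localization followed by the L^2 bound obtained from L^1 and L^4. The bound on single
    coefficients alone would give q^8 in place of q^7. *)
Lemma block_bound p n (T : R) : size p = n.+1 -> (2 <= n)%N ->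
  injective (freq p) -> 0 < T ->
  exists2 C, 0 < C & exists q0 : nat, forall (q N : nat) (k0 : int), (q0 <= q)%N ->
  (q ^ 20 <= N)%N -> absz k0 = N -> forall s d, uniq s ->
  \sum_(k <- s | (absz (k - k0)%R <= q ^ 8)%N) cmod (d k) <=
    C * q%:R ^+ 7 * mean_norm T s d (freq p).
Proof.
move=> sp n2 inj T0; have T20 : 0 < T / 2 by rewrite divr_gt0.
have [c c0 [K gaps]] := poly_growing_gaps sp n2 inj.
have [CI CI0 HI] := ingham_coef_bound inj c0 gaps T0.
have [A A0 [K4 H4]] := fourth_moment sp n2 (ltW T20).
have [A1 A10 [q1 Hloc]] := localize_block sp n2 T0.
pose B0 := CI^-1.
have B00 : 0 < B0 by rewrite invr_gt0.
pose B2 := 1 + T / 2 * (A1 * B0).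
have B20 : 0 < B2 by rewrite /B2 ltr_pwDl// !mulr_ge0 ?ltW.
pose B5 := 72 * B0 ^+ 2 / c + B2 + A * B0 ^+ 4.
have B50 : 0 < B5.
  have : 0 < 72 * B0 ^+ 2 / c by rewrite divr_gt0// mulr_gt0// exprn_gt0.
  have : 0 < A * B0 ^+ 4 by rewrite mulr_gt0// exprn_gt0.
  by rewrite /B5; move: B20; clear; lra.
exists (2 ^+ 18 * (2 * B5 / T + 3)).
  by rewrite mulr_gt0 ?exprn_gt0// addr_gt0// divr_gt0// mulr_gt0.
(* Large enough for localization, for indices near N or -N to exceed [K] in modulus, for the fourth
   moment bound, and for 2 q^9 <= N. *)
exists (q1 + 2 * K + K4 + 2)%N => q N k0 qq0 qN k0N s d us.
set W := mean_norm T s d (freq p).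
have W0 : 0 <= W by exact: mean_norm_ge0.
have dW k : k \in s -> cmod (d k) <= B0 * W.
  move=> ks; have := HI s d k us ks; rewrite -/W => h.
  by rewrite /B0 mulrC ler_pdivlMr// mulrC.
set Q : R := q%:R.
have q2 : (2 <= q)%N by rewrite (leq_trans _ qq0)// leq_addl.
have q0 : (0 < q)%N by exact: ltnW.
have Q1 : 1 <= Q by rewrite ler1n.
have Q0 : 0 < Q by exact: lt_le_trans Q1.
(* If W = 0 all coefficients vanish; otherwise W may serve as a divisor below. *)
have [Wz|Wn0] := eqVneq W 0.
  rewrite big_seq_cond big1 ?mulr_ge0 ?exprn_ge0// => [|k /andP[ks _]].
    by rewrite addr_ge0// divr_ge0 ?ltW// mulr_gt0.
  by apply/eqP; rewrite eq_le cmod_ge0 andbT (le_trans (dW _ ks))// Wz mulr0.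
have {}W0 : 0 < W by rewrite lt_def Wn0.
have qq1 : (q1 <= q)%N by rewrite (leq_trans _ qq0)// -!addnA leq_addr.
have BW : 0 <= B0 * W by rewrite mulr_ge0 ?ltW.
have [b [b1 b2 b3 b4]] := Hloc q N k0 qq1 qN k0N s d _ us BW dW.
pose L := (q ^ 9)%N.
have L0 : (0 < L)%N by rewrite expn_gt0 q0.
pose P := fun k : int => (absz (Posz (absz k) - Posz N)%R <= L)%N.
pose s1 := [seq k <- s | P k].
have us1 : uniq s1 by exact: filter_uniq.
have s1P k : k \in s1 -> P k /\ k \in s by rewrite mem_filter => /andP.
have bW k : k \in s1 -> cmod (b k) <= B0 * W.
  by move=> /s1P[_ ks]; rewrite (le_trans (b2 k))// dW.
have mean1 : mean_norm (T / 2) s1 b (freq p) <= B2 * W.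
  rewrite (le_trans (mean_norm_filter _ _ _ _ (ltW T20)))//.
  have -> : B2 * W = W + T / 2 * (A1 * (B0 * W)) by rewrite /B2; ring.
  rewrite lerD// ler_wpM2l ?(ltW T20)// (le_trans _ b4)//.
  by under eq_bigl do rewrite /P -ltnNge.
have qK : (2 * K <= q)%N.
  by move: qq0; clear; lia.
have qK4 : (K4 <= q)%N by move: qq0; clear; lia.
have qX m : (0 < m)%N -> (q <= q ^ m)%N.
  by move=> m0; rewrite -[leqLHS]expn1 leq_pexp2l.
have KN : (K4 <= N)%N by rewrite (leq_trans qK4)// (leq_trans _ qN)// qX.
have q18N : (q ^ 18 <= N)%N by rewrite (leq_trans _ qN)// leq_pexp2l.
have KLN : (K4 * L ^ 2 <= N)%N.
  rewrite (leq_trans _ qN)// /L -expnM [in leqRHS](_ : 20 = 2 + 18)%N// expnD.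
  by rewrite leq_mul// (leq_trans qK4)// qX.
have LN : (2 * L <= N)%N.
  rewrite (leq_trans _ q18N)// /L [in leqRHS](_ : 18 = 9 + 9)%N// expnD leq_mul//.
  by rewrite (leq_trans q2)// qX.
have KNL : (2 * K <= N)%N by rewrite (leq_trans qK)// (leq_trans _ qN)// qX.
have NR0 : 0 < N%:R :> R by rewrite ltr0n (leq_trans _ q18N)// expn_gt0 q0.
have far k : P k -> (N <= 2 * absz k)%N by move: LN; rewrite /P; clear; lia.
have gap k m : k \in s1 -> m \in s1 -> k != m ->
    c * N%:R / 2 <= `|freq p k - freq p m|.
  move=> /s1P[Pk _] _ km; have kN := far k Pk.
  have KM : (K <= maxn (absz k) (absz m))%N.
    by rewrite leq_max; move: kN KNL; clear; lia.
  rewrite (le_trans _ (gaps k m km KM))// -mulrA ler_wpM2l ?(ltW c0)//.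
  rewrite ler_pdivrMr// -natrM ler_nat mulnC (leq_trans kN)// leq_mul2l leq_maxl.
  by rewrite orbT.
have I4 := H4 N L KN L0 KLN s1 b _ us1 (fun k h => (s1P k h).1) bW.
(* The threshold H = Q^6 W balances the two terms: up to constants H times the L^1 norm is Q^6 W^2,
   and so is the fourth moment W^4 Q^18 divided by H^2. *)
have H0 : 0 < Q ^+ 6 * W by rewrite mulr_gt0 ?exprn_gt0.
have g0 : 0 < c * N%:R / 2 by rewrite divr_gt0 ?mulr_gt0.
have := l2_le_l1_l4 (ltW T20) H0 g0 us1 bW gap.
set S := \sum_(k <- s1) _ => hS.
have sM : (size s1 <= 6 * L)%N by apply: (@size_two_int_balls _ N L us1 L0) => k /s1P[].
have LQ : (L%:R : R) = Q ^+ 9 by rewrite /L natrX.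
have QN : Q ^+ 18 <= N%:R by rewrite /Q -natrX ler_nat.
have Q61 : 1 <= Q ^+ 6 by rewrite exprn_ege1.
(* The off-diagonal part is harmless because the square of the block size, at most 36 q^18, is at
   most 36 N. *)
have t1 : (size s1)%:R ^+ 2 * (B0 * W) ^+ 2 / (c * N%:R / 2) <=
    72 * B0 ^+ 2 / c * (Q ^+ 6 * W ^+ 2).
  have h1 : (size s1)%:R ^+ 2 <= 36 * N%:R :> R.
    apply: (@le_trans _ _ (36 * Q ^+ 18)); last by rewrite ler_wpM2l.
    have -> : 36 * Q ^+ 18 = (6 * Q ^+ 9) ^+ 2 by rewrite exprMn -exprM; ring.
    by rewrite -LQ -natrM lerXn2r ?nnegrE// ler_nat.
  rewrite ler_pdivrMr//.
  apply: (@le_trans _ _ (36 * N%:R * (B0 * W) ^+ 2)).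
    by rewrite ler_wpM2r// sqr_ge0.
  have -> : 72 * B0 ^+ 2 / c * (Q ^+ 6 * W ^+ 2) * (c * N%:R / 2) =
      36 * N%:R * (B0 * W) ^+ 2 * Q ^+ 6 by field; rewrite gt_eqF.
  have pos : 0 <= 36 * N%:R * (B0 * W) ^+ 2 by rewrite mulr_ge0 ?sqr_ge0.
  by rewrite ler_peMr.
have t2 : Q ^+ 6 * W * mean_norm (T / 2) s1 b (freq p) <= B2 * (Q ^+ 6 * W ^+ 2).
  have -> : B2 * (Q ^+ 6 * W ^+ 2) = Q ^+ 6 * W * (B2 * W) by ring.
  by rewrite ler_wpM2l// ltW.
have t3 : int0 (T / 2) (fun t => cmod (trig_sum s1 b (freq p) t) ^+ 4) /
    (Q ^+ 6 * W) ^+ 2 <= A * B0 ^+ 4 * (Q ^+ 6 * W ^+ 2).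
  rewrite ler_pdivrMr ?exprn_gt0// (le_trans I4)// LQ.
  rewrite le_eqVlt; apply/orP; left; apply/eqP; ring.
have SB : S <= 2 * B5 / T * (Q ^+ 6 * W ^+ 2).
  rewrite mulrAC ler_pdivlMr//; move: hS t1 t2 t3; rewrite /B5; clear; lra.
pose J k : bool := (absz (k - k0)%R <= q ^ 8)%N.
have JP k : J k -> P k.
  rewrite /J /P /L -k0N => h; rewrite (leq_trans (absz_dist_le _ _))// (leq_trans h)//.
  by rewrite leq_pexp2l.
have cardJ : (size [seq k <- s | J k] <= 3 * q ^ 8)%N.
  apply: (@size_int_ball _ k0); first exact: filter_uniq.
    by rewrite expn_gt0 q0.
  by move=> k; rewrite mem_filter => /andP[].
have SJ : \sum_(k <- s | J k) cmod (b k) ^+ 2 <= S.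
  rewrite /S /s1 big_filter [leRHS](bigID J)/= -[leLHS]addr0 lerD//.
    rewrite le_eqVlt; apply/orP; left; apply/eqP; apply: eq_bigl => k.
    by case: (boolP (J k)) => [/JP ->|]; rewrite ?andbF.
  by apply: sumr_ge0 => k _; exact: sqr_ge0.
(* x <= x^2 / y + y with y = W / Q replaces the Cauchy-Schwarz inequality: summed over the block,
   both terms are of order Q^7 W. *)
have dk k : J k -> cmod (d k) <= 2 ^+ 18 * (cmod (b k) ^+ 2 * (Q / W) + W / Q).
  move=> Jk; rewrite (le_trans (b3 k Jk))// ler_wpM2l ?exprn_ge0//.
  have := cmod_ge0 (b k); move: (cmod (b k)) => x x0.
  have WQ : 0 < W / Q by rewrite divr_gt0.
  have -> : Q / W = (W / Q)^-1 by rewrite invf_div.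
  move: (W / Q) WQ => y y0; rewrite -(ler_pM2r y0) mulrDl -mulrA mulVf ?mulr1 ?gt_eqF//.
  have : 0 <= (x - y) ^+ 2 by rewrite sqr_ge0.
  have : 0 <= x * y by rewrite mulr_ge0// ltW.
  by clear; rewrite !expr2; lra.
apply: (@le_trans _ _ (\sum_(k <- s | J k) 2 ^+ 18 * (cmod (b k) ^+ 2 * (Q / W) + W / Q))).
  by apply: ler_sum => k; exact: dk.
have -> : 2 ^+ 18 * (2 * B5 / T + 3) * Q ^+ 7 * W =
    2 ^+ 18 * (2 * B5 / T * (Q ^+ 7 * W) + 3 * (Q ^+ 7 * W)).
  by move: (2 ^+ 18) (2 * B5 / T) (Q ^+ 7); clear => *; ring.
rewrite -mulr_sumr ler_wpM2l ?exprn_ge0// big_split /= -mulr_suml.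
have -> : \sum_(k <- s | J k) (W / Q) = (size [seq k <- s | J k])%:R * (W / Q).
  by rewrite -big_filter big_const_seq count_predT iter_addr_0 mulr_natl.
apply: lerD.
  apply: (@le_trans _ _ (2 * B5 / T * (Q ^+ 6 * W ^+ 2) * (Q / W))).
    by rewrite ler_wpM2r ?divr_ge0 ?(ltW Q0) ?(ltW W0)// (le_trans SJ).
  rewrite le_eqVlt; apply/orP; left; apply/eqP; field.
  by rewrite !gt_eqF.
apply: (@le_trans _ _ (3 * Q ^+ 8 * (W / Q))).
  by rewrite ler_wpM2r ?divr_ge0 ?(ltW Q0) ?(ltW W0)// /Q -natrX -natrM ler_nat.
rewrite le_eqVlt; apply/orP; left; apply/eqP; field.
by rewrite gt_eqF.
Qed.

End BlockEstimate.

(** * Dyadic summation of the block estimates *)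

Section WeightedSum.
Context {R : realType}.
Implicit Types (p : {poly R}) (s : seq int) (d : int -> R[i]).

(** With q = 2^l the centers are spaced by q^8; [sg] selects the negative ones. *)
Definition block_center (sg : bool) (l i : nat) : int :=
  if sg then - Posz (2 ^ (8 * l) * i) else Posz (2 ^ (8 * l) * i).

(** Take for l the integer part of log_2 |k| / 20, for i the quotient of |k| by 2^(8 l), and for
    [sg] whether k is negative. The remainder is less than 2^(8 l). *)
Lemma dyadic_cover (k : int) (l0 M : nat) :
  (2 ^ (20 * l0) <= absz k)%N -> (absz k < 2 ^ M)%N ->
  exists l i sg, [/\ (l0 <= l < M)%N, (2 ^ (12 * l) <= i < 2 ^ (12 * l + 20))%N,
    (2 ^ (20 * l) <= absz k)%N & (absz (k - block_center sg l i)%R <= (2 ^ l) ^ 8)%N].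
Proof.
move=> l0k kM; have k0 : (0 < absz k)%N by rewrite (leq_trans _ l0k)// expn_gt0.
have [le1 lt1] := andP (trunc_log_bounds (isT : 1 < 2)%N k0).
set e := trunc_log 2 (absz k) in le1 lt1.
pose l := (e %/ 20)%N.
have el : (20 * l <= e)%N by rewrite mulnC leq_trunc_div.
have eu : (e < 20 * l + 20)%N.
  by rewrite {1}(divn_eq e 20) -/l mulnC ltn_add2l ltn_mod.
have kl : (2 ^ (20 * l) <= absz k)%N by rewrite (leq_trans _ le1)// leq_pexp2l.
have ku : (absz k < 2 ^ (20 * l + 20))%N.
  by rewrite (leq_trans lt1)// leq_pexp2l.
pose i := (absz k %/ 2 ^ (8 * l))%N.
have p0 : (0 < 2 ^ (8 * l))%N by rewrite expn_gt0.
exists l, i, (k < 0); split => //.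
- apply/andP; split.
    have : (20 * l0 < 20 * l + 20)%N.
      by rewrite -(ltn_exp2l _ _ (isT : 1 < 2)%N) (leq_ltn_trans l0k).
    by clear; lia.
  rewrite (@leq_trans e.+1)//.
    by rewrite ltnS (leq_trans _ el)// leq_pmull.
  by rewrite -(ltn_exp2l _ _ (isT : 1 < 2)%N) (leq_ltn_trans le1).
- rewrite leq_divRL// ltn_divLR// -!expnD; apply/andP; split.
    by rewrite -mulnDl.
  by rewrite addnAC -mulnDl.
- rewrite -expnM [(l * 8)%N]mulnC /block_center.
  have := divn_eq (absz k) (2 ^ (8 * l)); have := ltn_mod (absz k) (2 ^ (8 * l)).
  rewrite p0 -/i [(i * _)%N]mulnC.
  set m := (2 ^ (8 * l) * i)%N; set r := (absz k %% _)%N; set q := (2 ^ (8 * l))%N.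
  by move: m r q; clear => m r q rq E; case: ifP; lia.
Qed.

Lemma ler_sum_nat_term (a b l : nat) (F : nat -> R) : (forall l, 0 <= F l) ->
  (a <= l < b)%N -> F l <= \sum_(a <= l < b) F l.
Proof.
move=> F0 lab; rewrite (bigD1_seq l) ?mem_index_iota ?iota_uniq//=.
by rewrite lerDl sumr_ge0.
Qed.

Lemma int_seq_bounded s : exists M, forall k, k \in s -> (absz k < 2 ^ M)%N.
Proof.
elim: s => [|x s [M ih]]; first by exists 0%N.
exists (maxn M (absz x)) => k; rewrite inE => /predU1P[->|/ih kM].
  by rewrite (leq_trans (ltn_expl (absz x) (isT : 1 < 2)%N))// leq_pexp2l// leq_maxr.
by rewrite (leq_trans kM)// leq_pexp2l// leq_maxl.
Qed.

(** Every k beyond 2^(20 l0) lies in some block, where 1 / (1 + |k|) <= 2^(-20 l). Blocks may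
    overlap, as all terms are nonnegative. *)
Lemma weighted_sum_blocks s d (l0 M : nat) :
  (forall k, k \in s -> (absz k < 2 ^ M)%N) ->
  \sum_(k <- s) cmod (d k) / (1 + `|k%:~R|) <=
  \sum_(k <- s | (absz k <= 2 ^ (20 * l0))%N) cmod (d k) +
  \sum_(l0 <= l < M) \sum_(2 ^ (12 * l) <= i < 2 ^ (12 * l + 20)) \sum_(sg : bool)
    (2 ^+ (20 * l))^-1 *
    \sum_(k <- s | (absz (k - block_center sg l i)%R <= (2 ^ l) ^ 8)%N) cmod (d k).
Proof.
move=> sM.
pose w (k : int) (l i : nat) (sg : bool) : R :=
  (absz (k - block_center sg l i)%R <= (2 ^ l) ^ 8)%N%:R * (2 ^+ (20 * l))^-1.
have w0 k l i sg : 0 <= w k l i sg.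
  by rewrite mulr_ge0// invr_ge0 exprn_ge0.
(* Summing over k last turns the block sums into a total weight of each k, of which a single block
   suffices. *)
have -> : \sum_(l0 <= l < M) \sum_(2 ^ (12 * l) <= i < 2 ^ (12 * l + 20)) \sum_(sg : bool)
    (2 ^+ (20 * l))^-1 *
    \sum_(k <- s | (absz (k - block_center sg l i)%R <= (2 ^ l) ^ 8)%N) cmod (d k) =
  \sum_(k <- s) cmod (d k) *
   \sum_(l0 <= l < M) \sum_(2 ^ (12 * l) <= i < 2 ^ (12 * l + 20)) \sum_(sg : bool) w k l i sg.
  under [RHS]eq_bigr do rewrite mulr_sumr.
  rewrite [RHS]exchange_big /=; apply: eq_bigr => l _.
  under [RHS]eq_bigr do rewrite mulr_sumr.
  rewrite [RHS]exchange_big /=; apply: eq_bigr => i _.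
  under [RHS]eq_bigr do rewrite mulr_sumr.
  rewrite [RHS]exchange_big /=; apply: eq_bigr => sg _.
  rewrite mulr_sumr big_mkcond /=; apply: eq_bigr => k _.
  by rewrite /w; case: ifP => _; [rewrite mul1r mulrC|rewrite mul0r mulr0].
rewrite [X in _ <= X + _]big_mkcond -big_split /=.
rewrite big_seq [leRHS]big_seq; apply: ler_sum => k ks.
have k1 : 1 <= 1 + `|k%:~R| :> R by rewrite lerDl.
have k10 : 0 < 1 + `|k%:~R| :> R by exact: lt_le_trans k1.
have wS : 0 <= \sum_(l0 <= l < M)
    \sum_(2 ^ (12 * l) <= i < 2 ^ (12 * l + 20)) \sum_(sg : bool) w k l i sg.
  by apply: sumr_ge0 => l _; apply: sumr_ge0 => i _; apply: sumr_ge0 => sg _.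
case: leqP => [_|kl].
  rewrite (@le_trans _ _ (cmod (d k)))//.
    by rewrite ler_pdivrMr// ler_peMr ?cmod_ge0.
  by rewrite lerDl mulr_ge0 ?cmod_ge0.
rewrite add0r ler_wpM2l ?cmod_ge0//.
have [l [i [sg [hl hi hlk hc]]]] := dyadic_cover (ltnW kl) (sM _ ks).
apply: (@le_trans _ _ (w k l i sg)).
  rewrite /w hc mul1r lef_pV2 ?posrE ?exprn_gt0// -absz_int_norm.
  rewrite (@le_trans _ _ (absz k)%:R)//; last by rewrite lerDr.
  by rewrite -natrX ler_nat.
apply: (@le_trans _ _ (\sum_(sg : bool) w k l i sg)).
  by rewrite (bigD1 sg)//= lerDl sumr_ge0.
apply: (@le_trans _ _ (\sum_(2 ^ (12 * l) <= i < 2 ^ (12 * l + 20)) \sum_(sg : bool) w k l i sg)).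
  apply: (@ler_sum_nat_term _ _ i (fun i => \sum_(sg : bool) w k l i sg)) => // j.
  exact: sumr_ge0.
apply: (@ler_sum_nat_term _ _ l (fun l =>
  \sum_(2 ^ (12 * l) <= i < 2 ^ (12 * l + 20)) \sum_(sg : bool) w k l i sg)) => // j.
by apply: sumr_ge0 => ? _; exact: sumr_ge0.
Qed.

Lemma sum_geometric_half a b : \sum_(a <= l < b) (2 ^+ l)^-1 <= 2 :> R.
Proof.
apply: (@le_trans _ _ (\sum_(0 <= l < b) (2 ^+ l)^-1)).
  have [ab|ba] := leqP a b.
    rewrite [leRHS](big_cat_nat (leq0n a) ab)//= lerDr.
    by rewrite sumr_ge0// => i _; rewrite invr_ge0 exprn_ge0.
  by rewrite big_geq ?sumr_ge0 ?(ltnW ba)// => i _; rewrite invr_ge0 exprn_ge0.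
apply: (@le_trans _ _ (2 - 2 * (2 ^+ b)^-1)); last first.
  by rewrite lerBlDr lerDl mulr_ge0// invr_ge0 exprn_ge0.
elim: b => [|b ih]; first by rewrite big_geq// expr0; lra.
rewrite big_nat_recr//= exprS invfM.
by move: ih; clear; lra.
Qed.

(** At level l there are at most 2 * 2^(12 l + 20) blocks, each contributing at most C 2^(7 l) W
    with weight 2^(-20 l): a total of order 2^-l. The at most 3 * 2^(20 l0) small indices are
    handled one by one. *)
Lemma weighted_sum_bound_finite p n (T : R) : size p = n.+1 -> (2 <= n)%N ->
  injective (freq p) -> 0 < T ->
  exists2 C, 0 < C & forall s d, uniq s ->
  C * \sum_(k <- s) cmod (d k) / (1 + `|k%:~R|) <= mean_norm T s d (freq p).
Proof.
move=> sp n2 inj T0.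
have [c c0 [K gaps]] := poly_growing_gaps sp n2 inj.
have [CI CI0 HI] := ingham_coef_bound inj c0 gaps T0.
have [C C0 [q0 Hb]] := block_bound sp n2 inj T0.
(* Since l < 2^l, [l0 <= l] implies [q0 <= 2 ^ l]. *)
pose l0 := q0.
pose A : R := 3 * 2 ^+ (20 * l0) * CI^-1 + 2 * (2 ^+ 20 * (2 * C)).
have A0 : 0 < A.
  by rewrite addr_gt0// ?mulr_gt0 ?invr_gt0 ?exprn_gt0.
exists A^-1; first by rewrite invr_gt0.
move=> s d us; rewrite ler_pdivrMl//.
set W := mean_norm _ _ _ _.
have W0 : 0 <= W by exact: mean_norm_ge0.
have dW k : k \in s -> cmod (d k) <= CI^-1 * W.
  by move=> ks; rewrite ler_pdivlMl// HI.
have [M sM] := int_seq_bounded s.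
rewrite (le_trans (weighted_sum_blocks d l0 sM))// mulrDl lerD//.
  rewrite big_seq_cond.
  rewrite (@le_trans _ _ (\sum_(k <- [seq k <- s | (absz k <= 2 ^ (20 * l0))%N]) CI^-1 * W))//.
    rewrite big_filter [leRHS]big_seq_cond; apply: ler_sum => k /andP[ks _]; exact: dW.
  rewrite big_const_seq count_predT iter_addr_0 -[leLHS]mulr_natl -[leRHS]mulrA ler_wpM2r//.
    by rewrite mulr_ge0// invr_ge0 ltW.
  rewrite -natrX -natrM ler_nat; apply: (@size_int_ball _ 0).
  - exact: filter_uniq.
  - by rewrite expn_gt0.
  - by move=> k; rewrite mem_filter subr0 => /andP[].
have blk l i sg : (l0 <= l)%N -> (2 ^ (12 * l) <= i)%N ->
    \sum_(k <- s | (absz (k - block_center sg l i)%R <= (2 ^ l) ^ 8)%N) cmod (d k) <=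
    C * 2 ^+ (7 * l) * W.
  move=> ll hi.
  have := Hb (2 ^ l)%N (2 ^ (8 * l) * i)%N (block_center sg l i).
  rewrite natrX -exprM [(l * 7)%N]mulnC; apply => //.
  - by rewrite (leq_trans ll)// ltnW// ltn_expl.
  - rewrite -expnM (leq_trans _ (leq_mul (leqnn _) hi))// -expnD -mulnDl.
    by rewrite [(l * _)%N]mulnC.
  - by rewrite /block_center; case: sg; rewrite ?abszN absz_nat.
apply: (@le_trans _ _ (\sum_(l0 <= l < M) (2 ^+ l)^-1 * (2 ^+ 20 * (2 * C) * W))); last first.
  rewrite -mulr_suml -[leRHS]mulrA ler_wpM2r ?sum_geometric_half//.
  by rewrite !mulr_ge0 ?exprn_ge0// ltW.
rewrite big_nat [leRHS]big_nat; apply: ler_sum => l /andP[ll _].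
pose X : R := (2 ^+ (20 * l))^-1 * (C * 2 ^+ (7 * l) * W).
have X0 : 0 <= X by rewrite mulr_ge0 ?invr_ge0 ?exprn_ge0// !mulr_ge0 ?exprn_ge0// ltW.
apply: (@le_trans _ _ (\sum_(2 ^ (12 * l) <= i < 2 ^ (12 * l + 20)) (2 * X))).
  rewrite big_nat [leRHS]big_nat; apply: ler_sum => i /andP[hi _].
  have -> : 2 * X = X + X by rewrite mulr_natl mulr2n.
  rewrite big_bool /=.
  apply: lerD; rewrite ler_wpM2l ?invr_ge0 ?exprn_ge0//; first exact: (blk l i true).
  exact: (blk l i false).
rewrite sumr_const_nat -[leLHS]mulr_natl.
apply: (@le_trans _ _ (2 ^+ (12 * l + 20) * (2 * X))).
  have X20 : 0 <= 2 * X by exact: mulr_ge0.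
  by rewrite ler_wpM2r// -natrX ler_nat leq_subr.
rewrite le_eqVlt; apply/orP; left; apply/eqP.
have e20 : (2 : R) ^+ (20 * l) = 2 ^+ l * (2 ^+ (12 * l) * 2 ^+ (7 * l)).
  by rewrite -!exprD; congr (_ ^+ _); clear; lia.
have [n1 n3 n4] : [/\ (2 : R) ^+ l != 0, (2 : R) ^+ (12 * l) != 0 & (2 : R) ^+ (7 * l) != 0].
  by split; rewrite expf_neq0// pnatr_eq0.
rewrite /X exprD e20; move: n1 n3 n4.
move: (2 ^+ l) (2 ^+ (12 * l)) (2 ^+ (7 * l)) (2 ^+ 20); clear => x y z t x0 y0 z0.
by field; rewrite x0 y0 z0.
Qed.

End WeightedSum.

(** * Sums over the integers as limits of symmetric partial sums *)

Section SymmetricSums.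
Context {R : realType}.
Local Open Scope complex_scope.

Lemma esum_seq_le (f : int -> R) (s : seq int) : uniq s ->
  ((\sum_(k <- s) f k)%:E <= \esum_(k in [set: int]) (f k)%:E)%E.
Proof.
move=> us; apply: esum_ge; exists [set` s].
  by split; [exact: finite_seq|].
by rewrite -fsbig_seq// sumEFin.
Qed.

Lemma esum_le_seq (f : int -> R) (x : \bar R) :
  (forall s, uniq s -> ((\sum_(k <- s) f k)%:E <= x)%E) ->
  (\esum_(k in [set: int]) (f k)%:E <= x)%E.
Proof.
move=> H; apply: ge_ereal_sup => _ [X [fX _] <-].
by rewrite fsbig_finite//= sumEFin H// finmap.fset_uniq.
Qed.

Definition sym_range (N : nat) : seq int := [seq Posz j - Posz N | j <- iota 0 (2 * N).+1].

Lemma sym_range_uniq N : uniq (sym_range N).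
Proof. by rewrite map_inj_uniq ?iota_uniq// => i j /addIr []. Qed.

Lemma mem_sym_range N k : (k \in sym_range N) = (absz k <= N)%N.
Proof.
apply/idP/idP => [/mapP[j]|kN].
  by rewrite mem_iota => jN ->; move: jN; clear; lia.
apply/mapP; exists (absz (k + Posz N)); last by move: kN; clear; lia.
by rewrite mem_iota; move: kN; clear; lia.
Qed.

Lemma sym_range_perm N M : (N <= M)%N ->
  perm_eq (sym_range N) [seq k <- sym_range M | (absz k <= N)%N].
Proof.
move=> NM; apply: uniq_perm; rewrite ?filter_uniq ?sym_range_uniq// => k.
rewrite mem_filter !mem_sym_range; apply/idP/andP => [kN|[]//].
by rewrite kN (leq_trans kN NM).
Qed.

Lemma sym_range_split (V : nmodType) (G : int -> V) N M : (N <= M)%N ->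
  \sum_(k <- sym_range M) G k =
  \sum_(k <- sym_range N) G k + \sum_(k <- sym_range M | (N < absz k)%N) G k.
Proof.
move=> NM; rewrite (perm_big _ (sym_range_perm NM)) big_filter.
rewrite (bigID (fun k => (absz k <= N)%N)); congr (_ + _).
by apply: eq_bigl => k; rewrite ltnNge.
Qed.

Lemma seq_sub_sym_range (s : seq int) : exists N, forall k, k \in s -> (absz k <= N)%N.
Proof.
by have [M H] := int_seq_bounded s; exists (2 ^ M)%N => k /H /ltnW.
Qed.

Lemma csum_intE (F : int -> R[i]) :
  csum_int F = limn (fun N => complex.Re (\sum_(k <- sym_range N) F k)) +i*
               limn (fun N => complex.Im (\sum_(k <- sym_range N) F k)).
Proof.
have E N : \sum_(j < (2 * N).+1) F (j%:Z - N%:Z) = \sum_(k <- sym_range N) F k.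
  by rewrite -(big_mkord xpredT (fun j => F (Posz j - Posz N))) /index_iota subn0 big_map.
by rewrite /csum_int /=; under eq_fun do rewrite E; under [X in _ +i* limn X]eq_fun do rewrite E.
Qed.

(* [u + A] is nondecreasing and bounded, which gives the convergence of [u]. *)
Lemma dominated_increments (u A : nat -> R) (Ainf : R) :
  (forall N M, (N <= M)%N -> `|u M - u N| <= A M - A N) -> (forall N, A N <= Ainf) ->
  cvgn u /\ forall N, `|limn u - u N| <= Ainf - A N.
Proof.
move=> uA AA.
have ndA : nondecreasing_seq A.
  by move=> N M NM; rewrite -subr_ge0 (le_trans _ (uA _ _ NM)).
have cA : cvgn A.
  apply: nondecreasing_is_cvgn => //; exists Ainf => _ [N _ <-]; exact: AA.
have cuA : cvgn (fun N => u N + A N).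
  apply: nondecreasing_is_cvgn.
    by move=> N M NM; have := uA _ _ NM; rewrite ler_norml => /andP[]; lra.
  exists (u 0%N + 2 * Ainf - A 0%N) => _ [N _ <-].
  have := uA 0%N N (leq0n _); rewrite ler_norml => /andP[_].
  by have := AA N; lra.
have cu : cvgn u.
  have -> : u = (fun N => u N + A N) \- A by apply/funext => N /=; rewrite addrK.
  exact: is_cvgB.
split=> // N; rewrite ler_distl; apply/andP; split.
  apply: limr_ge => //; near=> M.
  have NM : (N <= M)%N by near: M; exists N.
  by have := uA _ _ NM; rewrite ler_norml => /andP[]; have := AA M; lra.
apply: limr_le => //; near=> M.
have NM : (N <= M)%N by near: M; exists N.
by have := uA _ _ NM; rewrite ler_norml => /andP[]; have := AA M; lra.
Unshelve. all: by end_near. Qed.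

(** Increments of the real and of the imaginary parts are dominated by those of the partial sums of
    moduli. The factor 2 comes from |z| <= |Re z| + |Im z|. *)
Lemma csum_int_tail (F : int -> R[i]) (A : R) :
  (forall N, \sum_(k <- sym_range N) cmod (F k) <= A) -> forall N,
  cmod (csum_int F - \sum_(k <- sym_range N) F k) <=
    2 * (A - \sum_(k <- sym_range N) cmod (F k)).
Proof.
move=> FA N; pose a N := \sum_(k <- sym_range N) cmod (F k).
have incr (M' M : nat) : (M' <= M)%N ->
    cmod (\sum_(k <- sym_range M) F k - \sum_(k <- sym_range M') F k) <= a M - a M'.
  move=> MM; rewrite /a !(sym_range_split _ MM) ![_ + _ - _]addrAC !subrr !add0r.
  exact: ler_cmod_sum.
have ReB z w : complex.Re z - complex.Re w = complex.Re (z - w :> R[i]).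
  by case: z; case: w.
have ImB z w : complex.Im z - complex.Im w = complex.Im (z - w :> R[i]).
  by case: z; case: w.
have [_ hRe] := @dominated_increments
  (fun N => complex.Re (\sum_(k <- sym_range N) F k)) a A
  (fun M' M MM =>
    le_trans (eq_ind_r (fun x => `|x| <= _) (ler_Re_cmod _) (ReB _ _)) (incr M' M MM)) FA.
have [_ hIm] := @dominated_increments
  (fun N => complex.Im (\sum_(k <- sym_range N) F k)) a A
  (fun M' M MM =>
    le_trans (eq_ind_r (fun x => `|x| <= _) (ler_Im_cmod _) (ImB _ _)) (incr M' M MM)) FA.
rewrite (le_trans (cmod_le_ReIm _))// -ReB -ImB csum_intE /=.
by have := hRe N; have := hIm N; rewrite /a; lra.
Qed.

Lemma csum_int_const (F : int -> R[i]) (z : R[i]) (N0 : nat) :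
  (forall N, (N0 <= N)%N -> \sum_(k <- sym_range N) F k = z) -> csum_int F = z.
Proof.
move=> H; rewrite csum_intE.
have hz (g : R[i] -> R) : limn (fun N => g (\sum_(k <- sym_range N) F k)) = g z.
  apply: lim_near_cst => //; near=> N.
  by rewrite H//; near: N; exists N0.
by rewrite !hz; case: z {H hz}.
Unshelve. all: by end_near. Qed.

(** The partial sums converge uniformly in t, since their tails are controlled by A minus the
    partial sums of moduli. A lower bound valid for all late truncations therefore passes to the
    limit. *)
Lemma le_integral_csum (T v A : R) (d : int -> R[i]) (lam : int -> R) (N0 : nat) :
  0 <= T ->
  (forall N, \sum_(k <- sym_range N) cmod (d k) <= A) ->
  (forall e, 0 < e -> exists N1, forall N, (N1 <= N)%N ->
     A - \sum_(k <- sym_range N) cmod (d k) <= e) ->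
  (forall N, (N0 <= N)%N -> v <= mean_norm T (sym_range N) d lam) ->
  (v%:E <= \int[lebesgue_measure]_(t in `[0%R, T])
     (cmod (csum_int (fun k => d k * cexp2pi (lam k * t))))%:E)%E.
Proof.
move=> T0 dA dA0 vN.
pose f t := cmod (csum_int (fun k => d k * cexp2pi (lam k * t))).
pose g N t := cmod (trig_sum (sym_range N) d lam t).
have cE t N : \sum_(k <- sym_range N) cmod (d k * cexp2pi (lam k * t)) =
    \sum_(k <- sym_range N) cmod (d k).
  by apply: eq_bigr => k _; rewrite cmodM cmod_cexp2pi mulr1.
have fg N t : cmod (csum_int (fun k => d k * cexp2pi (lam k * t)) -
    trig_sum (sym_range N) d lam t) <= 2 * (A - \sum_(k <- sym_range N) cmod (d k)).
  rewrite -(cE t); apply: csum_int_tail => M; rewrite cE; exact: dA.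
have fg1 N t : `|f t - g N t| <= 2 * (A - \sum_(k <- sym_range N) cmod (d k)).
  have h1 := fg N t; rewrite /f /g; set z := csum_int _ in h1 *; set w := trig_sum _ _ _ _ in h1 *.
  have h2 := ler_cmodD (z - w) w; rewrite subrK in h2.
  have h3 := ler_cmodD (w - z) z; rewrite subrK in h3.
  have h4 : cmod (w - z) = cmod (z - w) by rewrite -cmodN opprB.
  by rewrite ler_norml; move: h1 h2 h3; rewrite h4; clear; lra.
have mg N : measurable_fun `[0%R, T] (g N).
  have := continuous_integrable T (continuous_cmod_trig (s := sym_range N) (d := d) (lam := lam)).
  by move=> /measurable_int /measurable_realfun.measurable_EFinP.
(* [f] is measurable as a pointwise limit of continuous functions. *)
have mf : measurable_fun `[0%R, T] f.
  apply: (measurable_realfun.measurable_fun_cvg (h := g)) => // t _.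
  apply/cvgrPdist_le => e e0.
  have [|N1 HN1] := dA0 (e / 2); first by rewrite divr_gt0.
  exists N1 => // N /= N1N; rewrite (le_trans (fg1 N t))//.
  by have := HN1 N N1N; clear; lra.
have f0 t : 0 <= f t by exact: cmod_ge0.
apply/lee_addgt0Pr => e e0.
(* The pointwise error is then at most e / (T + 1), and its integral at most e; T + 1 is positive
   also for T = 0. *)
have [|N1 HN1] := dA0 (e / (2 * (T + 1))).
  by rewrite divr_gt0// mulr_gt0//; move: T0; clear; lra.
pose N := maxn N0 N1.
pose ep := e / (T + 1).
have T1 : 0 < T + 1 by move: T0; clear; lra.
have ep0 : 0 <= ep by rewrite divr_ge0// ltW.
have gf t : g N t <= f t + ep.
  have h1 := fg1 N t; have h2 := HN1 N (leq_maxr _ _).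
  have h3 : ep = 2 * (e / (2 * (T + 1))) by rewrite /ep; field; rewrite gt_eqF.
  have := ler_norm (g N t - f t); rewrite distrC in h1.
  by move: h1 h2; rewrite h3; clear; lra.
have intg : (mean_norm T (sym_range N) d lam)%:E =
    (\int[lebesgue_measure]_(t in `[0%R, T]) (g N t)%:E)%E.
  rewrite /mean_norm /int0 /Rintegral fineK//; apply: integrable_fin_num => //.
  by apply: continuous_integrable; exact: continuous_cmod_trig.
apply: (@le_trans _ _ ((mean_norm T (sym_range N) d lam)%:E)).
  by rewrite lee_fin vN// leq_maxl.
rewrite intg.
apply: (@le_trans _ _ (\int[lebesgue_measure]_(t in `[0%R, T]) ((f t)%:E + ep%:E))%E).
  apply: ge0_le_integral => //=.
  - by move=> t _; rewrite lee_fin cmod_ge0.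
  - by apply/measurable_realfun.measurable_EFinP; exact: mg.
  - by apply: emeasurable_funD; [exact/measurable_realfun.measurable_EFinP|exact: measurable_cst].
  - by move=> t _; rewrite -EFinD lee_fin.
rewrite ge0_integralD//=; last 2 first.
- by move=> t _; rewrite lee_fin.
- exact/measurable_realfun.measurable_EFinP.
rewrite leeD2l// integral_cst//= lebesgue_measure_itv/= lte_fin.
case: ifP => [_|_]; last by rewrite mule0 lee_fin ltW.
rewrite oppr0 adde0 -EFinM lee_fin /ep mulrAC ler_pdivrMr//.
by rewrite ler_pM2l//; clear; lra.
Qed.

End SymmetricSums.

(** * The solution along a line, and both lower bounds for a outside E *)

Section LineRestriction.
Context {R : realType}.
Local Open Scope complex_scope.
Implicit Types (P : {poly R}) (a T : R).

Definition line_poly P a : {poly R} := a *: 'X - P.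

(** The coefficients d_k of the restriction to the line: the starting point (t0, x0) enters only
    through phases. *)
Definition line_coef P (t0 x0 : R) (c : int -> R[i]) (k : int) : R[i] :=
  c k * cexp2pi (- (P.[k%:~R] * t0)) * cexp2pi (k%:~R * x0).

Lemma cmod_line_coef P t0 x0 c k : cmod (line_coef P t0 x0 c k) = cmod (c k).
Proof. by rewrite !cmodM !cmod_cexp2pi !mulr1. Qed.

Lemma size_line_poly P a n : size P = n.+1 -> (2 <= n)%N -> size (line_poly P a) = n.+1.
Proof.
move=> sP n2; rewrite /line_poly addrC size_polyDl size_polyN ?sP//.
rewrite (leq_ltn_trans (size_scale_leq _ _))// size_polyX.
by rewrite ltnS.
Qed.

Lemma freq_line_poly P a k : freq (line_poly P a) k = a * k%:~R - P.[k%:~R].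
Proof. by rewrite /freq /line_poly !hornerE. Qed.

(** [Qpoly] is the divided difference of P: each x^l - y^l is factored, and the constant terms
    cancel. *)
Lemma horner_sub_Qpoly P n k m : size P = n.+1 ->
  P.[k%:~R] - P.[m%:~R] = (k - m)%:~R * Qpoly n P k m.
Proof.
move=> sP; rewrite !horner_coef sP -sumrB /Qpoly.
rewrite -(big_mkord xpredT (fun i => P`_i * k%:~R ^+ i - P`_i * m%:~R ^+ i)).
rewrite big_ltn// !expr0 subrr add0r mulr_sumr; apply: eq_bigr => l _.
rewrite -mulrBr subrXX intrB mulrCA; congr (_ * (_ * _)).
by rewrite big_mkord; apply: eq_bigr => i _; rewrite subn1.
Qed.

Lemma freq_line_poly_sub P n a k m : size P = n.+1 ->
  freq (line_poly P a) k - freq (line_poly P a) m = (k - m)%:~R * (a - Qpoly n P k m).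
Proof.
move=> sP; rewrite !freq_line_poly mulrBr -(horner_sub_Qpoly _ _ sP) intrB.
by ring.
Qed.

Lemma freq_line_poly_inj P n a : size P = n.+1 -> ~ Eset n P a ->
  injective (freq (line_poly P a)).
Proof.
move=> sP aE k m /eqP; rewrite -subr_eq0 (freq_line_poly_sub _ _ _ sP) mulf_eq0.
rewrite intr_eq0 subr_eq0 => /orP[/eqP//|]; rewrite subr_eq0 => /eqP aQ.
have [//|km] := eqVneq k m.
by exfalso; apply: aE; exists k, m.
Qed.

Lemma solution_on_line P a t0 x0 u0 t :
  solution P u0 (t0 + t) (x0 + a * t) =
  csum_int (fun k => line_coef P t0 x0 (fourier_coef u0) k *
    cexp2pi (freq (line_poly P a) k * t)).
Proof.
congr csum_int; apply/funext => k; rewrite /line_coef freq_line_poly.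
rewrite -!mulrA -!cexp2piD; congr (_ * cexp2pi _); ring.
Qed.

(** [A] is the limit of the nondecreasing partial sums, which are bounded by the finite total
    sum. *)
Lemma wiener_partial_sums (u0 : R -> R[i]) : wiener_algebra u0 -> exists A,
  (forall N, \sum_(k <- sym_range N) cmod (fourier_coef u0 k) <= A) /\
  (forall e, 0 < e -> exists N1, forall N, (N1 <= N)%N ->
     A - \sum_(k <- sym_range N) cmod (fourier_coef u0 k) <= e).
Proof.
move=> [_ fin]; pose S N := \sum_(k <- sym_range N) cmod (fourier_coef u0 k).
have ndS : nondecreasing_seq S.
  move=> N M NM; rewrite /S (sym_range_split _ NM) lerDl sumr_ge0// => k _.
  exact: cmod_ge0.
have ub N : S N <= fine (\esum_(k in [set: int]) (cmod (fourier_coef u0 k))%:E)%E.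
  rewrite -lee_fin fineK ?ge0_fin_numE ?esum_seq_le ?sym_range_uniq//.
  by apply: esum_ge0 => k _; rewrite lee_fin cmod_ge0.
have cS : cvgn S.
  apply: nondecreasing_is_cvgn => //.
  by exists (fine (\esum_(k in [set: int]) (cmod (fourier_coef u0 k))%:E)%E) => _ [N _ <-].
exists (limn S); split=> [N|e e0]; first exact: nondecreasing_cvgn_le.
have /cvgrPdist_le /(_ e e0) [N1 _ H] := cS.
by exists N1 => N N1N; rewrite (le_trans (ler_norm _))// H.
Qed.

(** Transfers bounds on truncations to the solution; the phases in [line_coef] do not change the
    moduli that control the tails. *)
Lemma line_mean_ge P a T t0 x0 (u0 : R -> R[i]) (v : R) (N0 : nat) :
  wiener_algebra u0 -> 0 < T ->
  (forall N, (N0 <= N)%N -> v <= mean_norm T (sym_range N)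
     (line_coef P t0 x0 (fourier_coef u0)) (freq (line_poly P a))) ->
  ((T^-1 * v)%:E <= line_mean P a T t0 x0 u0)%E.
Proof.
move=> /wiener_partial_sums[A [HA HA1]] T0 H.
rewrite /line_mean EFinM lee_pmul2l ?lte_fin ?invr_gt0//.
under eq_integral do rewrite solution_on_line.
have cE N : \sum_(k <- sym_range N) cmod (line_coef P t0 x0 (fourier_coef u0) k) =
    \sum_(k <- sym_range N) cmod (fourier_coef u0 k).
  by apply: eq_bigr => k _; rewrite cmod_line_coef.
apply: (@le_integral_csum R T v A _ _ N0 (ltW T0)) => // [N|e /HA1[N1 HN1]].
  by rewrite cE.
by exists N1 => N /HN1; rewrite cE.
Qed.

Lemma max_bound_holds P n a T : size P = n.+1 -> (2 <= n)%N -> ~ Eset n P a -> 0 < T ->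
  exists C, 0 < C /\ forall t0 x0 (u0 : R -> R[i]),
    wiener_algebra u0 -> max_bound P a T t0 x0 C u0.
Proof.
move=> sP n2 aE T0; have sp := size_line_poly a sP n2.
have inj := freq_line_poly_inj sP aE.
have [c c0 [K gaps]] := poly_growing_gaps sp n2 inj.
have [CI CI0 HI] := ingham_coef_bound inj c0 gaps T0.
exists (T^-1 * CI); have C0 : 0 < T^-1 * CI by rewrite mulr_gt0 ?invr_gt0.
split=> // t0 x0 u0 wu; rewrite /max_bound -lee_pdivlMl//.
apply: ge_ereal_sup => _ [k _ <-]; rewrite lee_pdivlMl// -EFinM -mulrA.
apply: (@line_mean_ge _ _ _ _ _ _ _ (absz k)) => // N kN.
by rewrite -(cmod_line_coef P t0 x0) HI ?sym_range_uniq ?mem_sym_range.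
Qed.

(** It suffices to bound finite partial sums. Each of them is contained in every late symmetric
    range, on which the finite estimate has a constant independent of the range. *)
Lemma weighted_sum_bound_holds P n a T : size P = n.+1 -> (2 <= n)%N -> ~ Eset n P a ->
  0 < T -> exists C, 0 < C /\ forall t0 x0 (u0 : R -> R[i]),
    wiener_algebra u0 -> weighted_sum_bound P a T t0 x0 C u0.
Proof.
move=> sP n2 aE T0; have sp := size_line_poly a sP n2.
have inj := freq_line_poly_inj sP aE.
have [CW CW0 HW] := weighted_sum_bound_finite sp n2 inj T0.
exists (T^-1 * CW); have C0 : 0 < T^-1 * CW by rewrite mulr_gt0 ?invr_gt0.
split=> // t0 x0 u0 wu; rewrite /weighted_sum_bound -lee_pdivlMl//.
apply: esum_le_seq => s us; rewrite lee_pdivlMl// -EFinM -mulrA.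
have [N0 sN0] := seq_sub_sym_range s.
apply: (@line_mean_ge _ _ _ _ _ _ _ N0) => // N N0N.
rewrite (le_trans _ (HW _ _ (sym_range_uniq N)))// ler_wpM2l ?(ltW CW0)//.
under [leRHS]eq_bigr do rewrite cmod_line_coef.
apply: ler_sum_subset => // [k|k /sN0 kN].
  by rewrite divr_ge0 ?cmod_ge0// addr_ge0.
by rewrite mem_sym_range (leq_trans kN).
Qed.

End LineRestriction.

(** * Trigonometric polynomials as initial data, and the cancellation for a in E *)

Section TrigonometricPolynomials.
Context {R : realType}.
Local Open Scope complex_scope.
Implicit Types (s : seq int) (c : int -> R[i]).

Lemma cexp2pi_int (h : int) : cexp2pi (h%:~R : R) = 1.
Proof.
have one : cexp2pi (1 : R) = 1.
  by rewrite /cexp2pi mulr1 mulr_natl cos2pi sin2pi.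
have nat n : cexp2pi (n%:R : R) = 1.
  by elim: n => [|n ih]; rewrite ?cexp2pi0// -natr1 cexp2piD ih one mulr1.
case: h => n; first exact: nat.
have := cexp2piD (n.+1%:R : R) (- n.+1%:R); rewrite subrr cexp2pi0 nat mul1r => ->.
by rewrite NegzE mulrNz.
Qed.

Lemma exp_int1_int (h : int) : exp_int 1 (h%:~R : R) = (h == 0)%:R.
Proof.
have [->|h0] := eqVneq h 0; first by rewrite exp_int0.
rewrite exp_intE ?intr_eq0// mulr1.
have /eqP := cexp2pi_int h; rewrite eq_complex /cexp2pi /= => /andP[/eqP -> /eqP ->].
by rewrite subrr !mul0r.
Qed.

(** Reduced to real parts by Im z = Re (- i z). *)
Lemma int0_Im_trig (I : Type) T (s : seq I) (d : I -> R[i]) (lam : I -> R) :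
  int0 T (fun t => complex.Im (trig_sum s d lam t)) =
  complex.Im (\sum_(k <- s) d k * exp_int T (lam k)).
Proof.
have ImE z : complex.Im z = complex.Re (- 'i%C * z) :> R.
  by case: z => x y; rewrite Re_mulE /=; ring.
under eq_int0 do rewrite ImE -trig_sumZ.
rewrite int0_Re_trig ImE mulr_sumr; congr complex.Re.
by apply: eq_bigr => k _; rewrite mulrA.
Qed.

Definition trig_poly s c (x : R) : R[i] := trig_sum s c (fun k => k%:~R) x.

(** Orthogonality: the integral of e(h x) over a period is 0 for every nonzero integer h. *)
Lemma fourier_trig_poly s c j : uniq s ->
  fourier_coef (trig_poly s c) j = if j \in s then c j else 0.
Proof.
move=> us; rewrite /fourier_coef /cintegral.
have E x : trig_poly s c x * cexp2pi (- (j%:~R * x)) =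
    trig_sum s c (fun k => k%:~R - j%:~R) x by rewrite trig_sum_mod mulrC.
have -> : \int[lebesgue_measure]_(x in `[0, 1])
      complex.Re (trig_poly s c x * cexp2pi (- (j%:~R * x))) =
    complex.Re (\sum_(k <- s) c k * exp_int 1 (k%:~R - j%:~R)).
  by rewrite -int0_Re_trig; apply: eq_int0 => x; rewrite E.
have -> : \int[lebesgue_measure]_(x in `[0, 1])
      complex.Im (trig_poly s c x * cexp2pi (- (j%:~R * x))) =
    complex.Im (\sum_(k <- s) c k * exp_int 1 (k%:~R - j%:~R)).
  by rewrite -int0_Im_trig; apply: eq_int0 => x; rewrite E.
set z := \sum_(k <- s) _; rewrite (_ : _ +i* _ = z); last by case: z.
rewrite /z; under eq_bigr do rewrite -intrB exp_int1_int subr_eq0.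
case: ifPn => js.
  rewrite (bigD1_seq j)//= eqxx mulr1 big1 ?addr0// => k kj.
  by rewrite (negbTE kj) mulr0.
rewrite big_seq big1// => k ks; case: eqP => [kj|]; last by rewrite mulr0.
by rewrite -kj ks in js.
Qed.

Lemma trig_poly_wiener s c : uniq s -> wiener_algebra (trig_poly s c).
Proof.
move=> us; split.
  split.
  - move=> x; apply: eq_bigr => k _.
    by rewrite mulrDr mulr1 cexp2piD cexp2pi_int mulr1.
  - apply: (@continuous_integrable R 1 (fun x => complex.Re (trig_poly s c x))).
    exact: continuous_Re_trig.
  - apply: (@continuous_integrable R 1 (fun x => complex.Im (trig_poly s c x))).
    exact: continuous_Im_trig.
apply: (@le_lt_trans _ _ (\sum_(k <- s) cmod (c k))%:E); last exact: ltry.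
apply: esum_le_seq => s' us'; rewrite lee_fin.
under eq_bigr do rewrite fourier_trig_poly//.
apply: (@le_trans _ _ (\sum_(k <- [seq k <- s' | k \in s]) cmod (c k))).
  rewrite big_filter [leRHS]big_mkcond; apply: ler_sum => k _.
  by case: ifP => //; rewrite cmod0.
apply: ler_sum_subset; first by move=> k; exact: cmod_ge0.
  exact: filter_uniq.
by move=> k; rewrite mem_filter => /andP[].
Qed.

Lemma csum_int_finite s (F : int -> R[i]) : uniq s ->
  (forall k, k \notin s -> F k = 0) -> csum_int F = \sum_(k <- s) F k.
Proof.
move=> us F0; have [N0 sN0] := seq_sub_sym_range s.
apply: (@csum_int_const _ _ _ N0) => N N0N.
rewrite (bigID (fun k => k \in s))/= [X in _ + X]big1 ?addr0; last by move=> k /F0.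
rewrite -big_filter; apply: perm_big; apply: uniq_perm => //.
  by rewrite filter_uniq// sym_range_uniq.
move=> k; rewrite mem_filter mem_sym_range; apply/andP/idP => [[]//|ks].
by rewrite ks (leq_trans (sN0 _ ks)).
Qed.

(** If a = Q(k, m) with k <> m, the frequencies of the waves k and m along the line coincide, so
    opposite coefficients cancel for all t. *)
Lemma vanishing_on_line (P : {poly R}) n a t0 x0 : size P = n.+1 -> Eset n P a ->
  exists u0 : R -> R[i], [/\ wiener_algebra u0,
    exists k, cmod (fourier_coef u0 k) = 1 &
    forall t, solution P u0 (t0 + t) (x0 + a * t) = 0].
Proof.
move=> sP [k [m [km aQ]]].
have mk : (m == k) = false by rewrite eq_sym (negbTE km).
(* The phases undo those of [line_coef], so that the restricted coefficients are exactly 1 and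
   -1. *)
pose c (j : int) : R[i] := (if j == k then 1 else - 1) *
  (cexp2pi (P.[j%:~R] * t0) * cexp2pi (- (j%:~R * x0))).
pose s := [:: k; m].
have us : uniq s by rewrite /= inE km.
exists (trig_poly s c); split.
- exact: trig_poly_wiener.
- exists k; rewrite fourier_trig_poly// mem_head /c eqxx !cmodM !cmod_cexp2pi cmod1.
  by rewrite !mulr1.
move=> t; rewrite solution_on_line (csum_int_finite us); last first.
  by move=> j js; rewrite /line_coef fourier_trig_poly// (negbTE js) !mul0r.
have dj j : j \in s -> line_coef P t0 x0 (fourier_coef (trig_poly s c)) j =
    (if j == k then 1 else - 1).
  move=> js; rewrite /line_coef fourier_trig_poly// js /c -!mulrA -!cexp2piD.
  by rewrite (_ : _ + _ = 0) ?cexp2pi0 ?mulr1//; ring.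
rewrite /s big_cons big_seq1 !dj ?mem_head ?inE ?eqxx ?orbT// mk mul1r mulN1r.
have -> : freq (line_poly P a) k = freq (line_poly P a) m.
  apply/eqP; rewrite -subr_eq0 (freq_line_poly_sub _ _ _ sP) aQ subrr mulr0.
  exact: eqxx.
exact: subrr.
Qed.

End TrigonometricPolynomials.

Theorem theorem4p1 (R : realType) (n : nat) (P : {poly R}) (a : R)
    (hn : (2 <= n)%N) (hP : size P = n.+1) :
  (~ Eset n P a ->
     (forall T : R, 0 < T -> exists C : R, 0 < C /\
        forall (t0 x0 : R) (u0 : R -> complex R),
          wiener_algebra u0 -> max_bound P a T t0 x0 C u0) /\
     (~~ odd n ->
      forall T : R, 0 < T -> exists C : R, 0 < C /\
        forall (t0 x0 : R) (u0 : R -> complex R),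
          wiener_algebra u0 -> weighted_sum_bound P a T t0 x0 C u0)) /\
  (Eset n P a ->
     forall (t0 x0 T : R), 0 < T ->
       ~ (exists C : R, 0 < C /\
            forall u0 : R -> complex R,
              wiener_algebra u0 -> max_bound P a T t0 x0 C u0) /\
       ~ (exists C : R, 0 < C /\
            forall u0 : R -> complex R,
              wiener_algebra u0 -> weighted_sum_bound P a T t0 x0 C u0)).
Proof.
split=> [aE|aE t0 x0 T T0].
  split=> [T T0|_ T T0]; first exact: max_bound_holds hP hn aE T0.
  exact: weighted_sum_bound_holds hP hn aE T0.
have [u0 [wu [k ck] u0line]] := vanishing_on_line t0 x0 hP aE.
have mean0 : line_mean P a T t0 x0 u0 = 0%E.
  rewrite /line_mean; under eq_integral do rewrite u0line cmod0.
  by rewrite integral0 mule0.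
split=> -[C [C0 /(_ u0 wu)]].
  (* The mean along the line is 0, while the supremum is at least |c_k| = 1. *)
  rewrite /max_bound mean0 leNgt => /negP; apply.
  rewrite mule_gt0 ?lte_fin//; apply: (@lt_le_trans _ _ 1%E); first by rewrite lte01.
  by apply: ereal_sup_ubound; exists k => //; rewrite ck.
rewrite /weighted_sum_bound mean0 leNgt => /negP; apply.
rewrite mule_gt0 ?lte_fin//.
(* The single term of index k already makes the weighted sum positive. *)
have := @esum_seq_le R (fun k => cmod (fourier_coef u0 k) / (1 + `|k%:~R|)) [:: k] isT.
apply: lt_le_trans; rewrite big_seq1 ck lte_fin divr_gt0// ltr_pwDl//.
Qed.
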